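(* Let $f\in\mathcal{D}_2(\mathbf{L}_{q,\mathfrak{I}_N})$ be a solution of $\mathbf{L}_{q,\mathfrak{I}_N}f=0$ with $f(x)\neq0$ for all $x\in[0,b]$ and $f(0)=1$, and set $h=f'(0)$. The operator $\mathbf{T}^f_{\mathfrak{I}_N}$ is a transmutation operator for the pair $\mathbf{L}_{q,\mathfrak{I}_N}$, $-D^2$ in $H^2(-b,b)$, that is, $\mathbf{T}^f_{\mathfrak{I}_N}\left(H^2(-b,b)\right)\subset\mathcal{D}_2(\mathbf{L}_{q,\mathfrak{I}_N})$ and $$\mathbf{L}_{q,\mathfrak{I}_N}\mathbf{T}^f_{\mathfrak{I}_N}u=-\mathbf{T}^f_{\mathfrak{I}_N}D^2u\qquad\forall u\in H^2(-b,b).$$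
   Context: Let $b>0$, let $q\in L_2(0,b)$ be complex valued, $N\in\mathbb{N}$, $0<x_1<\dots<x_N<b$, $\alpha_1,\dots,\alpha_N\in\mathbb{C}\setminus\{0\}$, $x_0=0$, $x_{N+1}=b$, $\mathfrak{I}_N=\{(x_j,\alpha_j)\}_{j=1}^N$, $D=\frac{d}{dx}$. $\mathcal{D}_2(\mathbf{L}_{q,\mathfrak{I}_N})$ is the set of $u\in AC[0,b]$ such that $u|_{(x_k,x_{k+1})}\in H^2(x_k,x_{k+1})$ for $k=0,\dots,N$ and $u'(x_k+)-u'(x_k-)=\alpha_ku(x_k)$ for $k=1,\dots,N$. For $u$ in this set the distribution $\mathbf{L}_{q,\mathfrak{I}_N}u=-u''+\left(q+\sum_{k=1}^N\alpha_k\delta(x-x_k)\right)u$ is the $L_2(0,b)$ function equal to $-u''+qu$ a.e. on each $(x_k,x_{k+1})$. A solution of $\mathbf{L}_{q,\mathfrak{I}_N}u=\lambda u$ is a function $u\in\mathcal{D}_2(\mathbf{L}_{q,\mathfrak{I}_N})$ satisfying $-u''+qu=\lambda u$ a.e. on each $(x_k,x_{k+1})$. For $h\in\mathbb{C}$, $K^h_{\mathfrak{I}_N}(x,t)$, $0<x\le b$, $|t|\le x$, is the transmutation kernel: the ($\rho$-independent) kernel with $K^h_{\mathfrak{I}_N}\in L_\infty$ and $K^h_{\mathfrak{I}_N}(x,\cdot)\in L_2(-x,x)$ such that $e^h_{\mathfrak{I}_N}(\rho,x)=e^{i\rho x}+\int_{-x}^xK^h_{\mathfrak{I}_N}(x,t)e^{i\rho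 t}dt$ for all $\rho\in\mathbb{C}$, where $e^h_{\mathfrak{I}_N}(\rho,\cdot)$ is the solution of $\mathbf{L}_{q,\mathfrak{I}_N}u=\rho^2u$ with $e^h_{\mathfrak{I}_N}(\rho,0)=1$, $(e^h_{\mathfrak{I}_N})'(\rho,0)=i\rho+h$. Such a kernel exists. For $h=f'(0)$, write $K^f_{\mathfrak{I}_N}=K^h_{\mathfrak{I}_N}$; the canonical transmutation operator is $\mathbf{T}^f_{\mathfrak{I}_N}u(x)=u(x)+\int_{-x}^xK^f_{\mathfrak{I}_N}(x,t)u(t)dt$, $x\in[0,b]$, for $u$ defined on $(-b,b)$. *)

(* Defs.v *)
From HB Require Import structures.
From mathcomp Require Import all_boot all_order all_algebra.
From mathcomp Require Import all_classical all_reals all_analysis.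
From mathcomp Require Import complex.
Import Order.TTheory GRing.Theory Num.Theory.
Import numFieldNormedType.Exports.

Set Implicit Arguments.
Unset Strict Implicit.
Unset Printing Implicit Defensive.

Local Open Scope classical_set_scope.
Local Open Scope ring_scope.
Local Open Scope complex_scope.

Section ComplexValued.
Context {R : realType}.
Local Notation mu := (@lebesgue_measure R).
Implicit Types (A : set R) (a b : R) (u v w : R -> R[i]).

Definition cexp (z : R[i]) : R[i] :=
  (expR (complex.Re z))%:C * (cos (complex.Im z) +i* sin (complex.Im z)).

Definition cintegral A u : R[i] :=
  (\int[mu]_(x in A) complex.Re (u x)) +i* (\int[mu]_(x in A) complex.Im (u x)).

(* A complex function is in L_p iff its real and imaginary parts are;
   f \_ A is the extension by zero of the restriction of f to A. *)
Definition in_L2 A u : Prop :=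
  ((fun x => complex.Re (u x)) \_ A \in Lfun mu 2%:E) /\
  ((fun x => complex.Im (u x)) \_ A \in Lfun mu 2%:E).

Definition in_Loo2 (A : set (R * R)) (F : R -> R -> R[i]) : Prop :=
  ((fun p : R * R => complex.Re (F p.1 p.2)) \_ A \in Lfun (mu \x mu)%E +oo%E) /\
  ((fun p : R * R => complex.Im (F p.1 p.2)) \_ A \in Lfun (mu \x mu)%E +oo%E).

Definition ccontinuous_on A u : Prop :=
  {within A, continuous (fun x => complex.Re (u x))} /\
  {within A, continuous (fun x => complex.Im (u x))}.

Definition abs_cont a b u : Prop :=
  forall e : R, 0 < e -> exists2 d : R, 0 < d &
    forall (n : nat) (s t : 'I_n -> R),
      (forall i, [/\ a <= s i, s i <= t i & t i <= b]) ->
      (forall i j, i != j -> t i <= s j \/ t j <= s i) ->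
      \sum_(i < n) (t i - s i) < d ->
      \sum_(i < n) `|u (t i) - u (s i)| < e%:C.

(* C_c^oo(a,b) *)
Definition test_function a b (phi : R -> R) : Prop :=
  (forall (n : nat) (x : R), derivable (phi^`(n))%classic x 1) /\
  exists c d : R, [/\ a < c, d < b & forall x, x \notin `[c, d] -> phi x = 0].

(* v is the weak derivative of u on (a,b); real test functions suffice by
   linearity. *)
Definition weak_derivative a b u v : Prop :=
  forall phi, test_function a b phi ->
    cintegral `]a, b[ (fun x => u x * (phi^`()%classic x)%:C) =
    - cintegral `]a, b[ (fun x => v x * (phi x)%:C).

(* u belongs to H^2(a,b), with u' = v and u'' = w. *)
Definition H2_derivatives a b u v w : Prop :=
  [/\ in_L2 `]a, b[ u, in_L2 `]a, b[ v, in_L2 `]a, b[ w,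
      weak_derivative a b u v & weak_derivative a b v w].

Definition in_H2 a b u : Prop := exists v w, H2_derivatives a b u v w.

Definition second_derivative a b u w : Prop :=
  exists v, H2_derivatives a b u v w.

(* u'(x+) = d and u'(x-) = d: one-sided limits of the classical derivative,
   which exists near x on the given side when u is continuous and H^2 there. *)
Definition derivative_right u (x : R) (d : R[i]) : Prop :=
  (((fun y => complex.Re (u y))^`()%classic y @[y --> x^'+] --> complex.Re d) /\
   ((fun y => complex.Im (u y))^`()%classic y @[y --> x^'+] --> complex.Im d)).

Definition derivative_left u (x : R) (d : R[i]) : Prop :=
  (((fun y => complex.Re (u y))^`()%classic y @[y --> x^'-] --> complex.Re d) /\
   ((fun y => complex.Im (u y))^`()%classic y @[y --> x^'-] --> complex.Im d)).

End ComplexValued.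

(* The points are xs 0 = 0 < xs 1 < ... < xs N < xs N.+1 = b; the strengths are
   alpha 1, ..., alpha N. All other values of xs and alpha are irrelevant. *)
Definition interactions (R : realType) (b : R) (N : nat)
    (xs : nat -> R) (alpha : nat -> R[i]) : Prop :=
  [/\ xs 0%N = 0, xs N.+1 = b,
      forall k, (k <= N)%N -> xs k < xs k.+1
    & forall k, (1 <= k <= N)%N -> alpha k != 0].

Section Operator.
Context {R : realType}.
Variables (b : R) (q : R -> R[i]) (N : nat) (xs : nat -> R)
  (alpha : nat -> R[i]).
Local Notation mu := (@lebesgue_measure R).
Implicit Types (u g : R -> R[i]) (K : R -> R -> R[i]).

(* D_2(L); absolute continuity makes u the continuous representative on each
   subinterval, so its values at the points are meaningful. *)
Definition in_domain u : Prop :=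
  [/\ abs_cont 0 b u,
      forall k, (k <= N)%N -> in_H2 (xs k) (xs k.+1) u
    & forall k, (1 <= k <= N)%N -> exists dp dm : R[i],
        [/\ derivative_right u (xs k) dp, derivative_left u (xs k) dm
          & dp - dm = alpha k * u (xs k)]].

(* For u in D_2(L): the L_2(0,b) function L u is g. *)
Definition L_equals u g : Prop :=
  in_L2 `]0, b[ g /\
  forall k, (k <= N)%N -> exists2 w,
    second_derivative (xs k) (xs k.+1) u w &
    {ae mu, forall x, x \in `]xs k, xs k.+1[ -> g x = - w x + q x * u x}.

Definition is_solution (lambda : R[i]) u : Prop :=
  in_domain u /\ L_equals u (fun x => lambda * u x).

(* The kernel does not depend on rho; e is the (unique) solution with e(0) = 1
   and e'(0) = i rho + h. *)
Definition transmutation_kernel (h : R[i]) K : Prop :=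
  [/\ in_Loo2 [set p | 0 < p.1 <= b /\ `|p.2| <= p.1] K,
      forall x, 0 < x <= b -> in_L2 `]- x, x[ (K x)
    & forall rho : R[i], exists e : R -> R[i],
        [/\ is_solution (rho ^+ 2) e, e 0 = 1,
            derivative_right e 0 ('i%C * rho + h)
          & forall x, 0 < x <= b ->
              e x = cexp ('i%C * rho * x%:C) +
                cintegral `]- x, x[
                  (fun t => K x t * cexp ('i%C * rho * t%:C))]].

End Operator.

(* The value at x = b involves u b: for u in H^2(-b,b), take u continuous on
   [-b,b]. *)
Definition transmutation_operator (R : realType) (K : R -> R -> R[i])
    (u : R -> R[i]) : R -> R[i] :=
  fun x => u x + cintegral `]- x, x[ (fun t => K x t * u t).

(* Main.v *)
Require Import Defs.
From mathcomp Require Import all_boot all_order all_algebra.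
From mathcomp Require Import all_classical all_reals all_analysis.
From mathcomp Require Import measurable_realfun ess_sup_inf complex ring lra.
Import Order.TTheory GRing.Theory Num.Theory.
Import numFieldNormedType.Exports.

(**
Write [V = T u] for the transmuted function. Membership of [V] in the domain,
together with [L V = - T u''], follows from one integrated equation, [piecewise]:
on each interval between two interaction points, [V] is the double primitive of
[w = q (T u) + T u''] starting from its value and right derivative at the left
end; the right derivative at 0 is [u'(0) + h u(0)], and at an interaction point
it is the left derivative plus [alpha V]. A double primitive of an L^2 function
is of class H^2 with the expected derivatives ([cprim2_H2], [derivative_ends])
and is Lipschitz, so the equation gives both conclusions ([piecewise_in_domain],
[piecewise_L_equals]).

The equation holds for exponentials. By the definition of the kernel at
[rho = - i s], the image of [exp (s x)] solves [L e = - s^2 e] with [e(0) = 1]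
and [e'(0) = s + h]; and any solution satisfies the integrated equation
([solution_piecewise]), because a continuous function of class H^2 is a double
primitive of its second derivative ([second_derivative_primitive]).

The general case is a density argument. The function [u] is determined by
[r = u''] up to an affine function: [u(x) = A + B (x + b) + U r (x)], where
[U r] is the double primitive of [r] from [- b]. The amount [total] by which the
integrated equation fails at a given point is linear in [u], and on the
functions [U r] it is a bounded functional of [r] in [L^1(-b, b)]
([blf_total]). It vanishes on exponentials; [s = 0] gives that it vanishes on
constants, and [s -> 0] that it vanishes on [x + b] ([total_affine]).
Subtracting the affine part of [exp (s x)] shows that the functional vanishes on
every exponential [exp (s x)] with [s != 0]. These exponentials span a dense
subspace of [L^1] ([exp_total]), so it vanishes altogether ([total_zero]).

The same density result gives integration by parts for primitives of integrable
functions ([Rintegral_prim_parts]), on which the description of H^2 rests.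
Since the kernel is only essentially bounded, the estimates use an everywhere
bounded version of it, which yields the same integrals for almost every [x]
([bounded_kernel_version]).
*)

Set Implicit Arguments.
Unset Strict Implicit.
Unset Printing Implicit Defensive.

Local Open Scope classical_set_scope.
Local Open Scope ring_scope.
Local Open Scope complex_scope.

(** * Smooth functions *)

Section SmoothFunctions.
Context {R : realType}.
Implicit Types (f g : R -> R) (x : R).

(** Gives the derivative of [flat n] at 0, where the two formulas that
    define it meet. *)
Lemma is_derive_quadratic_bound f x (d C : R) :
  (forall h, `|f (x + h) - f x - d * h| <= C * h ^+ 2) -> is_derive x 1 f d.
Proof.
move=> H; have C0 : 0 <= C.
  by have := le_trans (normr_ge0 _) (H 1); rewrite expr1n mulr1.
suff L : h^-1 *: (f (h *: 1 + x) - f x) @[h --> (0:R)^'] --> d.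
  apply: DeriveDef; first by apply/cvg_ex; exists d.
  by apply/cvg_lim.
apply/cvgrPdist_le => e e0; near=> h.
have h0 : h != 0 by near: h; exact: nbhs_dnbhs_neq.
have -> : d - h^-1 *: (f (h *: 1 + x) - f x) = - h^-1 * (f (x + h) - f x - d * h).
  by rewrite /GRing.scale /= mulr1 (addrC h x); field.
rewrite normrM normrN normfV mulrC ler_pdivrMr ?normr_gt0//.
apply: (le_trans (H h)); rewrite -real_normK ?num_real// expr2 mulrA ler_wpM2r//.
have : `|h| < e / (C + 1).
  near: h; apply: dnbhs0_lt; apply: divr_gt0 => //; lra.
rewrite ltr_pdivlMr; last lra.
have := normr_ge0 h; nra.
Unshelve. all: by end_near. Qed.

(** The functions [x ^- n * exp (- 1 / x)], extended by 0 to the left, are closed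
    under differentiation up to linear combinations; this is how smoothness at
    the origin is obtained. *)
Definition flat (n : nat) x : R :=
  if 0 < x then x^-1 ^+ n * expR (- x^-1) else 0.

Lemma flat_ge0 n x : 0 <= flat n x.
Proof.
rewrite /flat; case: ifPn => // x0.
by rewrite mulr_ge0 ?expR_ge0// exprn_ge0// invr_ge0 ltW.
Qed.

(** The exponential of [1 / x] dominates the term of order [n + 2] of its Taylor
    series; the resulting quadratic bound makes the derivative at 0 vanish. *)
Lemma flat_le_sqr n x : flat n x <= n.+2`!%:R * x ^+ 2.
Proof.
rewrite /flat; case: ifPn => x0; last by rewrite mulr_ge0// sqr_ge0.
have y0 : 0 < x^-1 by rewrite invr_gt0.
have := expR_ge1Dxn n.+1 (ltW y0).
set F := (n.+2`!%:R : R); have F0 : 0 < F by rewrite ltr0n fact_gt0.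
rewrite expRN => H.
have e0 := expR_gt0 x^-1.
have {}H : x^-1 ^+ n.+2 / F <= expR x^-1 by lra.
rewrite ler_pdivrMr//; rewrite ler_pdivrMr// in H.
have : x ^+ 2 * x^-1 ^+ n.+2 <= x ^+ 2 * (expR x^-1 * F).
  by rewrite ler_wpM2l// sqr_ge0.
have -> : x ^+ 2 * x^-1 ^+ n.+2 = x^-1 ^+ n.
  by rewrite -[n.+2]addn2 exprD mulrCA -exprMn divff ?gt_eqF// expr1n mulr1.
by move=> /le_trans; apply; rewrite le_eqVlt; apply/orP; left; apply/eqP; ring.
Qed.

Lemma is_derive_flat n x :
  is_derive x 1 (flat n) (flat n.+2 x - n%:R * flat n.+1 x).
Proof.
have [x0|x0|->] := ltgtP x 0.
- rewrite /flat ltNge ltW//= mulr0 subr0.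
  apply: (@near_eq_is_derive _ _ _ (cst 0)).
  by near=> y; rewrite /flat ltNge ltW//=; near: y; exact: lt_nbhsl.
- apply: (@near_eq_is_derive _ _ _ (fun y : R => y^-1 ^+ n * expR (- y^-1))).
    near=> y; rewrite /flat ifT//; near: y; exact: lt_nbhsr.
  have D1 : is_derive x 1 (fun y : R => y^-1) (- x ^- 2).
    have xn0 : x != 0 by rewrite gt_eqF.
    by apply: is_derive_eq (@is_deriveV _ id _ _ _ xn0 (is_derive_id _ _)) _;
      rewrite /GRing.scale/= mulr1.
  have D2 : is_derive x 1 (fun y : R => expR (- y^-1)) (expR (- x^-1) * x ^- 2).
    apply: (@is_derive1_comp _ expR (fun y => - y^-1)).
    by apply: is_derive_eq; rewrite opprK.
  have D3 := @is_deriveX _ _ (fun y : R => y^-1) n x 1 _ D1.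
  rewrite exprfctE in D3.
  apply: is_derive_eq (is_deriveM D3 D2) _.
  rewrite /flat x0 /GRing.scale/= -!exprVn; case: n {D3} => [|n].
    by rewrite !expr0; ring.
  by rewrite -[n.+1.-1]/n !exprS -[n.+1]addn1 natrD; ring.
- have F0 m : flat m 0 = 0 by rewrite /flat ltxx.
  rewrite !F0 mulr0 subr0.
  apply: (@is_derive_quadratic_bound _ _ _ (n.+2`!%:R)) => h.
  by rewrite add0r F0 mul0r !subr0 ger0_norm ?flat_ge0// flat_le_sqr.
Unshelve. all: by end_near. Qed.

Definition smooth f := forall (n : nat) x, derivable (f^`(n))%classic x 1.

Lemma smooth_derive1 f : smooth f -> smooth f^`()%classic.
Proof. by move=> sf n x; rewrite -derive1Sn; exact: sf. Qed.

Lemma smooth_is_derive f x : smooth f -> is_derive x 1 f (f^`()%classic x).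
Proof. by move=> sf; apply: DeriveDef; [exact: (sf 0%N)|rewrite derive1E]. Qed.

Lemma smooth_continuous f : smooth f -> continuous f.
Proof.
move=> sf x; apply/differentiable_continuous/derivable1_diffP; exact: (sf 0%N).
Qed.

Lemma is_derive_derive1 f g : (forall x, is_derive x 1 f (g x)) ->
  f^`()%classic = g.
Proof.
move=> D; apply/funext => y; have Dy := D y.
by rewrite derive1E (@derive_val _ _ _ _ _ _ _ Dy).
Qed.

(** Smoothness by coinduction: it suffices to exhibit a class of functions that
    is stable under differentiation. *)
Lemma smooth_coind (P : (R -> R) -> Prop) :
  (forall f, P f -> exists2 f', P f' & forall x, is_derive x 1 f (f' x)) ->
  forall f, P f -> smooth f.
Proof.
move=> step f Pf n; elim: n f Pf => [|n IH] f /step[f' Pf' D] x.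
  by have := D x => -[].
by rewrite derive1Sn (is_derive_derive1 D); exact: IH.
Qed.

Lemma smooth_primitive f g :
  (forall x, is_derive x 1 g (f x)) -> smooth f -> smooth g.
Proof.
move=> D sf n x; case: n => [|n]; first by have := D x => -[].
by rewrite derive1Sn (is_derive_derive1 D); exact: sf.
Qed.

Lemma smooth_lin (k : R) f g : smooth f -> smooth g ->
  smooth (fun x => k * f x + g x).
Proof.
move=> sf sg; apply: (@smooth_coind (fun u => exists f g,
  [/\ smooth f, smooth g & u = fun x => k * f x + g x])); last by exists f, g.
move=> _ [{sf}f [{sg}g [sf sg ->]]].
exists (fun x => k * f^`()%classic x + g^`()%classic x).
  by exists f^`()%classic, g^`()%classic; split; [exact: smooth_derive1..|].
move=> x; have Df := smooth_is_derive x sf; have Dg := smooth_is_derive x sg.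
by apply: is_derive_eq.
Qed.

Lemma smooth_cst (c : R) : smooth (fun=> c).
Proof.
apply: (@smooth_coind (fun u => exists c, u = fun=> c)); last by exists c.
by move=> _ [k ->]; exists (fun=> 0) => [|x]; [exists 0|exact: is_derive_cst].
Qed.

Lemma smooth_scale (k : R) f : smooth f -> smooth (fun x => k * f x).
Proof.
move=> sf; have := @smooth_lin k _ _ sf (@smooth_cst 0).
by under eq_fun do rewrite addr0.
Qed.

Lemma smooth_affine (k c : R) f : smooth f -> smooth (fun x => f (k * x + c)).
Proof.
move=> sf; apply: (@smooth_coind (fun u => exists f l,
  smooth f /\ u = fun x => l * f (k * x + c))); last first.
  by exists f, 1; split=> //; apply/funext => x; rewrite mul1r.
move=> _ [{sf}f [l [sf ->]]].
exists (fun x => (l * k) * f^`()%classic (k * x + c)).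
  by exists f^`()%classic, (l * k); split; [exact: smooth_derive1|].
move=> x; have Df := smooth_is_derive (k * x + c) sf.
have D : is_derive x 1 (fun x => f (k * x + c)) (f^`()%classic (k * x + c) * k).
  apply: (@is_derive1_comp _ f (fun x => k * x + c)).
  by apply: is_derive_eq; rewrite /GRing.scale/= mulr1 addr0.
by apply: is_derive_eq; rewrite /GRing.scale/=; ring.
Qed.

(** Products of two smooth functions are not stable under differentiation;
    finite sums of such products are. *)
Inductive smooth_span : (R -> R) -> Prop :=
| smooth_span_mul f g : smooth f -> smooth g -> smooth_span (fun x => f x * g x)
| smooth_span_add f g : smooth_span f -> smooth_span g ->
    smooth_span (fun x => f x + g x).

Lemma smooth_mul f g : smooth f -> smooth g -> smooth (fun x => f x * g x).
Proof.
move=> sf sg; apply: (@smooth_coind smooth_span); last exact: smooth_span_mul.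
move=> u; elim=> {sf sg f g u}[f g sf sg|f g _ [f' Sf' Df] _ [g' Sg' Dg]].
  exists (fun x => f x * g^`()%classic x + g x * f^`()%classic x).
    exact: smooth_span_add (smooth_span_mul sf (smooth_derive1 sg))
                           (smooth_span_mul sg (smooth_derive1 sf)).
  by move=> x; have Df := smooth_is_derive x sf; have Dg := smooth_is_derive x sg;
    apply: is_derive_eq.
exists (fun x => f' x + g' x); first exact: smooth_span_add.
by move=> x; have := Df x; have := Dg x => ? ?; apply: is_derive_eq.
Qed.

Inductive flat_span : (R -> R) -> Prop :=
| flat_span_flat n : flat_span (flat n)
| flat_span_lin (k : R) f g : flat_span f -> flat_span g ->
    flat_span (fun x => k * f x + g x).

Lemma smooth_flat n : smooth (flat n).
Proof.
apply: (@smooth_coind flat_span); last exact: flat_span_flat.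
move=> u; elim=> {n u}[n|k f g _ [f' Sf' Df] _ [g' Sg' Dg]].
  exists (fun x => - n%:R * flat n.+1 x + flat n.+2 x).
    by apply: flat_span_lin; exact: flat_span_flat.
  by move=> x; have := is_derive_flat n x; rewrite addrC mulNr.
exists (fun x => k * f' x + g' x); first exact: flat_span_lin.
by move=> x; have := Df x; have := Dg x => ? ?; apply: is_derive_eq.
Qed.

Local Notation mu := (@lebesgue_measure R).

(** Integrating from [-oo] rather than from 0 gives a function that is
    differentiable on the whole line without distinguishing the sign of [x]. *)
Lemma primitive_from_0 f : continuous f -> (forall x, x <= 0 -> f x = 0) ->
  exists2 F : R -> R, forall x, is_derive x 1 F (f x)
                    & forall x, x <= 0 -> F x = 0.
Proof.
move=> cf f0; pose F x := \int[mu]_(t in `]-oo, x]) f t.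
have intf u : mu.-integrable `]-oo, u] (EFin \o f).
  have int0u : mu.-integrable `[0, u] (EFin \o f).
    apply: continuous_compact_integrable; first exact: segment_compact.
    exact: continuous_subspaceT.
  apply/integrable_mkcond => //.
  have -> : (EFin \o f) \_ `]-oo, u] = (EFin \o f) \_ `[0, u].
    apply/funext => x; rewrite !patchE !mem_setE !in_itv/=.
    by have [x0|x0] := leP 0 x => //=; case: ifP => //; rewrite f0// ltW.
  by apply: (integrable_mkcond _ _).1 => //; exact: measurable_itv.
exists F => [x|x x0].
  have xx1 : x < x + 1 by rewrite ltrDl.
  have [] := @continuous_FTC1 R f -oo%O x (x + 1) xx1 (intf _) (ltNyr _) (cf x).
  by move=> dF FE; apply: DeriveDef; [exact: dF|rewrite -FE derive1E].
rewrite /F (@eq_Rintegral _ _ _ _ _ (cst 0)); last first.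
  by move=> t; rewrite inE/= in_itv/= => tx; rewrite f0// (le_trans tx).
by rewrite Rintegral_cst// mul0r.
Qed.

Lemma derive0_cst_right f (a : R) : (forall x, derivable f x 1) ->
  (forall x, a <= x -> f^`()%classic x = 0) -> forall x, a <= x -> f x = f a.
Proof.
move=> df D x; rewrite le_eqVlt => /orP[/eqP->//|ax].
have [||c] := @MVT R f f^`()%classic a x ax.
- by move=> y _; apply: DeriveDef; [exact: df|rewrite derive1E].
- apply: continuous_subspaceT => y; apply/differentiable_continuous/derivable1_diffP.
  exact: df.
rewrite in_itv/= => /andP[ac _]; rewrite D ?mul0r ?ltW// => /eqP.
by rewrite subr_eq0 => /eqP.
Qed.

(** A smooth substitute [B] for the positive part [max(x, 0)]. Its second
    derivative [beta] is a bump of mass 1 in [[0, 1]], so that the second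
    derivatives of the rescaled translates of [B] form approximate identities.
    Take [beta] proportional to [flat 0 x * flat 0 (1 - x)]. *)
Lemma smooth_ramp : exists B D beta : R -> R,
  [/\ [/\ smooth B, forall x, is_derive x 1 B (D x)
      & forall x, is_derive x 1 D (beta x)],
     [/\ continuous beta, forall x, 0 <= beta x
      & forall x, (x <= 0) || (1 <= x) -> beta x = 0],
     forall x, x <= 0 -> B x = 0 /\ D x = 0
   & forall x, 1 <= x -> B x = x - (1 - B 1) /\ D x = 1].
Proof.
pose be x := flat 0 x * flat 0 (- 1 * x + 1).
have sbe : smooth be.
  by apply: smooth_mul; [exact: smooth_flat|apply: smooth_affine; exact: smooth_flat].
have be_ge0 x : 0 <= be x by rewrite mulr_ge0// flat_ge0.
have be0 x : (x <= 0) || (1 <= x) -> be x = 0.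
  rewrite /be /flat => /orP[x0|x1]; first by rewrite ltNge x0 mul0r.
  by rewrite [X in _ * X]ifF ?mulr0//; apply/negbTE; rewrite -leNgt; lra.
have be_gt0 x : 0 < x < 1 -> 0 < be x.
  move=> /andP[x0 x1]; rewrite /be /flat x0 ifT; last lra.
  by rewrite !expr0 !mul1r mulr_gt0// expR_gt0.
have be0l x : x <= 0 -> be x = 0 by move=> x0; rewrite be0// x0.
have [D0 dD0 D00] := primitive_from_0 (smooth_continuous sbe) be0l.
have sD0 := smooth_primitive dD0 sbe.
have [B0 dB0 B00] := primitive_from_0 (smooth_continuous sD0) D00.
have sB0 := smooth_primitive dB0 sD0.
have m0 : 0 < D0 1.
  rewrite -(D00 0)//; apply: (@gtr0_derive1_incr _ D0 0 1) => //.
  - by move=> x; rewrite in_itv/= (is_derive_derive1 dD0); exact: be_gt0.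
  - exact/continuous_subspaceT/smooth_continuous.
have D01 x : 1 <= x -> D0 x = D0 1.
  apply: derive0_cst_right => [y|y y1]; first exact: (sD0 0%N).
  by rewrite (is_derive_derive1 dD0) be0// y1 orbT.
pose m := (D0 1)^-1.
have dD x : is_derive x 1 (fun x => m * D0 x) (m * be x).
  by have := dD0 x => ?; apply: is_derive_eq.
have dB x : is_derive x 1 (fun x => m * B0 x) (m * D0 x).
  by have := dB0 x => ?; apply: is_derive_eq.
have m1 x : 1 <= x -> m * D0 x = 1 by move=> x1; rewrite D01// mulVf// gt_eqF.
exists (fun x => m * B0 x), (fun x => m * D0 x), (fun x => m * be x); split.
- by split; [exact: smooth_scale|exact: dB|exact: dD].
- split=> [x|x|x /be0->]; last by rewrite mulr0.
  + by apply: cvgM; [exact: cvg_cst|exact: smooth_continuous].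
  + by rewrite mulr_ge0// invr_ge0 ltW.
- by move=> x x0; rewrite B00// D00// mulr0.
- move=> x x1; split; last exact: m1.
  have dg (y : R) : is_derive y 1 (fun y : R => m * B0 y - y) (m * D0 y - 1).
    by have := dB y => ?; apply: is_derive_eq.
  have : m * B0 x - x = m * B0 1 - 1.
    apply: (@derive0_cst_right (fun y : R => m * B0 y - y)) x1 => [y|y y1].
      by have := dg y => -[].
    by rewrite (is_derive_derive1 dg) m1// subrr.
  by move=> /eqP; rewrite subr_eq => /eqP ->; ring.
Qed.

End SmoothFunctions.

(** * Integrable real functions *)

Section RealIntegrals.
Context {R : realType}.
Local Notation mu := (@lebesgue_measure R).
Local Notation mble A := (@measurable _ (measurableTypeR R) A).
Local Notation mfun A f := (@measurable_fun _ _ (measurableTypeR R) R A f).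
Implicit Types (A : set R) (f g : R -> R).

Lemma ae_imply (P Q : R -> Prop) : (forall x, P x -> Q x) ->
  {ae mu, forall x, P x} -> {ae mu, forall x, Q x}.
Proof. exact: (@filterS _ _ (ae_filter_ringOfSetsType mu)). Qed.

Lemma ae_and (P Q : R -> Prop) : {ae mu, forall x, P x} ->
  {ae mu, forall x, Q x} -> {ae mu, forall x, P x /\ Q x}.
Proof.
by move=> HP HQ; have := @filterI _ _ (ae_filter_ringOfSetsType mu) _ _ HP HQ.
Qed.

Lemma ae_neq x : {ae mu, forall y, y != x}.
Proof.
exists [set x]; split; [exact: measurable_set1|exact: lebesgue_measure_set1|].
by move=> y /= /negP; rewrite negbK => /eqP.
Qed.

Lemma integrable_dominated A f g : mble A -> mfun A f ->
  (forall x, A x -> `|f x| <= g x) -> mu.-integrable A (EFin \o g) ->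
  mu.-integrable A (EFin \o f).
Proof.
move=> mA mf fg; apply: le_integrable => //; first exact/measurable_EFinP.
by move=> x Ax /=; rewrite lee_fin (le_trans (fg _ Ax))// ler_norm.
Qed.

Lemma integrable_measurable A f : mu.-integrable A (EFin \o f) ->
  mfun A f.
Proof. by move=> /integrableP[/measurable_EFinP]. Qed.

Lemma integrable_lin A f g (k : R) : mble A ->
  mu.-integrable A (EFin \o f) -> mu.-integrable A (EFin \o g) ->
  mu.-integrable A (EFin \o (fun x => k * f x + g x)).
Proof.
move=> mA fi gi.
have kf : mu.-integrable A (fun x => k%:E * (f x)%:E)%E by exact: integrableZl.
by have := integrableD mA kf gi; apply: eq_integrable.
Qed.

Lemma integrable_cc_bounded (a c : R) f (M : R) : mfun `[a, c] f ->
  (forall x, a <= x <= c -> `|f x| <= M) ->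
  mu.-integrable `[a, c] (EFin \o f).
Proof.
move=> mf fM; apply: measurable_bounded_integrable => //=.
  by rewrite lebesgue_measure_itv/=; case: ifP => _; rewrite ?ltry// ltry.
exists M; split; rewrite ?num_real// => N MN x /=; rewrite in_itv/= => xac.
exact: le_trans (fM _ xac) (ltW MN).
Qed.

Lemma integrable_cc_cst (a c k : R) : mu.-integrable `[a, c] (EFin \o (fun=> k)).
Proof. exact: (@integrable_cc_bounded _ _ _ `|k|). Qed.

Lemma Rintegral_lin A f g (k : R) : mble A ->
  mu.-integrable A (EFin \o f) -> mu.-integrable A (EFin \o g) ->
  \int[mu]_(x in A) (k * f x + g x) =
  k * \int[mu]_(x in A) f x + \int[mu]_(x in A) g x.
Proof.
move=> mA fi gi; rewrite RintegralD//; first by rewrite RintegralZl.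
by have := integrableZl mA k fi; apply: eq_integrable.
Qed.

End RealIntegrals.

(** * Totality of the exponentials in L^1 *)

Lemma expr_onem_ge {R : realType} (t : R) (N : nat) :
  0 <= t <= 1 -> 1 - N%:R * t <= (1 - t) ^+ N.
Proof.
move=> /andP[t0 t1]; elim: N => [|N IH]; first by rewrite expr0; lra.
rewrite exprS mulrS; have N0 : 0 <= N%:R :> R by [].
have := ler_wpM2l (_ : 0 <= 1 - t) IH; rewrite subr_ge0 => /(_ t1); nra.
Qed.

(** Bernoulli's inequality applied to [(1 + t) ^ N], as [(1 - t) (1 + t) <= 1]. *)
Lemma expr_onem_le {R : realType} (t : R) (N : nat) :
  0 <= t <= 1 -> (1 - t) ^+ N <= (1 + N%:R * t)^-1.
Proof.
move=> /andP[t0 t1]; have N0 : 0 <= N%:R :> R by [].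
have D0 : 0 < 1 + N%:R * t by nra.
rewrite -[leRHS]mul1r ler_pdivlMr//.
have H1 : 1 + N%:R * t <= (1 + t) ^+ N.
  elim: {D0 N0} N => [|N IH]; first by rewrite expr0; lra.
  rewrite exprS mulrS; have N0 : 0 <= N%:R :> R by [].
  have := ler_wpM2l (_ : 0 <= 1 + t) IH; rewrite addr_ge0// => /(_ erefl); nra.
apply: le_trans (ler_wpM2l _ H1) _; first by rewrite exprn_ge0// subr_ge0.
by rewrite -exprMn exprn_ile1//; nra.
Qed.

(** The polynomials [(1 - z ^ n) ^ (k ^ n)], well known from proofs of the
    Stone-Weierstrass theorem, approximate the indicator function of
    [z < 1 / k] on [0, 1]: both bounds depend on [k ^ n * z ^ n] only. *)
Lemma cvg_step_poly {R : realType} (k : nat) (z : R) : 0 < z < 1 -> (0 < k)%N ->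
  (k%:R * z < 1 -> (1 - z ^+ n) ^+ (k ^ n) @[n --> \oo] --> (1 : R)) /\
   (1 < k%:R * z -> (1 - z ^+ n) ^+ (k ^ n) @[n --> \oo] --> (0 : R)).
Proof.
move=> /andP[z0 z1] k0; have zn n : 0 <= z ^+ n <= 1.
  by rewrite exprn_ge0 ?exprn_ile1// ltW.
have kz0 : 0 < k%:R * z by rewrite mulr_gt0// ltr0n.
split=> kz.
  apply: (@squeeze_cvgr _ _ _ _ (fun n => 1 - (k%:R * z) ^+ n) (fun=> 1)).
  - apply: nearW => n; rewrite exprMn -natrX expr_onem_ge//=.
    by have /andP[? ?] := zn n; rewrite exprn_ile1//; lra.
  - rewrite -[X in _ --> X]subr0; apply: cvgB; first exact: cvg_cst.
    by apply: cvg_expr; rewrite gtr0_norm.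
  - exact: cvg_cst.
apply: (@squeeze_cvgr _ _ _ _ (fun=> 0) (fun n => (k%:R * z)^-1 ^+ n)).
- apply: nearW => n; have /andP[? ?] := zn n.
  rewrite exprn_ge0 ?subr_ge0//=.
  apply: le_trans (expr_onem_le _ (zn n)) _.
  rewrite exprVn lef_pV2 ?posrE ?exprn_gt0//; last first.
    by rewrite ltr_pwDl// mulr_ge0.
  by rewrite exprMn -natrX lerDr.
- exact: cvg_cst.
- by apply: cvg_expr; rewrite gtr0_norm ?invr_gt0// invf_lt1.
Qed.

Section BoundedFunctionals.
Context {R : realType} (a c : R).
Local Notation mu := (@lebesgue_measure R).
Local Notation L1 f := (mu.-integrable `[a, c] (EFin \o f)).
Implicit Types (f g : R -> R).

Context (Lam : (R -> R) -> R) (C : R).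
Hypothesis Lam_lin : forall (k : R) f g, L1 f -> L1 g ->
  Lam (fun x => k * f x + g x) = k * Lam f + Lam g.
Hypothesis Lam_bnd : forall f, L1 f ->
  `|Lam f| <= C * \int[mu]_(x in `[a, c]) `|f x|.
Hypothesis Lam_exp : forall s : R, s != 0 -> Lam (fun x => expR (s * x)) = 0.

Let L1lin f g (k : R) : L1 f -> L1 g -> L1 (fun x => k * f x + g x).
Proof. by apply: integrable_lin. Qed.

(** Convergence in [L^1] follows from dominated convergence, so the kernel of
    the functional is closed under dominated pointwise limits. *)
Let Lam_dominated (f_ : nat -> R -> R) f g :
  (forall n, L1 (f_ n)) -> L1 f -> L1 g ->
  {ae mu, forall x, `[a, c]%classic x -> f_ n x @[n --> \oo] --> f x} ->
  (forall n x, a <= x <= c -> `|f_ n x| <= g x) ->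
  (forall n, Lam (f_ n) = 0) -> Lam f = 0.
Proof.
move=> f_i fi gi ff fg L0.
have mD : @measurable _ (measurableTypeR R) `[a, c] by exact: measurable_itv.
have [] := @dominated_convergence _ _ _ mu _ mD (fun n => EFin \o f_ n) (EFin \o f)
    (EFin \o g).
- by move=> n; have /integrableP[] := f_i n.
- by have /integrableP[] := fi.
- apply: ae_imply ff => x H Dx; apply: cvg_EFin; last exact: H.
  by near=> n.
- exact: gi.
- by apply: aeW => x n; rewrite /= in_itv/= lee_fin; exact: fg.
move=> _ H _; apply/eqP; rewrite -normr_le0.
apply/ler_addgt0Pr => e e0; rewrite add0r.
move/fine_cvgP : H => [_ /cvgrPdist_le/= H].
have C0 : 0 < `|C| + 1 by rewrite ltr_wpDl.
have [n _ /(_ n (leqnn n))] := H _ (divr_gt0 e0 C0).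
rewrite sub0r normrN => Hn.
have -> : Lam f = - Lam (fun x => -1 * f x + f_ n x).
  by rewrite Lam_lin// L0 addr0 mulN1r opprK.
rewrite normrN; apply: le_trans (Lam_bnd _) _; first exact: L1lin.
have -> : \int[mu]_(x in `[a, c]) `|-1 * f x + f_ n x| =
    fine (\int[mu]_(x in `[a, c]) `|(f_ n x)%:E - (f x)%:E|)%E.
  congr fine; apply: eq_integral => x _.
  by rewrite mulN1r addrC.
apply: le_trans (ler_norm _) _; rewrite normrM.
rewrite ler_pdivlMr// in Hn; apply: le_trans _ Hn; rewrite mulrC ler_wpM2l//.
by rewrite lerDl.
Unshelve. all: by end_near. Qed.

Let L1exp s : L1 (fun x => expR (s * x)).
Proof.
apply: continuous_compact_integrable; first exact: segment_compact.
apply: continuous_subspaceT => x; apply: continuous_comp; last exact: continuous_expR.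
by apply: cvgM; [exact: cvg_cst|exact: cvg_id].
Qed.

Let expR_le_bound (s x : R) : `|s| <= 1 -> a <= x <= c ->
  expR (s * x) <= expR (`|a| + `|c|).
Proof.
move=> s1 /andP[ax xc]; rewrite ler_expR.
apply: le_trans (ler_norm _) _; rewrite normrM.
have xb : `|x| <= `|a| + `|c|.
  rewrite ler_norml; have := ler_norm c; have := ler_norm (- a); rewrite normrN => *.
  have := normr_ge0 a; have := normr_ge0 c => *; apply/andP; split; lra.
by apply: le_trans (ler_pM _ _ s1 xb) _; rewrite ?mul1r.
Qed.

(** The constant 1 is the limit of [exp (x / n)], which stays bounded on
    [[a, c]]. *)
Let Lam1 : Lam (fun=> 1) = 0.
Proof.
apply: (@Lam_dominated (fun n x => expR (n.+1%:R^-1 * x)) _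
  (fun=> expR (`|a| + `|c|))) => //.
- exact: integrable_cc_cst.
- exact: integrable_cc_cst.
- apply: aeW => x _; rewrite -[X in _ --> X](@expR0 R).
  apply: continuous_cvg; first exact: continuous_expR.
  rewrite -[X in _ --> X](mul0r x); apply: cvgM; last exact: cvg_cst.
  exact: cvg_harmonic.
- move=> n x xac; rewrite ger0_norm ?expR_ge0//; apply: expR_le_bound => //.
  by rewrite ger0_norm ?invr_ge0// invf_le1// ler1n.
- by move=> n; apply: Lam_exp; rewrite invr_eq0 pnatr_eq0.
Qed.

Let Lam0 : Lam (fun=> 0) = 0.
Proof.
have -> : (fun=> 0) = (fun x : R => -1 * 1 + 1 : R).
  by apply/funext => x; rewrite mulr1 addNr.
by rewrite Lam_lin ?Lam1 ?mulr0 ?addr0//; exact: integrable_cc_cst.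
Qed.

Let Lam_sum (T : Type) (r : seq T) (k : T -> R) (f_ : T -> R -> R) :
  (forall i, L1 (f_ i)) -> (forall i, Lam (f_ i) = 0) ->
  L1 (fun x => \sum_(i <- r) k i * f_ i x) /\
  Lam (fun x => \sum_(i <- r) k i * f_ i x) = 0.
Proof.
move=> f_i L0; elim: r => [|i r [IHi IH]].
  have -> : (fun x : R => \sum_(i <- [::]) k i * f_ i x) = fun=> 0.
    by apply/funext => x; rewrite big_nil.
  by split; [exact: integrable_cc_cst|exact: Lam0].
have -> : (fun x : R => \sum_(j <- i :: r) k j * f_ j x) =
    fun x => k i * f_ i x + \sum_(j <- r) k j * f_ j x.
  by apply/funext => x; rewrite big_cons.
by split; [exact: L1lin|rewrite Lam_lin// L0 IH mulr0 add0r].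
Qed.

Let Lam_poly (p : {poly R}) :
  L1 (fun x => p.[expR x]) /\ Lam (fun x => p.[expR x]) = 0.
Proof.
have -> : (fun x => p.[expR x]) = fun x => \sum_(i < size p) p`_i * expR (i%:R * x).
  apply/funext => x; rewrite horner_coef.
  by apply: eq_bigr => i _; rewrite expRM_natl.
apply: (@Lam_sum _ _ (fun i : 'I_(size p) => p`_i) (fun i x => expR (i%:R * x)))
  => // -[[|i] iS] /=.
  by rewrite -Lam1; congr Lam; apply/funext => x; rewrite mul0r expR0.
by apply: Lam_exp; rewrite pnatr_eq0.
Qed.

(** The step polynomials are applied to [z = exp (x - y) / k], which lies in
    (0, 1) on [[a, c]] when [k > exp (c - y)]; then [z < 1 / k] means [x < y]. *)
Let Lam_ray (y : R) : Lam \1_(`]-oo, y[) = 0.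
Proof.
pose k := (Num.trunc (expR (c - y))).+1.
have kc : expR (c - y) < k%:R by exact: truncnS_gt.
pose p n : {poly R} := (1 - ((expR (- y) / k%:R)%:P * 'X) ^+ n) ^+ (k ^ n).
have pE n x : (p n).[expR x] = (1 - (expR (x - y) / k%:R) ^+ n) ^+ (k ^ n).
  rewrite /p !(hornerE, horner_exp) expRD; congr ((1 - _ ^+ _) ^+ _); ring.
have k0 : 0 < k%:R :> R by [].
have z01 x : x <= c -> 0 < expR (x - y) / k%:R < 1.
  move=> xc; rewrite divr_gt0 ?expR_gt0//= ltr_pdivrMr// mul1r.
  by rewrite (le_lt_trans _ kc)// ler_expR lerB.
apply: (@Lam_dominated (fun n x => (p n).[expR x]) _ (fun=> 1)).
- by move=> n; have [] := Lam_poly (p n).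
- apply: (@integrable_cc_bounded _ _ _ _ 1) => [|x _].
    exact: measurable_indic.
  by rewrite indicE; case: (_ \in _) => /=; rewrite ?normr1// normr0.
- exact: integrable_cc_cst.
- exists [set y]; split; [exact: measurable_set1|exact: lebesgue_measure_set1|].
  move=> x /= nH; apply: contrapT => /eqP xy; apply: nH; rewrite in_itv/= => /andP[_ xc].
  under eq_fun do rewrite pE.
  have [] := cvg_step_poly (z01 x xc) (ltn0Sn (Num.trunc (expR (c - y)))); rewrite -/k.
  rewrite mulrC divfK ?gt_eqF// expR_lt1 expR_gt1 indicE mem_setE in_itv/=.
  by rewrite subr_lt0 subr_gt0; case: (ltgtP x y) xy => //= _ _ H1 H2; [exact: H1|exact: H2].
- move=> n x /andP[_ xc]; rewrite pE.
  have /andP[z0 z1] := z01 x xc; set z := _ / _ in z0 z1 *.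
  have zn0 : 0 <= z ^+ n by rewrite exprn_ge0// ltW.
  have zn1 : z ^+ n <= 1 by rewrite exprn_ile1// ltW.
  by rewrite ger0_norm ?exprn_ge0 ?exprn_ile1//; lra.
- by move=> n; have [] := Lam_poly (p n).
Qed.

Let L1indic (A : set R) : @measurable _ (measurableTypeR R) A -> L1 \1_A.
Proof.
move=> mA; apply: (@integrable_cc_bounded _ _ _ _ 1) => [|x _].
  exact: measurable_indic.
by rewrite indicE; case: (_ \in _) => /=; rewrite ?normr1// normr0.
Qed.

(** Open rays generate the Borel sets and are stable under intersection; the
    sets whose indicator is annihilated form a Dynkin class, countable disjoint
    unions being handled by dominated convergence of the partial sums. *)
Let Lam_indic (A : set R) : @measurable _ (measurableTypeR R) A -> Lam \1_A = 0.
Proof.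
move=> mA; have mE := @measurable_realfun.RGenInftyO.measurableE R.
apply: (@dynkin_induction _ (measurableTypeR R)
  (@measurable_realfun.RGenInftyO.G R) (fun A => Lam \1_A = 0)) => //=.
- move=> _ _ [x ->] [y ->]; exists (Num.min x y).
  by apply/seteqP; split => z /=; rewrite !in_itv/= lt_min => /andP.
- by rewrite indicT.
- by move=> _ [x ->]; exact: Lam_ray.
- move=> S mS LS; have -> : \1_(~` S) = (fun x : R => -1 * \1_S x + 1 : R).
    by apply/funext => x; rewrite !indicE in_setC; case: (_ \in _) => /=; ring.
  by rewrite Lam_lin ?LS ?Lam1 ?mulr0 ?addr0//; [exact: L1indic|exact: integrable_cc_cst].
- move=> F mF tF LF.
  pose f_ n x : R := \sum_(i < n) 1 * \1_(F i) x.
  have fE x : (exists i0, forall n, f_ n x = (i0 < n)%N%:R /\ \1_(\bigcup_k F k) x = 1 :> R) \/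
      (forall n, f_ n x = 0 /\ \1_(\bigcup_k F k) x = 0 :> R).
    have [[i0 _ Fx]|nF] := pselect ((\bigcup_k F k) x); [left|right].
      have FE i : \1_(F i) x = (i == i0)%:R :> R.
        rewrite indicE; case: eqP => [->|ii0]; first by rewrite mem_set.
        by rewrite memNset// => Fix; apply: ii0; apply: tF => //; exists x.
      exists i0 => n; split; last by rewrite indicE mem_set//; exists i0.
      rewrite /f_; under eq_bigr do rewrite FE mul1r.
      case: ltnP => [i0n|ni0].
        rewrite (bigD1 (Ordinal i0n))//= eqxx big1 ?addr0// => i.
        by rewrite -val_eqE/= => /negbTE ->.
      by apply: big1 => i _; rewrite ltn_eqF// (leq_trans _ ni0).
    move=> n; split; last by rewrite indicE memNset.
    rewrite /f_ big1// => i _; rewrite indicE memNset ?mulr0// => Fx.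
    by apply: nF; exists i.
  apply: (@Lam_dominated f_ _ (fun=> 1)).
  + by move=> n; have [] := @Lam_sum _ (index_enum 'I_n) (fun=> 1) (fun i => \1_(F i))
      (fun i => L1indic (mF i)) (fun i => LF i).
  + by apply: L1indic; exact: bigcup_measurable.
  + exact: integrable_cc_cst.
  + apply: aeW => x _; case: (fE x) => [[i0 {}fE]|{}fE].
      rewrite (fE 0%N).2; apply: cvg_near_cst; exists i0.+1 => // n /= i0n.
      by rewrite (fE n).1 i0n.
    by rewrite (fE 0%N).2; apply: cvg_near_cst; apply: nearW => n; rewrite (fE n).1.
  + move=> n x _; case: (fE x) => [[i0 {}fE]|{}fE]; rewrite (fE n).1 ?normr0//.
    by case: (_ < _)%N; rewrite ?normr1 ?normr0.
  + by move=> n; have [] := @Lam_sum _ (index_enum 'I_n) (fun=> 1) (fun i => \1_(F i))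
      (fun i => L1indic (mF i)) (fun i => LF i).
- by have : (fun S : set (set R) => S A) ((@ocitv R).-sigma.-measurable) by [];
  rewrite mE.
Qed.

Import HBSimple.

(** The functional vanishes on constants, as limits of exponentials for
    [s -> 0], hence on polynomials in [exp x], hence on indicators; and simple
    functions are dense in [L^1]. *)
Lemma exp_total f : L1 f -> Lam f = 0.
Proof.
move=> fi; have mD : @measurable _ (measurableTypeR R) `[a, c] by exact: measurable_itv.
have [g_ [g_i _ g_cvg]] := approximation_sfun_integrable mD fi.
have Lg n : Lam (g_ n) = 0.
  have -> : (g_ n : R -> R) = fun x => \sum_(y <- finmap.enum_fset (fset_set (range (g_ n))))
      y * \1_(g_ n @^-1` [set y]) x.
    by apply/funext => x; rewrite -fsbig_finite ?[LHS]fimfunE//; exact: fimfunP.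
  have mg y : @measurable _ (measurableTypeR R) (g_ n @^-1` [set y]) by exact: measurable_funPTI.
  by have [_] := @Lam_sum _ (finmap.enum_fset (fset_set (range (g_ n))))
    (fun y => y) (fun y => \1_(g_ n @^-1` [set y])) (fun y => L1indic (mg y))
    (fun y => Lam_indic (mg y)).
apply/eqP; rewrite -normr_le0; apply/ler_addgt0Pr => e e0; rewrite add0r.
move/fine_cvgP : g_cvg => [_ /cvgrPdist_le/= H].
have C0 : 0 < `|C| + 1 by rewrite ltr_wpDl.
have [n _ /(_ n (leqnn n))] := H _ (divr_gt0 e0 C0).
rewrite sub0r normrN => Hn.
have -> : Lam f = Lam (fun x => -1 * g_ n x + f x).
  by rewrite Lam_lin// ?Lg ?mulr0 ?add0r//; exact: g_i.
apply: le_trans (Lam_bnd _) _; first by apply: L1lin => //; exact: g_i.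
have -> : \int[mu]_(x in `[a, c]) `|-1 * g_ n x + f x| =
    fine (\int[mu]_(x in `[a, c]) `|(f x)%:E - (g_ n x)%:E|)%E.
  by congr fine; apply: eq_integral => x _; rewrite mulN1r addrC.
apply: le_trans (ler_norm _) _; rewrite normrM.
rewrite ler_pdivlMr// in Hn; apply: le_trans _ Hn; rewrite mulrC ler_wpM2l//.
by rewrite lerDl.
Qed.

End BoundedFunctionals.

(** * Primitives of integrable functions *)

Section Primitives.
Context {R : realType}.
Local Notation mu := (@lebesgue_measure R).
Local Notation mble A := (@measurable _ (measurableTypeR R) A).
Local Notation mfun A f := (@measurable_fun _ _ (measurableTypeR R) R A f).
Local Notation L1 a c f := (mu.-integrable `[a, c] (EFin \o f)).
Implicit Types (f g w : R -> R) (a c x : R).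

Definition prim a w x : R := \int[mu]_(t in `[a, x]) w t.

Lemma integrable_mulb (A : set R) f g (M : R) : mble A -> mfun A f ->
  (forall x, A x -> `|f x| <= M) -> mu.-integrable A (EFin \o g) ->
  mu.-integrable A (EFin \o (fun x => f x * g x)).
Proof.
move=> mA mf fM gi.
have Mgi : mu.-integrable A (EFin \o (fun x => `|M| * `|g x|)).
  have := integrableZl mA `|M| (integrable_norm gi).
  by apply: eq_integrable.
apply: integrable_dominated Mgi => //.
- apply: measurable_funM => //; exact: integrable_measurable.
- move=> x Ax; rewrite normrM ler_wpM2r//.
  by rewrite (le_trans (fM _ Ax))// ler_norm.
Qed.

Lemma subset_cc a c x y : a <= x -> y <= c -> `[x, y] `<=` `[a, c].
Proof.
move=> ax yc z; rewrite /= !in_itv/= => /andP[xz zy].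
by rewrite (le_trans ax)//= (le_trans zy).
Qed.

Lemma L1_sub a c x y w : a <= x -> y <= c -> L1 a c w -> L1 x y w.
Proof.
move=> ax yc; apply: integrableS; [exact: measurable_itv..|].
exact: subset_cc.
Qed.

Lemma Rintegral_norm_sub a c x y w : a <= x -> y <= c -> L1 a c w ->
  `|\int[mu]_(t in `[x, y]) w t| <= \int[mu]_(t in `[a, c]) `|w t|.
Proof.
move=> ax yc wi; have wi' := L1_sub ax yc wi.
apply: le_trans (le_normr_Rintegral _ wi') _; first exact: measurable_itv.
rewrite /Rintegral fine_le//.
- by apply: integrable_fin_num (integrable_norm wi'); exact: measurable_itv.
- by apply: integrable_fin_num (integrable_norm wi); exact: measurable_itv.
- apply: ge0_subset_integral => //; [exact: measurable_itv..| |].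
  + apply/measurable_EFinP; apply: integrable_measurable.
    exact: integrable_norm.
  + exact: subset_cc.
Qed.

Lemma Rintegral_cc_cst a c (k : R) : a <= c ->
  \int[mu]_(x in `[a, c]) k = k * (c - a).
Proof.
move=> ac; rewrite (@Rintegral_cst _ _ _ mu `[a, c] (measurable_itv _) k).
have := @lebesgue_measure_itv R `[a, c]; rewrite /= lte_fin => ->.
by move: ac; rewrite le_eqVlt => /orP[/eqP->|->//]; rewrite ltxx subrr.
Qed.

Lemma prim_bound a c x w : x <= c -> L1 a c w ->
  `|prim a w x| <= \int[mu]_(t in `[a, c]) `|w t|.
Proof. by move=> xc wi; apply: Rintegral_norm_sub. Qed.

Lemma prim_lin a c x w g (k : R) : x <= c -> L1 a c w -> L1 a c g ->
  prim a (fun t => k * w t + g t) x = k * prim a w x + prim a g x.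
Proof.
move=> xc wi gi; rewrite /prim Rintegral_lin//.
- exact: L1_sub wi.
- exact: L1_sub gi.
Qed.

Lemma prim_continuous a c w : a <= c -> L1 a c w ->
  {within `[a, c], continuous (prim a w)}.
Proof. by move=> ac wi; exact: parameterized_integral_continuous. Qed.

Lemma L1_continuous a c f : {within `[a, c], continuous f} -> L1 a c f.
Proof.
by move=> cf; apply: continuous_compact_integrable => //; exact: segment_compact.
Qed.

Lemma L1_continuousT a c f : continuous f -> L1 a c f.
Proof. by move=> cf; apply: L1_continuous; exact: continuous_subspaceT. Qed.

Lemma prim_integrable a c w : a <= c -> L1 a c w -> L1 a c (prim a w).
Proof. by move=> ac wi; apply: L1_continuous; exact: prim_continuous. Qed.

Lemma continuous_bounded_cc a c f : {within `[a, c], continuous f} ->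
  exists2 M : R, 0 <= M & forall x, a <= x <= c -> `|f x| <= M.
Proof.
move=> cf; have [ac|ca] := leP a c; last first.
  by exists 0 => // x /andP[ax xc]; have := le_trans ax xc; rewrite leNgt ca.
have [y _ ymax] := EVT_max ac cf; have [z _ zmin] := EVT_min ac cf.
exists (`|f y| + `|f z|) => [|x xac]; first exact: addr_ge0.
have xI : x \in `[a, c] by rewrite in_itv.
have := ymax x xI; have := zmin x xI; have := ler_norm (f y).
have := ler_norm (- f z); rewrite normrN ler_norml.
have := normr_ge0 (f y); have := normr_ge0 (f z) => *.
by apply/andP; split; lra.
Qed.

Lemma FTC2_prim a x (F f : R -> R) : a <= x -> continuous f ->
  (forall y : R, is_derive y 1 F (f y)) -> prim a f x = F x - F a.
Proof.
rewrite le_eqVlt => /orP[/eqP<- _ _|ax cf dF].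
  by rewrite /prim set_itv1 Rintegral_set1 subrr.
rewrite /prim /Rintegral (@continuous_FTC2 _ f F)//.
- exact: continuous_subspaceT.
- have cF : continuous F.
    move=> y; apply/differentiable_continuous/derivable1_diffP.
    by have := dF y => -[].
  split=> [y _||]; first by have := dF y => -[].
  + exact/cvg_at_right_filter/cF.
  + exact/cvg_at_left_filter/cF.
- by move=> y _; rewrite (is_derive_derive1 dF).
Qed.

Lemma is_derive_exp_scale (s x : R) :
  is_derive x 1 (fun y : R => expR (s * y)) (s * expR (s * x)).
Proof.
have -> : s * expR (s * x) = expR (s * x) * s by rewrite mulrC.
apply: (@is_derive1_comp _ expR (fun y : R => s * y)).
by apply: is_derive_eq; rewrite /GRing.scale/= mulr1.
Qed.

Lemma continuous_exp_scale (s : R) : continuous (fun y : R => expR (s * y)).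
Proof.
move=> x; apply/differentiable_continuous/derivable1_diffP.
by have := is_derive_exp_scale s x => -[].
Qed.

Lemma prim_exp (s a x : R) : s != 0 -> a <= x ->
  prim a (fun y => expR (s * y)) x = s^-1 * (expR (s * x) - expR (s * a)).
Proof.
move=> s0 ax.
have dF (y : R) : is_derive y 1 (fun y : R => s^-1 * expR (s * y)) (expR (s * y)).
  have := is_derive_exp_scale s y => ?.
  by apply: is_derive_eq; rewrite /GRing.scale/= mulrA mulVf// mul1r.
by rewrite (FTC2_prim ax (@continuous_exp_scale s) dF) mulrBr.
Qed.

(** The difference of the two sides is a bounded functional of [w], so it is enough
    to know it for [w = exp (s x)], where the primitive is continuously
    differentiable. *)
Lemma Rintegral_prim_parts a c w (phi : R -> R) : a < c -> L1 a c w ->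
  smooth phi -> phi a = 0 -> phi c = 0 ->
  \int[mu]_(x in `[a, c]) (phi^`()%classic x * prim a w x) =
  - \int[mu]_(x in `[a, c]) (phi x * w x).
Proof.
move=> ac wi sp pa pc; apply/eqP; rewrite -addr_eq0; apply/eqP.
have mI : mble `[a, c] by exact: measurable_itv.
have cphi := smooth_continuous sp.
have cphi' := smooth_continuous (smooth_derive1 sp).
have [M M0 phiM] := @continuous_bounded_cc a c _ (continuous_subspaceT cphi).
have [M' M'0 phi'M] := @continuous_bounded_cc a c _ (continuous_subspaceT cphi').
have mphi : mfun `[a, c] phi by exact: integrable_measurable (@L1_continuousT a c _ cphi).
have mphi' : mfun `[a, c] phi^`()%classic.
  exact: integrable_measurable (@L1_continuousT a c _ cphi').
have i1 f : L1 a c f -> L1 a c (fun x => phi x * f x).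
  by move=> fi; apply: integrable_mulb fi => // x; rewrite /= in_itv/=; exact: phiM.
have i2 f : L1 a c f -> L1 a c (fun x => phi^`()%classic x * prim a f x).
  move=> fi; apply: integrable_mulb (prim_integrable (ltW ac) fi) => // x.
  by rewrite /= in_itv/=; exact: phi'M.
pose Lam w := \int[mu]_(x in `[a, c]) (phi^`()%classic x * prim a w x) +
  \int[mu]_(x in `[a, c]) (phi x * w x).
apply: (@exp_total _ a c Lam (M' * (c - a) + M)) wi.
- move=> k f g fi gi; rewrite /Lam.
  have -> : \int[mu]_(x in `[a, c]) (phi^`()%classic x * prim a (fun t => k * f t + g t) x) =
     \int[mu]_(x in `[a, c]) (k * (phi^`()%classic x * prim a f x) +
       phi^`()%classic x * prim a g x).
    apply: eq_Rintegral => x; rewrite inE/= in_itv/= => /andP[_ xc].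
    by rewrite (prim_lin k xc fi gi); ring.
  have -> : \int[mu]_(x in `[a, c]) (phi x * (k * f x + g x)) =
     \int[mu]_(x in `[a, c]) (k * (phi x * f x) + phi x * g x).
    by apply: eq_Rintegral => x _; ring.
  by rewrite !Rintegral_lin ?i1 ?i2//; ring.
- move=> f fi; rewrite /Lam.
  apply: le_trans (ler_normD _ _) _; rewrite mulrDl; apply: lerD.
    apply: le_trans (le_normr_Rintegral mI (i2 _ fi)) _.
    apply: (@le_trans _ _ (\int[mu]_(x in `[a, c]) (M' * \int[mu]_(t in `[a, c]) `|f t|))).
      apply: le_Rintegral => //.
      - exact/integrable_norm/i2.
      - exact: integrable_cc_cst.
      - move=> x; rewrite /= in_itv/= => xac; rewrite normrM ler_pM//; first exact: phi'M.
        by apply: prim_bound => //; have /andP[] := xac.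
    rewrite (Rintegral_cc_cst _ (ltW ac)).
    by rewrite mulrAC.
  apply: le_trans (le_normr_Rintegral mI (i1 _ fi)) _.
  rewrite -RintegralZl//; last exact: integrable_norm.
  apply: le_Rintegral => //.
  + exact/integrable_norm/i1.
  + by have := integrableZl mI M (integrable_norm fi); apply: eq_integrable.
  + by move=> x; rewrite /= in_itv/= => xac; rewrite normrM ler_wpM2r// phiM.
- move=> s s0; rewrite /Lam.
  pose F x := s^-1 * (expR (s * x) - expR (s * a)).
  have dF x : is_derive x 1 F (expR (s * x)).
    have := is_derive_exp_scale s x => ?.
    by apply: is_derive_eq; rewrite /GRing.scale/= ?subr0 mulrA mulVf// mul1r.
  have cF : continuous F.
    move=> y; apply/differentiable_continuous/derivable1_diffP.
    by have := dF y => -[].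
  have := @Rintegration_by_parts _ F phi (fun x => expR (s * x)) phi^`()%classic a c ac.
  rewrite pa pc !mulr0 subr0 sub0r => H.
  have -> : \int[mu]_(x in `[a, c]) (phi^`()%classic x * prim a (fun t => expR (s * t)) x) =
     \int[mu]_(x in `[a, c]) (F x * phi^`()%classic x).
    apply: eq_Rintegral => x; rewrite inE/= in_itv/= => /andP[ax _].
    by rewrite prim_exp// mulrC.
  rewrite H.
  + by rewrite addrC; under eq_Rintegral do rewrite mulrC; rewrite subrr.
  + exact/continuous_subspaceT/continuous_exp_scale.
  + split=> [y _||]; first by have := dF y => -[].
    * exact/cvg_at_right_filter/cF.
    * exact/cvg_at_left_filter/cF.
  + by move=> y _; rewrite (is_derive_derive1 dF).
  + exact: continuous_subspaceT.
  + split=> [y _||]; first exact: (sp 0%N).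
    * exact/cvg_at_right_filter/cphi.
    * exact/cvg_at_left_filter/cphi.
  + by [].
Qed.

End Primitives.

(** * Weak second derivatives of continuous functions *)

Section WeakDerivatives.
Context {R : realType}.
Local Notation mu := (@lebesgue_measure R).
Local Notation mble A := (@measurable _ (measurableTypeR R) A).
Local Notation mfun A f := (@measurable_fun _ _ (measurableTypeR R) R A f).
Local Notation L1 a c f := (mu.-integrable `[a, c] (EFin \o f)).
Implicit Types (f g w : R -> R) (a c x : R).

Lemma is_derive_reflect f (df k z y : R) : is_derive (k * (z - y)) 1 f df ->
  is_derive y 1 (fun y : R => f (k * (z - y))) (- (k * df)).
Proof.
move=> Df; have -> : - (k * df) = df * - k by ring.
apply: (@is_derive1_comp _ f (fun y : R => k * (z - y))).
by apply: is_derive_eq; rewrite /GRing.scale/=; ring.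
Qed.

Lemma continuous_reflect (k z : R) f : continuous f ->
  continuous (fun y : R => k * f (k * (z - y))).
Proof.
move=> cf y; apply: cvgM; first exact: cvg_cst.
apply: (@continuous_comp _ _ _ (fun y : R => k * (z - y)) f); last exact: cf.
apply: cvgM; first exact: cvg_cst.
by apply: cvgB; [exact: cvg_cst|exact: cvg_id].
Qed.

Lemma L1_mul_continuous a c f g : {within `[a, c], continuous g} ->
  continuous f -> L1 a c (fun y => g y * f y).
Proof.
move=> cg cf; apply: L1_continuous => y; apply: cvgM; first exact: cg.
exact: continuous_subspaceT.
Qed.

(** The mass of the rescaled bump over [[a, c]] is 1 because [D] rises from 0
    to 1 over its support, which is contained in [[x - e, x]]. *)
Lemma approximate_identity a c x (g beta D : R -> R) (eta : R) :
  {within `[a, c], continuous g} -> a < x < c -> 0 < eta ->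
  continuous beta -> (forall z : R, 0 <= beta z) ->
  (forall z : R, (z <= 0) || (1 <= z) -> beta z = 0) ->
  (forall z : R, is_derive z 1 D (beta z)) ->
  (forall z : R, z <= 0 -> D z = 0) -> (forall z : R, 1 <= z -> D z = 1) ->
  exists2 d : R, 0 < d & forall e : R, 0 < e -> e < d ->
  `|\int[mu]_(y in `[a, c]) (g y * (e^-1 * beta (e^-1 * (x - y)))) - g x| <= eta.
Proof.
move=> cg /andP[ax xc] eta0 cbeta beta0 betaE dD D0 D1.
have mI : mble `[a, c] by exact: measurable_itv.
have ac : a <= c by rewrite ltW// (lt_trans ax).
have [d d0 gd] : exists2 d : R, 0 < d & forall y, `|x - y| < d -> `|g x - g y| <= eta.
  have cgx : {for x, continuous g}.
    apply: (within_continuous_continuous (lt_trans ax xc) cg).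
    by rewrite in_itv/= ax.
  have /cvgrPdist_le/(_ _ eta0)/nbhs_ballP[d /= d0 H] := cgx.
  by exists d.
exists (Num.min d (x - a)) => [|e e0]; first by rewrite lt_min d0/= subr_gt0.
rewrite lt_min => /andP[ed exa].
pose be (y : R) : R := e^-1 * beta (e^-1 * (x - y)).
have dF (y : R) : is_derive y 1 (fun y : R => - D (e^-1 * (x - y))) (be y).
  have := is_derive_reflect (dD (e^-1 * (x - y))) => ?.
  by apply: is_derive_eq; rewrite opprK.
have cbe : continuous be by exact: continuous_reflect.
have ibe : L1 a c be by exact: L1_continuousT.
have igbe : L1 a c (fun y => g y * be y) by exact: L1_mul_continuous.
have mass : \int[mu]_(y in `[a, c]) be y = 1.
  have := FTC2_prim ac cbe dF; rewrite /prim => ->.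
  rewrite D0 ?D1 ?oppr0 ?sub0r ?opprK//.
    by rewrite mulrC ler_pdivlMr// mul1r ltW.
  by rewrite pmulr_rle0 ?invr_gt0// subr_le0 ltW.
have -> : \int[mu]_(y in `[a, c]) (g y * be y) - g x =
    \int[mu]_(y in `[a, c]) (- g x * be y + g y * be y).
  by rewrite Rintegral_lin// mass mulr1 addrC.
have idiff : L1 a c (fun y => - g x * be y + g y * be y) by exact: integrable_lin.
apply: le_trans (le_normr_Rintegral mI idiff) _.
have ieta : L1 a c (fun y => eta * be y).
  by have := integrableZl mI eta ibe; apply: eq_integrable.
apply: (@le_trans _ _ (\int[mu]_(y in `[a, c]) (eta * be y))); last first.
  by rewrite RintegralZl// mass mulr1.
apply: le_Rintegral => //; first exact: integrable_norm.
move=> y _; have be0 : 0 <= be y by rewrite mulr_ge0// invr_ge0 ltW.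
rewrite -mulrDl normrM (ger0_norm be0).
have [z0|z0] := leP (e^-1 * (x - y)) 0.
  by rewrite /be betaE ?z0// !mulr0.
have [z1|z1] := leP 1 (e^-1 * (x - y)).
  by rewrite /be betaE ?z1 ?orbT// !mulr0.
rewrite ler_wpM2r// addrC distrC gd//.
move: z0 z1; rewrite pmulr_rgt0 ?invr_gt0// mulrC ltr_pdivrMr// mul1r => z0 z1.
by rewrite gtr0_norm// (lt_trans z1).
Qed.

(** Testing against three translates of a smooth ramp with weights summing to
    zero and with zero first moment approximates the weighted sum of three point
    values. The two conditions on the weights make the combination of ramps
    vanish to the left of the three points, where each ramp is affine. *)
Lemma weak_affine_three_points a c g : {within `[a, c], continuous g} ->
  (forall phi, test_function a c phi ->
    \int[mu]_(y in `[a, c]) (g y * (phi^`())^`()%classic y) = 0) ->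
  forall p q x, a < p < c -> a < q < c -> a < x < c ->
  g p * (q - x) + g q * (x - p) + g x * (p - q) = 0.
Proof.
move=> cg H p q x pac qac xac.
have [B [D [beta [[sB dB dD] [cbeta beta0 betaE] B0 B1]]]] := @smooth_ramp R.
have cvg_at z (zac : a < z < c) eta (eta0 : 0 < eta) :=
  approximate_identity cg zac eta0 cbeta beta0 betaE dD
  (fun z z0 => (B0 z z0).2) (fun z z1 => (B1 z z1).2).
pose K := `|q - x| + `|x - p| + `|p - q| + 1.
have K0 : 0 < K by rewrite ltr_wpDl// !addr_ge0.
apply/eqP; rewrite -normr_le0; apply/ler_addgt0Pr => eta eta0; rewrite add0r.
have etaK : 0 < eta / K by rewrite divr_gt0.
have [dp dp0 Hp] := cvg_at p pac _ etaK.
have [dq dq0 Hq] := cvg_at q qac _ etaK.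
have [dx dx0 Hx] := cvg_at x xac _ etaK.
pose m := Num.min p (Num.min q x).
have ma : a < m.
  by move: pac qac xac => /andP[? _] /andP[? _] /andP[? _]; rewrite !lt_min; apply/and3P.
(* Half the minimum lies strictly below each of the four bounds. *)
pose e := Num.min (m - a) (Num.min dp (Num.min dq dx)) / 2.
have [e0 ema edp edq edx] : [/\ 0 < e, e < m - a, e < dp, e < dq & e < dx].
  have M0 : 0 < Num.min (m - a) (Num.min dp (Num.min dq dx)).
    by rewrite !lt_min subr_gt0 ma dp0 dq0 dx0.
  have : e < Num.min (m - a) (Num.min dp (Num.min dq dx)).
    by rewrite /e ltr_pdivrMr// ltr_pMr// ltr1n.
  by rewrite !lt_min => /and4P[-> -> -> ->]; rewrite divr_gt0.
pose b_ (z y : R) : R := e * B (e^-1 * (z - y)).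
have db (z y : R) : is_derive y 1 (b_ z) (- D (e^-1 * (z - y))).
  have := is_derive_reflect (dB (e^-1 * (z - y))) => ?.
  by apply: is_derive_eq; rewrite /GRing.scale/= mulrN mulVKf// gt_eqF.
have ddb (z y : R) : is_derive y 1 (fun y : R => - D (e^-1 * (z - y)))
    (e^-1 * beta (e^-1 * (z - y))).
  have := is_derive_reflect (dD (e^-1 * (z - y))) => ?.
  by apply: is_derive_eq; rewrite opprK.
have sb (z : R) : smooth (b_ z).
  apply: smooth_scale; have -> : (fun y => B (e^-1 * (z - y))) =
      (fun y => B (- e^-1 * y + e^-1 * z)).
    by apply/funext => y; congr B; ring.
  exact: smooth_affine.
pose phi (y : R) : R := (q - x) * b_ p y + ((x - p) * b_ q y + ((p - q) * b_ x y)).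
have dphi (y : R) : is_derive y 1 phi ((q - x) * (- D (e^-1 * (p - y))) +
   ((x - p) * (- D (e^-1 * (q - y))) + (p - q) * (- D (e^-1 * (x - y))))).
  have := db p y; have := db q y; have := db x y => ? ? ?.
  exact: is_derive_eq.
have ddphi (y : R) : is_derive y 1 phi^`()%classic
   ((q - x) * (e^-1 * beta (e^-1 * (p - y))) +
   ((x - p) * (e^-1 * beta (e^-1 * (q - y))) +
    (p - q) * (e^-1 * beta (e^-1 * (x - y))))).
  rewrite (is_derive_derive1 dphi).
  have := ddb p y; have := ddb q y; have := ddb x y => ? ? ?.
  exact: is_derive_eq.
have tphi : test_function a c phi.
  split.
    by apply: (smooth_lin (sb p)); apply: (smooth_lin (sb q)); exact: smooth_scale.
  exists (m - e), (Num.max p (Num.max q x)); split.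
  - lra.
  - by move: pac qac xac => /andP[_ ?] /andP[_ ?] /andP[_ ?]; rewrite !gt_max; apply/and3P.
  - move=> y; rewrite in_itv/= negb_and -!ltNge => /orP[ym|].
      have [mp mq mx] : [/\ m <= p, m <= q & m <= x].
        by rewrite /m !ge_min !lexx !orbT.
      have bE z : m <= z -> b_ z y = z - y - e * (1 - B 1).
        move=> mz; rewrite /b_ (B1 _ _).1.
          by field; rewrite gt_eqF.
        rewrite mulrC ler_pdivlMr// mul1r; lra.
      by rewrite /phi !bE//; ring.
    rewrite !gt_max => /and3P[py qy xy].
    have bE z : z < y -> b_ z y = 0.
      move=> zy; rewrite /b_ (B0 _ _).1 ?mulr0//.
      by rewrite pmulr_rle0 ?invr_gt0// subr_le0 ltW.
    by rewrite /phi !bE// !mulr0 !addr0.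
have := H _ tphi; rewrite (is_derive_derive1 ddphi).
pose I (z : R) : R := \int[mu]_(y in `[a, c]) (g y * (e^-1 * beta (e^-1 * (z - y)))).
have ig (z : R) : L1 a c (fun y => g y * (e^-1 * beta (e^-1 * (z - y)))).
  by apply: L1_mul_continuous => //; exact: continuous_reflect.
have -> : \int[mu]_(y in `[a, c]) (g y * ((q - x) * (e^-1 * beta (e^-1 * (p - y))) +
   ((x - p) * (e^-1 * beta (e^-1 * (q - y))) +
    (p - q) * (e^-1 * beta (e^-1 * (x - y)))))) =
   (q - x) * I p + ((x - p) * I q + ((p - q) * I x + 0)).
  have -> : 0 = \int[mu]_(y in `[a, c]) (fun=> 0) y :> R.
    by rewrite (@Rintegral_cst _ _ _ mu `[a, c] (measurable_itv _) 0) mul0r.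
  have mI : mble `[a, c] by exact: measurable_itv.
  have i0 : L1 a c (fun=> 0) by exact: integrable_cc_cst.
  rewrite -!Rintegral_lin//; last 2 first.
  - by apply: integrable_lin => //; exact: integrable_lin.
  - exact: integrable_lin.
  by apply: eq_Rintegral => y _; ring.
move=> HI.
have -> : g p * (q - x) + g q * (x - p) + g x * (p - q) =
  - ((q - x) * (I p - g p) + (x - p) * (I q - g q) + (p - q) * (I x - g x)).
  lra.
have step (k z t : R) : `|z| <= t -> `|k * z| <= `|k| * t.
  by move=> zt; rewrite normrM ler_wpM2l.
rewrite normrN; apply: le_trans (ler_normD _ _) _.
apply: le_trans (lerD (ler_normD _ _) (step _ _ _ (Hx e e0 edx))) _.
apply: le_trans (lerD (lerD (step _ _ _ (Hp e e0 edp)) (step _ _ _ (Hq e e0 edq))) (lexx _)) _.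
by rewrite -!mulrDl mulrA ler_pdivrMr// mulrC ler_wpM2l ?lerDl// ltW.
Qed.

(** Extends an identity from the open interval to its ends by continuity. *)
Lemma within_cc_eq0 a c f : a < c -> {within `[a, c], continuous f} ->
  (forall x, a < x < c -> f x = 0) -> forall x, a <= x <= c -> f x = 0.
Proof.
move=> ac cf f0 x /andP[]; have [_ fa fc] := (continuous_within_itvP f ac).1 cf.
rewrite le_eqVlt => /orP[/eqP<- _|ax].
  have H : f x @[x --> a^'+] --> (0 : R).
    apply: cvg_near_cst; near=> y; apply: f0; apply/andP; split; near: y.
      exact: nbhs_right_gt.
    exact: nbhs_right_lt.
  exact: (cvg_unique _ fa H).
rewrite le_eqVlt => /orP[/eqP->|xc]; last by rewrite f0// ax.
have H : f x @[x --> c^'-] --> (0 : R).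
  apply: cvg_near_cst; near=> y; apply: f0; apply/andP; split; near: y.
    exact: nbhs_left_gt.
  exact: nbhs_left_lt.
exact: (cvg_unique _ fc H).
Unshelve. all: by end_near. Qed.

(** The three-point identity with two fixed points [p] and [q], taken at one and
    two thirds of the interval, says that [g] is the affine interpolation of its
    values there. *)
Lemma weak_affine a c g : a < c -> {within `[a, c], continuous g} ->
  (forall phi, test_function a c phi ->
    \int[mu]_(y in `[a, c]) (g y * (phi^`())^`()%classic y) = 0) ->
  exists A B : R, forall x, a <= x <= c -> g x = A + B * (x - a).
Proof.
move=> ac cg H; pose p := a + (c - a) / 3; pose q := a + (c - a) / 3 * 2.
have pac : a < p < c by rewrite /p; apply/andP; split; lra.
have qac : a < q < c by rewrite /q; apply/andP; split; lra.
have qp : q - p != 0 by rewrite gt_eqF// /p /q; lra.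
pose B := (g q - g p) / (q - p).
exists (g p - B * (p - a)), B => x xac; apply/eqP; rewrite -subr_eq0; apply/eqP.
apply: (@within_cc_eq0 a c (fun x => g x - (g p - B * (p - a) + B * (x - a)))) xac => //.
  have cA : continuous (fun y : R => g p - B * (p - a) + B * (y - a)).
    move=> z; apply: cvgD; first exact: cvg_cst.
    apply: cvgM; first exact: cvg_cst.
    by apply: cvgB; [exact: cvg_id|exact: cvg_cst].
  move=> y; apply: cvgB; first exact: cg.
  exact: (continuous_subspaceT cA).
move=> y yac; have := weak_affine_three_points cg H pac qac yac => E.
apply: (mulIf qp); rewrite mul0r -[RHS]oppr0 -E /B; field.
exact: qp.
Qed.

Lemma test_function_deriv a c phi : test_function a c phi ->
  test_function a c phi^`()%classic.
Proof.
move=> [sphi [a' [c' [aa' cc' phi0]]]]; split; first exact: smooth_derive1.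
exists a', c'; split=> // x xac; rewrite derive1E -(derive_cst 0 x 1).
move: xac; rewrite in_itv/= negb_and -!ltNge => /orP[xa|xc];
  apply: near_eq_derive; near=> y; apply: phi0; rewrite in_itv/= negb_and -!ltNge.
  by apply/orP; left; near: y; exact: (lt_nbhsl xa).
by apply/orP; right; near: y; exact: (lt_nbhsr xc).
Unshelve. all: by end_near. Qed.

Lemma test_function_end a c phi : test_function a c phi -> phi a = 0 /\ phi c = 0.
Proof.
move=> [sphi [a' [c' [aa' cc' phi0]]]]; split; apply: phi0;
  by rewrite in_itv/= negb_and -!ltNge ?aa' ?cc' ?orbT.
Qed.

(** The difference of [u] and the double primitive has zero second weak
    derivative, hence is affine. *)
Lemma weak_second_primitive a c (u w : R -> R) : a < c -> {within `[a, c], continuous u} ->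
  L1 a c w ->
  (forall phi, test_function a c phi ->
    \int[mu]_(y in `[a, c]) (u y * (phi^`())^`()%classic y) =
    \int[mu]_(y in `[a, c]) (phi y * w y)) ->
  exists A B : R, forall x, a <= x <= c ->
    u x = A + B * (x - a) + prim a (prim a w) x.
Proof.
move=> ac cu wi H; have p1i := prim_integrable (ltW ac) wi.
have cp2 := prim_continuous (ltW ac) p1i.
have mI : mble `[a, c] by exact: measurable_itv.
have [||A [B AB]] := @weak_affine a c (fun x => u x - prim a (prim a w) x) ac.
- by move=> y; apply: cvgB; [exact: cu|exact: cp2].
- move=> phi tphi; have tphi' := test_function_deriv tphi.
  have [sphi _] := tphi; have [sphi' _] := tphi'.
  have [pa pc] := test_function_end tphi; have [pa' pc'] := test_function_end tphi'.
  have cphi'' : continuous (phi^`())^`()%classic.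
    exact: smooth_continuous (smooth_derive1 (smooth_derive1 sphi)).
  have iu : L1 a c (fun y => u y * (phi^`())^`()%classic y) by exact: L1_mul_continuous.
  have ip : L1 a c (fun y => prim a (prim a w) y * (phi^`())^`()%classic y).
    exact: L1_mul_continuous.
  have -> : \int[mu]_(y in `[a, c])
      ((u y - prim a (prim a w) y) * (phi^`())^`()%classic y) =
    \int[mu]_(y in `[a, c]) (-1 * (prim a (prim a w) y * (phi^`())^`()%classic y) +
       u y * (phi^`())^`()%classic y) by apply: eq_Rintegral => y _; ring.
  rewrite Rintegral_lin// H// -(opprK (\int[mu]_(y in _) (phi y * _))).
  rewrite -(Rintegral_prim_parts ac wi sphi pa pc).
  rewrite -(opprK (\int[mu]_(y in _) (_ * prim a w y))).
  rewrite -(Rintegral_prim_parts ac p1i sphi' pa' pc').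
  rewrite opprK mulN1r; apply/eqP; rewrite addrC subr_eq0; apply/eqP.
  by apply: eq_Rintegral => y _; rewrite mulrC.
by exists A, B => x xac; rewrite -AB// subrK.
Qed.

End WeakDerivatives.

(** * Integrals of complex functions *)

Section ComplexIntegrals.
Context {R : realType}.
Local Notation mu := (@lebesgue_measure R).
Local Notation C := R[i].
Local Notation Re := complex.Re.
Local Notation Im := complex.Im.
Local Notation mble A := (@measurable _ (measurableTypeR R) A).
Local Notation mfun A f := (@measurable_fun _ _ (measurableTypeR R) R A f).
Local Notation L1 a c f := (mu.-integrable `[a, c] (EFin \o f)).
Implicit Types (z w : C) (A : set R) (u v : R -> C) (x a c : R).

Lemma complex_ext z w : Re z = Re w -> Im z = Im w -> z = w.
Proof. by case: z w => [? ?] [? ?] /= -> ->. Qed.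

Lemma Re_add z w : Re (z + w) = Re z + Re w. Proof. by case: z w => [? ?] []. Qed.
Lemma Im_add z w : Im (z + w) = Im z + Im w. Proof. by case: z w => [? ?] []. Qed.
Lemma Re_opp z : Re (- z) = - Re z. Proof. by case: z. Qed.
Lemma Im_opp z : Im (- z) = - Im z. Proof. by case: z. Qed.
Lemma Re_mul z w : Re (z * w) = Re z * Re w - Im z * Im w.
Proof. by case: z w => [? ?] []. Qed.
Lemma Im_mul z w : Im (z * w) = Re z * Im w + Im z * Re w.
Proof. by case: z w => [? ?] []. Qed.

Definition ReImE := (Re_add, Im_add, Re_opp, Im_opp, Re_mul, Im_mul).

(** The l^1 norm is submultiplicative, like the modulus, and its integral is a
    sum of two real integrals. *)
Definition N1 z : R := `|Re z| + `|Im z|.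

Lemma N1_ge0 z : 0 <= N1 z. Proof. exact: addr_ge0. Qed.
Lemma N10 : N1 0 = 0. Proof. by rewrite /N1 /= !normr0 addr0. Qed.
Lemma N1_real (r : R) : N1 r%:C = `|r|. Proof. by rewrite /N1 /= normr0 addr0. Qed.

Lemma N1_eq0 z : N1 z <= 0 -> z = 0.
Proof.
rewrite /N1 => H; have := normr_ge0 (Re z); have := normr_ge0 (Im z) => *.
by apply: complex_ext => /=; apply/eqP; rewrite -normr_eq0; lra.
Qed.

Lemma N1D z w : N1 (z + w) <= N1 z + N1 w.
Proof.
rewrite /N1 !ReImE; have := ler_normD (Re z) (Re w).
by have := ler_normD (Im z) (Im w); lra.
Qed.

Lemma N1N z : N1 (- z) = N1 z.
Proof. by rewrite /N1 !ReImE !normrN. Qed.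

Lemma N1M z w : N1 (z * w) <= N1 z * N1 w.
Proof.
rewrite /N1 !ReImE; have := ler_normB (Re z * Re w) (Im z * Im w).
by have := ler_normD (Re z * Im w) (Im z * Re w); rewrite !normrM; nra.
Qed.

Lemma Re_le_N1 z : `|Re z| <= N1 z. Proof. by rewrite lerDl. Qed.
Lemma Im_le_N1 z : `|Im z| <= N1 z. Proof. by rewrite lerDr. Qed.

Definition cint A u := mu.-integrable A (EFin \o (fun x => Re (u x))) /\
  mu.-integrable A (EFin \o (fun x => Im (u x))).

Definition cmfun A u := mfun A (fun x => Re (u x)) /\ mfun A (fun x => Im (u x)).

Lemma cint_cmfun A u : cint A u -> cmfun A u.
Proof. by move=> [? ?]; split; exact: integrable_measurable. Qed.

Lemma cint_N1 A u : mble A -> cint A u ->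
  mu.-integrable A (EFin \o (fun x => N1 (u x))).
Proof.
move=> mA [ru iu].
by have := integrableD mA (integrable_norm ru) (integrable_norm iu);
  apply: eq_integrable.
Qed.

Lemma cint_dominated A u (g : R -> R) : mble A -> cmfun A u ->
  (forall x, A x -> N1 (u x) <= g x) -> mu.-integrable A (EFin \o g) -> cint A u.
Proof.
move=> mA [mr mi] ug gi; split; apply: integrable_dominated gi => // x Ax.
  exact: le_trans (Re_le_N1 _) (ug _ Ax).
exact: le_trans (Im_le_N1 _) (ug _ Ax).
Qed.

Lemma cmfun_lin A u v z : cmfun A u -> cmfun A v -> cmfun A (fun x => z * u x + v x).
Proof.
move=> [ru iu] [rv iv]; split.
- under eq_fun do rewrite !ReImE.
  apply: measurable_funD => //; apply: measurable_funB; exact: measurable_funM.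
- under eq_fun do rewrite !ReImE.
  apply: measurable_funD => //; apply: measurable_funD; exact: measurable_funM.
Qed.

Lemma cmfun_add A u v : cmfun A u -> cmfun A v -> cmfun A (fun x => u x + v x).
Proof.
move=> mu_ mv; have -> : (fun x => u x + v x) = fun x => 1 * u x + v x.
  by apply/funext => x; rewrite mul1r.
exact: cmfun_lin.
Qed.

Lemma cmfun_mul A u v : cmfun A u -> cmfun A v -> cmfun A (fun x => u x * v x).
Proof.
move=> [ru iu] [rv iv]; split.
- under eq_fun do rewrite !ReImE.
  apply: measurable_funB; exact: measurable_funM.
- under eq_fun do rewrite !ReImE.
  apply: measurable_funD; exact: measurable_funM.
Qed.

Lemma cint_lin A u v z : mble A -> cint A u -> cint A v ->
  cint A (fun x => z * u x + v x).
Proof.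
move=> mA [ru iu] [rv iv]; split.
- have := integrable_lin (Re z) mA ru (integrable_lin (- Im z) mA iu rv).
  by apply: eq_integrable => // x _ /=; rewrite !ReImE; congr EFin; ring.
- have := integrable_lin (Re z) mA iu (integrable_lin (Im z) mA ru iv).
  by apply: eq_integrable => // x _ /=; rewrite !ReImE; congr EFin; ring.
Qed.

Lemma cint_add A u v : mble A ->
  cint A u -> cint A v -> cint A (fun x => u x + v x).
Proof.
move=> mA ui vi; have -> : (fun x => u x + v x) = fun x => 1 * u x + v x.
  by apply/funext => x; rewrite mul1r.
exact: cint_lin.
Qed.

Lemma cintegral_lin A u v z : mble A -> cint A u -> cint A v ->
  cintegral A (fun x => z * u x + v x) = z * cintegral A u + cintegral A v.
Proof.
move=> mA [ru iu] [rv iv]; rewrite /cintegral; apply: complex_ext => /=.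
- rewrite !ReImE /=.
  have -> : \int[mu]_(x in A) Re (z * u x + v x) =
    \int[mu]_(x in A) (Re z * Re (u x) + (- Im z * Im (u x) + Re (v x))).
    by apply: eq_Rintegral => x _; rewrite !ReImE; ring.
  by rewrite !Rintegral_lin//; [ring|exact: integrable_lin].
- rewrite !ReImE /=.
  have -> : \int[mu]_(x in A) Im (z * u x + v x) =
    \int[mu]_(x in A) (Re z * Im (u x) + (Im z * Re (u x) + Im (v x))).
    by apply: eq_Rintegral => x _; rewrite !ReImE; ring.
  by rewrite !Rintegral_lin//; [ring|exact: integrable_lin].
Qed.

Lemma cint0 A : mble A -> cint A (fun=> 0).
Proof.
by move=> mA; split; exact: integrable0.
Qed.

Lemma cintegral0 A : mble A -> cintegral A (fun=> 0) = 0.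
Proof.
by move=> mA; rewrite /cintegral /= (@Rintegral_cst _ _ _ mu A mA 0) mul0r.
Qed.

Lemma cint_scale A u z : mble A -> cint A u -> cint A (fun x => z * u x).
Proof.
move=> mA iu; have := cint_lin z mA iu (cint0 mA).
by under eq_fun do rewrite addr0.
Qed.

Lemma cintegral_scale A u z : mble A -> cint A u ->
  cintegral A (fun x => z * u x) = z * cintegral A u.
Proof.
move=> mA iu; have := cintegral_lin z mA iu (cint0 mA).
by under eq_fun do rewrite addr0; rewrite cintegral0// addr0.
Qed.

Lemma cintegral_bound A u : mble A -> cint A u ->
  N1 (cintegral A u) <= \int[mu]_(x in A) N1 (u x).
Proof.
move=> mA [ru iu]; rewrite {2}/N1 RintegralD//; try exact: integrable_norm.
by rewrite /N1 /=; apply: lerD; exact: le_normr_Rintegral.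
Qed.

Lemma cintegral_bound_le A u (g : R -> R) : mble A -> cint A u ->
  mu.-integrable A (EFin \o g) -> (forall x, A x -> N1 (u x) <= g x) ->
  N1 (cintegral A u) <= \int[mu]_(x in A) g x.
Proof.
move=> mA iu ig ug; apply: le_trans (cintegral_bound mA iu) _.
by apply: le_Rintegral => //; exact: cint_N1.
Qed.

Lemma cint_mulb A k u (M : R) : mble A -> cmfun A k ->
  (forall x, A x -> N1 (k x) <= M) -> cint A u -> cint A (fun x => k x * u x).
Proof.
move=> mA mk kM iu; apply: (@cint_dominated _ _ (fun x => M * N1 (u x))) => //.
- exact: cmfun_mul (cint_cmfun iu).
- move=> x Ax; apply: le_trans (N1M _ _) _.
  by rewrite ler_wpM2r ?N1_ge0// kM.
- by have := integrableZl mA M (cint_N1 mA iu); apply: eq_integrable.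
Qed.

Lemma cintS A B u : mble A -> mble B -> B `<=` A -> cint A u -> cint B u.
Proof. by move=> mA mB BA [ru iu]; split; apply: integrableS BA _. Qed.

Lemma eq_cintegral A u v : (forall x, A x -> u x = v x) ->
  cintegral A u = cintegral A v.
Proof.
move=> uv; rewrite /cintegral; congr Complex; apply: eq_Rintegral => x;
  by rewrite inE => /uv ->.
Qed.

Lemma eq_cint A u v : mble A -> (forall x, A x -> u x = v x) -> cint A u -> cint A v.
Proof.
move=> mA uv; have E x : x \in A -> u x = v x by rewrite inE; exact: uv.
move=> [ru iu]; split; [move: ru|move: iu]; apply: eq_integrable => //= x Ax;
  by rewrite E.
Qed.

Lemma ae_eq_cintegral A u v : mble A -> cmfun A u -> cmfun A v ->
  {ae mu, forall x, A x -> u x = v x} -> cintegral A u = cintegral A v.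
Proof.
move=> mA [ru iu] [rv iv] uv; rewrite /cintegral; congr Complex.
- congr fine; apply: ae_eq_integral => //; try exact/measurable_EFinP.
  by apply: ae_imply uv => x H Ax /=; rewrite H.
- congr fine; apply: ae_eq_integral => //; try exact/measurable_EFinP.
  by apply: ae_imply uv => x H Ax /=; rewrite H.
Qed.

End ComplexIntegrals.

(** * Complex primitives and bounded functionals *)

Section ComplexPrimitives.
Context {R : realType}.
Local Notation mu := (@lebesgue_measure R).
Local Notation C := R[i].
Local Notation Re := complex.Re.
Local Notation Im := complex.Im.
Local Notation mble A := (@measurable _ (measurableTypeR R) A).
Local Notation mfun A f := (@measurable_fun _ _ (measurableTypeR R) R A f).
Local Notation L1 a c f := (mu.-integrable `[a, c] (EFin \o f)).
Implicit Types (z : C) (A : set R) (u v w : R -> C) (x a c : R).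

Definition cprim a w x : C := cintegral `[a, x] w.

Lemma mble_cc a c : mble `[a, c]. Proof. exact: measurable_itv. Qed.

Lemma cint_sub a c x y w : a <= x -> y <= c -> cint `[a, c] w -> cint `[x, y] w.
Proof. by move=> ax yc [ri ii]; split; [exact: L1_sub ri|exact: L1_sub ii]. Qed.

Lemma cint_cst a c z : cint `[a, c] (fun=> z).
Proof. by split; exact: integrable_cc_cst. Qed.

Lemma cprim_lin a c x w v z : x <= c -> cint `[a, c] w -> cint `[a, c] v ->
  cprim a (fun t => z * w t + v t) x = z * cprim a w x + cprim a v x.
Proof.
by move=> xc wi vi; rewrite /cprim cintegral_lin//; [exact: cint_sub wi|exact: cint_sub vi].
Qed.

Lemma nrm_ge0 a c u : 0 <= \int[mu]_(x in `[a, c]) N1 (u x).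
Proof. by apply: Rintegral_ge0 => x _; exact: N1_ge0. Qed.

Lemma nrm_sub a c x y w : a <= x -> y <= c -> cint `[a, c] w ->
  \int[mu]_(t in `[x, y]) N1 (w t) <= \int[mu]_(t in `[a, c]) N1 (w t).
Proof.
move=> ax yc wi; have := Rintegral_norm_sub ax yc (cint_N1 (@mble_cc a c) wi).
rewrite ger0_norm ?nrm_ge0//.
have -> // : \int[mu]_(t in `[a, c]) `|N1 (w t)| = \int[mu]_(t in `[a, c]) N1 (w t).
by apply: eq_Rintegral => t _; rewrite ger0_norm ?N1_ge0.
Qed.

Lemma cintegral_bound_sub a c x y w : a <= x -> y <= c -> cint `[a, c] w ->
  N1 (cintegral `[x, y] w) <= \int[mu]_(t in `[a, c]) N1 (w t).
Proof.
move=> ax yc wi; apply: le_trans (nrm_sub ax yc wi).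
exact: cintegral_bound (@mble_cc _ _) (cint_sub ax yc wi).
Qed.

Lemma cprim_bound a c x w : x <= c -> cint `[a, c] w ->
  N1 (cprim a w x) <= \int[mu]_(t in `[a, c]) N1 (w t).
Proof. by move=> xc wi; exact: cintegral_bound_sub. Qed.

Lemma cprim_cint a c w : a <= c -> cint `[a, c] w -> cint `[a, c] (cprim a w).
Proof. by move=> ac [ri ii]; split; exact: prim_integrable. Qed.

Lemma cprim2_bound a c x w : a <= x <= c -> cint `[a, c] w ->
  N1 (cprim a (cprim a w) x) <= (c - a) * \int[mu]_(t in `[a, c]) N1 (w t).
Proof.
move=> /andP[ax xc] wi; have ac := le_trans ax xc.
apply: le_trans (cprim_bound xc (cprim_cint ac wi)) _.
rewrite mulrC -Rintegral_cc_cst//; apply: le_Rintegral.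
- exact: mble_cc.
- by apply: cint_N1; [exact: mble_cc|exact: cprim_cint].
- exact: integrable_cc_cst.
- by move=> t; rewrite /= in_itv/= => /andP[_ tc]; exact: cprim_bound.
Qed.

(** Integrability of the extension by zero is what membership in [in_L2]
    gives. *)
Definition zext A u x : C := if x \in A then u x else 0.

Lemma Re_zext A u : (fun x => Re (zext A u x)) = (fun x => Re (u x)) \_ A.
Proof. by apply/funext => x; rewrite /zext patchE; case: ifP. Qed.

Lemma Im_zext A u : (fun x => Im (zext A u x)) = (fun x => Im (u x)) \_ A.
Proof. by apply/funext => x; rewrite /zext patchE; case: ifP. Qed.

Lemma zextE A u x : A x -> zext A u x = u x.
Proof. by move=> Ax; rewrite /zext mem_set. Qed.

Lemma Lfun2_L1 a c f : f \in Lfun mu 2%:E -> L1 a c f.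
Proof.
move=> fL; have fi := Lfun2_integrable_sqr fL.
have mf : mfun setT f by move: fL; rewrite inE => /andP[]; rewrite inE.
have f2 : L1 a c (fun x => f x ^+ 2).
  by apply: integrableS fi => //; exact: mble_cc.
apply: (@integrable_dominated _ _ _ (fun x => 1 * f x ^+ 2 + 1)).
- exact: mble_cc.
- exact: measurable_funS mf.
- move=> x _; rewrite mul1r -real_normK ?num_real//.
  by have := sqr_ge0 (`|f x| - 1); have := normr_ge0 (f x); nra.
- by apply: integrable_lin => //; exact: integrable_cc_cst.
Qed.

Lemma in_L2_cint A u a c : in_L2 A u -> cint `[a, c] (zext A u).
Proof.
by move=> [ru iu]; split; rewrite ?Re_zext ?Im_zext; exact: Lfun2_L1.
Qed.

Lemma Rintegral_oo_restrict a c (f g : R -> R) : (forall x, f x = g x) ->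
  \int[mu]_(x in `]a, c[) f x = \int[mu]_(x in `[a, c]) (g \_ `]a, c[) x.
Proof.
move=> fg; rewrite -Rintegral_mkcondr setIidr.
  by apply: eq_Rintegral => x _.
by move=> x; rewrite /= !in_itv/= => /andP[/ltW-> /ltW->].
Qed.

Lemma Rintegral_oo_cc a c (f : R -> R) : L1 a c f ->
  \int[mu]_(x in `]a, c[) f x = \int[mu]_(x in `[a, c]) f x.
Proof.
move=> fi; rewrite Rintegral_itv_obnd_cbnd.
  rewrite Rintegral_itv_bndo_bndc//.
  apply: integrableS fi; [exact: measurable_itv..|].
  by move=> x; rewrite /= !in_itv/= => /andP[-> /ltW->].
apply: integrableS fi; [exact: measurable_itv..|].
by move=> x; rewrite /= !in_itv/= => /andP[/ltW-> /ltW->].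
Qed.

(** Continuity of [u] selects the representative for which the identity of
    [weak_second_primitive], applied to the real and imaginary parts, holds at
    every point. *)
Lemma second_derivative_primitive a c u w : a < c -> ccontinuous_on `[a, c] u ->
  second_derivative a c u w ->
  exists A B : C, forall x, a <= x <= c ->
    u x = A + B * (x - a)%:C + cprim a (cprim a (zext `]a, c[ w)) x.
Proof.
move=> ac [cr ci] [v [_ _ w2 uv vw]].
have [wr wi] := in_L2_cint a c w2.
have key phi : test_function a c phi ->
    cintegral `]a, c[ (fun x => u x * ((phi^`())^`()%classic x)%:C) =
    cintegral `]a, c[ (fun x => w x * (phi x)%:C).
  by move=> tphi; rewrite uv ?vw ?opprK//; exact: test_function_deriv.
have continuous2 phi : test_function a c phi -> continuous (phi^`())^`()%classic.
  by move=> [sphi _]; exact: smooth_continuous (smooth_derive1 (smooth_derive1 sphi)).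
have [|Ar [Br HR]] := weak_second_primitive ac cr wr.
  move=> phi tphi; have := congr1 (@complex.Re R) (key phi tphi); rewrite /cintegral /=.
  rewrite (Rintegral_oo_cc (f := fun x => Re (u x * ((phi^`())^`()%classic x)%:C))); last first.
    have := L1_mul_continuous cr (continuous2 _ tphi); apply: eq_integrable => //.
    by move=> x _ /=; rewrite Re_mul/= mulr0 subr0.
  rewrite (@Rintegral_oo_restrict _ _ _ (fun x => phi x * Re (w x))); last first.
    by move=> x; rewrite Re_mul/= mulr0 subr0 mulrC.
  move=> E; transitivity (\int[mu]_(x in `[a, c]) Re (u x * ((phi^`())^`()%classic x)%:C)).
    by apply: eq_Rintegral => x _; rewrite Re_mul/= mulr0 subr0.
  rewrite E; apply: eq_Rintegral => x _; rewrite patchE /zext.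
  by case: ifP; rewrite //= mulr0.
have [|Ai [Bi HI]] := weak_second_primitive ac ci wi.
  move=> phi tphi; have := congr1 (@complex.Im R) (key phi tphi); rewrite /cintegral /=.
  rewrite (Rintegral_oo_cc (f := fun x => Im (u x * ((phi^`())^`()%classic x)%:C))); last first.
    have := L1_mul_continuous ci (continuous2 _ tphi); apply: eq_integrable => //.
    by move=> x _ /=; rewrite Im_mul/= mulr0 add0r.
  rewrite (@Rintegral_oo_restrict _ _ _ (fun x => phi x * Im (w x))); last first.
    by move=> x; rewrite Im_mul/= mulr0 add0r mulrC.
  move=> E; transitivity (\int[mu]_(x in `[a, c]) Im (u x * ((phi^`())^`()%classic x)%:C)).
    by apply: eq_Rintegral => x _; rewrite Im_mul/= mulr0 add0r.
  rewrite E; apply: eq_Rintegral => x _; rewrite patchE /zext.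
  by case: ifP; rewrite //= mulr0.
exists (Ar +i* Ai), (Br +i* Bi) => x xac; apply: complex_ext.
  by rewrite (HR x xac) !ReImE /= mulr0 subr0.
by rewrite (HI x xac) !ReImE /= mulr0 add0r.
Qed.

Definition blf a c (Lam : (R -> C) -> C) :=
  (forall z f g, cint `[a, c] f -> cint `[a, c] g ->
    Lam (fun x => z * f x + g x) = z * Lam f + Lam g) /\
  exists2 M : R, 0 <= M & forall f, cint `[a, c] f ->
    N1 (Lam f) <= M * \int[mu]_(x in `[a, c]) N1 (f x).

Lemma blf_cprim2 a c x : a <= x <= c -> blf a c (fun f => cprim a (cprim a f) x).
Proof.
move=> /andP[ax xc]; have ac := le_trans ax xc; split=> [z f g fi gi|].
  rewrite -(@cprim_lin a c)//; [|exact: cprim_cint..].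
  apply: eq_cintegral => t; rewrite /= in_itv/= => /andP[at_ tx].
  by rewrite (@cprim_lin a c)// (le_trans tx).
exists (c - a) => [|f fi]; first by rewrite subr_ge0.
by apply: cprim2_bound => //; rewrite ax.
Qed.

Lemma blf_scale_arg a c Lam z u : blf a c Lam -> cint `[a, c] u ->
  Lam (fun x => z * u x) = z * Lam u.
Proof.
move=> [lin [m m0 Lm]] ui; have i0 : cint `[a, c] (fun=> (0 : C)) by exact: cint_cst.
have L0 : Lam (fun=> 0) = 0.
  apply: N1_eq0; apply: le_trans (Lm _ i0) _; rewrite N10.
  by rewrite (@Rintegral_cst _ _ _ mu _ (@mble_cc _ _) 0) mul0r mulr0.
have -> : (fun x => z * u x) = fun x => z * u x + 0 by apply/funext => x; rewrite addr0.
by rewrite lin// L0 addr0.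
Qed.

(** Totality of the exponentials, for complex functionals: on real functions,
    the real and imaginary parts of the functional are real functionals. *)
Lemma blf_exp_total a c Lam : a <= c -> blf a c Lam ->
  (forall s : R, s != 0 -> Lam (fun x => (expR (s * x))%:C) = 0) ->
  forall f, cint `[a, c] f -> Lam f = 0.
Proof.
move=> ac [lin [M M0 LM]] Lexp.
have cintR (f : R -> R) : L1 a c f -> cint `[a, c] (fun x => (f x)%:C).
  by move=> fi; split => //=; exact: integrable_cc_cst.
have linR (k : R) (f g : R -> R) : L1 a c f -> L1 a c g ->
    Lam (fun x => (k * f x + g x)%:C) =
    k%:C * Lam (fun x => (f x)%:C) + Lam (fun x => (g x)%:C).
  move=> fi gi; rewrite -lin; [|exact: cintR..].
  congr Lam; apply/funext => x; apply: complex_ext; rewrite !ReImE /=; ring.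
have bndR (f : R -> R) : L1 a c f ->
    N1 (Lam (fun x => (f x)%:C)) <= M * \int[mu]_(x in `[a, c]) `|f x|.
  move=> fi; apply: le_trans (LM _ (cintR _ fi)) _.
  have -> // : \int[mu]_(x in `[a, c]) N1 (f x)%:C = \int[mu]_(x in `[a, c]) `|f x|.
  by apply: eq_Rintegral => x _; exact: N1_real.
have Lreal (f : R -> R) : L1 a c f -> Lam (fun x => (f x)%:C) = 0.
  move=> fi; apply: complex_ext => /=.
  - apply: (@exp_total _ a c (fun f => Re (Lam (fun x => (f x)%:C))) M) fi.
    + by move=> k g g' gi gi'; rewrite linR// !ReImE/= mul0r subr0.
    + by move=> g gi; apply: le_trans (Re_le_N1 _) (bndR _ gi).
    + by move=> s s0; rewrite Lexp.
  - apply: (@exp_total _ a c (fun f => Im (Lam (fun x => (f x)%:C))) M) fi.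
    + by move=> k g g' gi gi'; rewrite linR// !ReImE/= mul0r addr0.
    + by move=> g gi; apply: le_trans (Im_le_N1 _) (bndR _ gi).
    + by move=> s s0; rewrite Lexp.
move=> f [ri ii].
have -> : f = fun x => 'i%C * (Im (f x))%:C + (Re (f x))%:C.
  by apply/funext => x; apply: complex_ext; rewrite !ReImE/=; ring.
by rewrite lin ?Lreal ?mulr0 ?addr0//; exact: cintR.
Qed.

End ComplexPrimitives.

(** * Derivatives at the ends of an interval *)

Section OneSidedDerivatives.
Context {R : realType}.
Local Notation mu := (@lebesgue_measure R).
Local Notation C := R[i].
Local Notation Re := complex.Re.
Local Notation Im := complex.Im.
Local Notation mble A := (@measurable _ (measurableTypeR R) A).
Local Notation mfun A f := (@measurable_fun _ _ (measurableTypeR R) R A f).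
Local Notation L1 a c f := (mu.-integrable `[a, c] (EFin \o f)).
Implicit Types (z : C) (u v w : R -> C) (x a c : R).

Lemma prim_left a (w : R -> R) : prim a w a = 0.
Proof. by rewrite /prim set_itv1 Rintegral_set1. Qed.

Lemma is_derive_affine_prim2 a c (A B y : R) (f w : R -> R) : L1 a c w ->
  (forall x, a <= x <= c -> f x = A + B * (x - a) + prim a (prim a w) x) ->
  a < y < c -> is_derive y 1 f (B + prim a w y).
Proof.
move=> wi fE /andP[ay yc]; have ac := lt_trans ay yc.
have cp : {for y, continuous (prim a w)}.
  apply: (within_continuous_continuous ac (prim_continuous (ltW ac) wi)).
  by rewrite in_itv/= ay.
have [dP PE] := continuous_FTC1_closed yc (prim_integrable (ltW ac) wi) ay cp.
have D : is_derive y 1 (prim a (prim a w)) (prim a w y).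
  by apply: DeriveDef; [exact: dP|rewrite -derive1E].
have D2 : is_derive y 1 (fun x : R => A + B * (x - a) + prim a (prim a w) x)
    (B + prim a w y).
  by apply: is_derive_eq; rewrite /GRing.scale/=; ring.
apply: near_eq_is_derive D2; near=> x; rewrite fE//.
apply/andP; split; apply: ltW; near: x; [exact: (lt_nbhsr ay)|exact: (lt_nbhsl yc)].
Unshelve. all: by end_near. Qed.

Lemma derive1_cvg_ends a c (A B : R) (f w : R -> R) : a < c -> L1 a c w ->
  (forall x, a <= x <= c -> f x = A + B * (x - a) + prim a (prim a w) x) ->
  f^`()%classic y @[y --> a^'+] --> B /\
  f^`()%classic y @[y --> c^'-] --> B + prim a w c.
Proof.
move=> ac wi fE.
have [_ pa pc] := (continuous_within_itvP _ ac).1 (prim_continuous (ltW ac) wi).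
have dE y : a < y < c -> B + prim a w y = f^`()%classic y.
  move=> yac; have D := is_derive_affine_prim2 wi fE yac.
  by rewrite derive1E (@derive_val _ _ _ _ _ _ _ D).
split.
- have H : (B + prim a w y) @[y --> a^'+] --> B.
    rewrite -[X in _ --> X]addr0 -(prim_left a w).
    by apply: cvgD; [exact: cvg_cst|exact: pa].
  apply: cvg_trans H; apply: near_eq_cvg; near=> y; rewrite dE//.
  by apply/andP; split; near: y; [exact: nbhs_right_gt|exact: nbhs_right_lt].
- have H : (B + prim a w y) @[y --> c^'-] --> B + prim a w c.
    by apply: cvgD; [exact: cvg_cst|exact: pc].
  apply: cvg_trans H; apply: near_eq_cvg; near=> y; rewrite dE//.
  by apply/andP; split; near: y; [exact: nbhs_left_gt|exact: nbhs_left_lt].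
Unshelve. all: by end_near. Qed.

(** Inside the interval the derivative is [B + cprim a w], which is continuous up
    to the ends. *)
Lemma derivative_ends a c (A B : C) u w : a < c -> cint `[a, c] w ->
  (forall x, a <= x <= c -> u x = A + B * (x - a)%:C + cprim a (cprim a w) x) ->
  derivative_right u a B /\ derivative_left u c (B + cprim a w c).
Proof.
move=> ac [rw iw] uE.
have [rr rl] : (fun y => Re (u y))^`()%classic y @[y --> a^'+] --> Re B /\
    (fun y => Re (u y))^`()%classic y @[y --> c^'-] --> Re B + prim a (fun x => Re (w x)) c.
  apply: (@derive1_cvg_ends _ _ (Re A)) ac rw _ => x xac.
  by rewrite (uE x xac) !(Re_add, Re_mul)/= mulr0 subr0.
have [ir il] : (fun y => Im (u y))^`()%classic y @[y --> a^'+] --> Im B /\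
    (fun y => Im (u y))^`()%classic y @[y --> c^'-] --> Im B + prim a (fun x => Im (w x)) c.
  apply: (@derive1_cvg_ends _ _ (Im A)) ac iw _ => x xac.
  by rewrite (uE x xac) !(Im_add, Im_mul)/= mulr0 add0r.
by split; split; rewrite ?Re_add ?Im_add.
Qed.

Lemma derivative_right_unique u x d d' :
  derivative_right u x d -> derivative_right u x d' -> d = d'.
Proof.
move=> [r i] [r' i'].
by apply: complex_ext; [exact: (cvg_unique _ r r')|exact: (cvg_unique _ i i')].
Qed.

Lemma derivative_left_unique u x d d' :
  derivative_left u x d -> derivative_left u x d' -> d = d'.
Proof.
move=> [r i] [r' i'].
by apply: complex_ext; [exact: (cvg_unique _ r r')|exact: (cvg_unique _ i i')].
Qed.

Lemma norm_N1 z : `|z| <= (N1 z)%:C.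
Proof.
case: z => x y; rewrite normc_def lecR /N1/=.
rewrite -[leRHS]ger0_norm; last exact: addr_ge0.
rewrite -sqrtr_sqr ler_wsqrtr// sqrrD.
rewrite !real_normK ?num_real// -addrA lerD2l lerDr.
by rewrite mulrn_wge0// mulr_ge0.
Qed.

Lemma N1_norm z : N1 z <= 2 * Re `|z|.
Proof.
case: z => x y; rewrite normc_def /N1/=.
have H (r s : R) : `|r| <= Num.sqrt (r ^+ 2 + s ^+ 2).
  by rewrite -sqrtr_sqr ler_wsqrtr// lerDl sqr_ge0.
have := H x y; have := H y x; rewrite addrC; lra.
Qed.

(** Absolute continuity is tested with a single interval. *)
Lemma abs_cont_continuous a c u : abs_cont a c u -> ccontinuous_on `[a, c] u.
Proof.
move=> acu.
have H (e : R) : 0 < e -> exists2 d : R, 0 < d & forall x y, a <= x <= c -> a <= y <= c ->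
    `|x - y| < d -> N1 (u x - u y) <= e.
  move=> e0; have e20 : 0 < e / 2 by rewrite divr_gt0.
  have [d d0 Hd] := acu _ e20; exists d => // x y.
  wlog xy : x y / x <= y.
    move=> W xac yac; have [xy|yx] := leP x y; first exact: W.
    by rewrite distrC -N1N opprB; apply: W => //; exact: ltW.
  move=> /andP[ax xc] /andP[ay yc]; rewrite distrC ger0_norm ?subr_ge0// => yxd.
  have := Hd 1%N (fun=> x) (fun=> y) _ _; rewrite !big_ord1.
  move=> /(_ _ _ yxd); rewrite -N1N opprB => K.
  have {}K : `|u y - u x| < (e / 2)%:C.
    by apply: K => // i j; rewrite !ord1 eqxx.
  apply: le_trans (N1_norm _) _; rewrite mulrC -ler_pdivlMr//.
  by move: K; rewrite ltcE/= => /andP[_ /ltW].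
suff S (f : R -> R) : (forall e, 0 < e -> exists2 d : R, 0 < d &
    forall x y, a <= x <= c -> a <= y <= c ->
    `|x - y| < d -> `|f x - f y| <= e) -> {within `[a, c], continuous f}.
  split; apply: S => e /H[d d0 K]; exists d => // x y xac yac xyd;
    apply: le_trans _ (K x y xac yac xyd).
  - by rewrite -Re_opp -Re_add; exact: Re_le_N1.
  - by rewrite -Im_opp -Im_add; exact: Im_le_N1.
move=> K; apply/subspace_continuousP => x; rewrite /= in_itv/= => xac.
apply/cvgrPdist_le => e /K[d d0 fd]; rewrite near_withinE; near=> y.
rewrite /= in_itv/= => yac; apply: fd => //.
Unshelve. all: by end_near. Qed.

End OneSidedDerivatives.

(** * Continuous complex functions on a segment *)

Section ContinuousOnSegment.
Context {R : realType}.
Local Notation C := R[i].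
Local Notation Re := complex.Re.
Local Notation Im := complex.Im.
Local Notation mu := (@lebesgue_measure R).
Implicit Types (u v : R -> C) (a c x : R).

Lemma ccontinuous_cint a c u : ccontinuous_on `[a, c] u -> cint `[a, c] u.
Proof. by move=> [r i]; split; exact: L1_continuous. Qed.

Lemma ccontinuous_bounded a c u : ccontinuous_on `[a, c] u ->
  exists2 m : R, 0 <= m & forall x, a <= x <= c -> N1 (u x) <= m.
Proof.
move=> [/continuous_bounded_cc[m m0 um] /continuous_bounded_cc[m' m'0 um']].
exists (m + m') => [|x xac]; first exact: addr_ge0.
by apply: lerD; [exact: um|exact: um'].
Qed.

Lemma ccontinuous_lin a c u v z : ccontinuous_on `[a, c] u -> ccontinuous_on `[a, c] v ->
  ccontinuous_on `[a, c] (fun x => z * u x + v x).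
Proof.
move=> [ru iu] [rv iv]; split.
- have -> : (fun x => Re (z * u x + v x)) =
    fun x => Re z * Re (u x) - Im z * Im (u x) + Re (v x).
    by apply/funext => x; rewrite Re_add Re_mul.
  move=> x; apply: cvgD; last exact: rv.
  by apply: cvgB; apply: cvgM; [exact: cvg_cst|exact: ru|exact: cvg_cst|exact: iu].
- have -> : (fun x => Im (z * u x + v x)) =
    fun x => Re z * Im (u x) + Im z * Re (u x) + Im (v x).
    by apply/funext => x; rewrite Im_add Im_mul.
  move=> x; apply: cvgD; last exact: iv.
  by apply: cvgD; apply: cvgM; [exact: cvg_cst|exact: iu|exact: cvg_cst|exact: ru].
Qed.

Lemma ccontinuous_real a c (f : R -> R) : continuous f ->
  ccontinuous_on `[a, c] (fun x => (f x)%:C).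
Proof.
by move=> cf; split => /=; apply: continuous_subspaceT => // x; exact: cvg_cst.
Qed.

Lemma eq_ccontinuous a c u v : (forall x, a <= x <= c -> u x = v x) ->
  ccontinuous_on `[a, c] u -> ccontinuous_on `[a, c] v.
Proof.
move=> uv; have E x : x \in (`[a, c]%classic : set R) -> u x = v x.
  by rewrite inE/= in_itv/=; exact: uv.
move=> [ru iu]; split.
- by apply: (subspace_eq_continuous _ ru) => x xI; congr (complex.Re _); exact: E.
- by apply: (subspace_eq_continuous _ iu) => x xI; congr (complex.Im _); exact: E.
Qed.

End ContinuousOnSegment.

(** * Square integrable functions *)

Section SquareIntegrable.
Context {R : realType}.
Local Notation mu := (@lebesgue_measure R).
Local Notation C := R[i].
Local Notation Re := complex.Re.
Local Notation Im := complex.Im.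
Local Notation mble A := (@measurable _ (measurableTypeR R) A).
Local Notation mfun A f := (@measurable_fun _ _ (measurableTypeR R) R A f).
Local Notation L1 a c f := (mu.-integrable `[a, c] (EFin \o f)).
Implicit Types (z : C) (V w u v : R -> C) (x a c : R).

Lemma Lfun2_sqr_integrable (f : R -> R) : mfun setT f ->
  mu.-integrable setT (EFin \o (fun x => f x ^+ 2)) -> f \in Lfun mu 2%:E.
Proof.
move=> mf fi; rewrite inE; apply/andP; split; rewrite inE//=.
rewrite /finite_norm unlock poweR_lty//.
have [_] := integrableP _ _ _ fi; apply: le_lt_trans.
rewrite le_eqVlt; apply/orP; left; apply/eqP; apply: eq_integral => x _ /=.
by rewrite powR_mulrn// normrX.
Qed.

Lemma Lfun2_measurable (f : R -> R) : f \in Lfun mu 2%:E -> mfun setT f.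
Proof. by rewrite inE => /andP[]; rewrite inE. Qed.

Lemma Lfun2_dominated (f g h : R -> R) : mfun setT f ->
  g \in Lfun mu 2%:E -> h \in Lfun mu 2%:E ->
  (forall x, `|f x| <= `|g x| + `|h x|) -> f \in Lfun mu 2%:E.
Proof.
move=> mf gL hL fgh; apply: Lfun2_sqr_integrable => //.
have mT : mble setT by exact: measurableT.
have gi := Lfun2_integrable_sqr gL; have hi := Lfun2_integrable_sqr hL.
apply: (@integrable_dominated _ _ _ (fun x => 2 * g x ^+ 2 + (1 * h x ^+ 2 + h x ^+ 2))) => //.
- exact: measurable_funX.
- move=> x _; rewrite normrX; have := fgh x.
  rewrite -(real_normK (num_real (g x))) -(real_normK (num_real (h x))).
  have := normr_ge0 (f x); have := normr_ge0 (g x); have := normr_ge0 (h x).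
  move: `|f x| `|g x| `|h x| => F G H H0 G0 F0 FGH.
  by have := sqr_ge0 (G - H); nra.
- by apply: integrable_lin => //; exact: integrable_lin.
Qed.

Lemma in_L2_eq A u v : (forall x, A x -> v x = u x) -> in_L2 A u -> in_L2 A v.
Proof.
have S (f g : R -> R) : (forall x, A x -> g x = f x) -> f \_ A = g \_ A.
  move=> fg; apply/funext => x; rewrite !patchE.
  by case: ifPn => // /[!inE] /fg ->.
move=> uv [r i]; split.
  by rewrite -(S (fun x => Re (u x)))// => x /uv ->.
by rewrite -(S (fun x => Im (u x)))// => x /uv ->.
Qed.

Lemma in_L2_sub A B u : mble B -> B `<=` A -> in_L2 A u -> in_L2 B u.
Proof.
move=> mB BA; have S (f : R -> R) : f \_ A \in Lfun mu 2%:E -> f \_ B \in Lfun mu 2%:E.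
  move=> fL; apply: (@Lfun2_dominated _ (f \_ A) (f \_ A)) => //.
    have -> : f \_ B = (f \_ A) \_ B.
      apply/funext => x; rewrite !patchE; case: ifPn => // /[!inE] /BA Ax.
      by rewrite mem_set.
    apply/(measurable_restrictT _ mB); apply: measurable_funS (Lfun2_measurable fL) => //.
  move=> x; rewrite ler_wpDr// !patchE; case: ifPn; rewrite ?normr0//.
  by rewrite inE => /BA Ax; rewrite mem_set.
by move=> [r i]; split; exact: S.
Qed.

Lemma Lfun2_scale M (f : R -> R) : f \in Lfun mu 2%:E ->
  (fun x => M * f x) \in Lfun mu 2%:E.
Proof.
move=> fL; apply: Lfun2_sqr_integrable.
  by apply: measurable_funM; [exact: measurable_cst|exact: Lfun2_measurable].
have := integrableZl (measurableT : mble setT) (M ^+ 2) (Lfun2_integrable_sqr fL).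
by apply: eq_integrable => // x _ /=; rewrite -EFinM exprMn.
Qed.

(** Measurability is a hypothesis because the Borel sigma-algebra is not
    complete. *)
Lemma Lfun2_ae_eq (f g : R -> R) : mfun setT f -> {ae mu, forall x, f x = g x} ->
  g \in Lfun mu 2%:E -> f \in Lfun mu 2%:E.
Proof.
move=> mf fg gL; apply: Lfun2_sqr_integrable => //.
have mE (k : R -> R) : mfun setT k ->
    @measurable_fun _ _ (measurableTypeR R) _ setT (EFin \o (fun x => k x ^+ 2)).
  by move=> mk; apply/measurable_EFinP; exact: measurable_funX.
have [_ gfin] := integrableP _ _ _ (Lfun2_integrable_sqr gL).
apply/integrableP; split; first exact: mE.
apply: le_lt_trans gfin; rewrite le_eqVlt; apply/orP; left; apply/eqP.
apply: ge0_ae_eq_integral => //.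
- by apply: measurableT_comp => //; exact: mE.
- by apply: measurableT_comp => //; apply: mE; exact: Lfun2_measurable.
- by apply: ae_imply fg => x /= -> _.
Qed.

Lemma Lfun2_N1 A u : mble A -> in_L2 A u -> (fun x => N1 (u x)) \_ A \in Lfun mu 2%:E.
Proof.
move=> mA [ur ui].
have E : (fun x => N1 (u x)) \_ A =
    fun x => `|((fun x => Re (u x)) \_ A) x| + `|((fun x => Im (u x)) \_ A) x|.
  by apply/funext => x; rewrite !patchE; case: ifP => _; rewrite ?normr0 ?addr0.
apply: (Lfun2_dominated _ ur ui) => [|x].
  rewrite E; apply: measurable_funD; apply: measurableT_comp => //; exact: Lfun2_measurable.
by rewrite E ger0_norm ?addr_ge0.
Qed.

Lemma in_L2_dominated A w (g h : R -> R) : mble A -> cmfun A w ->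
  g \in Lfun mu 2%:E -> h \in Lfun mu 2%:E ->
  (forall x, A x -> N1 (w x) <= `|g x| + `|h x|) -> in_L2 A w.
Proof.
move=> mA [wr wi] gL hL wgh.
have S (f : R -> R) : mfun A f -> (forall x, A x -> `|f x| <= N1 (w x)) ->
    f \_ A \in Lfun mu 2%:E.
  move=> mf fw; apply: (Lfun2_dominated _ gL hL) => [|x].
    exact/(measurable_restrictT _ mA).
  rewrite patchE; case: ifPn => [|_]; last by rewrite normr0 addr_ge0.
  by rewrite inE => Ax; exact: le_trans (fw x Ax) (wgh x Ax).
split; apply: S => // x _; rewrite /N1; [by rewrite lerDl|by rewrite lerDr].
Qed.

Lemma in_L2_cmfun A u : mble A -> in_L2 A u -> cmfun A u.
Proof.
by move=> mA [ur ui]; split; apply/(measurable_restrictT _ mA); exact: Lfun2_measurable.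
Qed.

Lemma in_L2_add A u v : mble A -> in_L2 A u -> in_L2 A v ->
  in_L2 A (fun x => u x + v x).
Proof.
move=> mA u2 v2; apply: (in_L2_dominated mA _ (Lfun2_N1 mA u2) (Lfun2_N1 mA v2)).
  by apply: cmfun_add; exact: in_L2_cmfun.
move=> x Ax; rewrite !patchE !mem_set// !ger0_norm ?N1_ge0//; exact: N1D.
Qed.

Lemma in_L2_mulb A M w u : mble A -> cmfun A w -> (forall x, A x -> N1 (w x) <= M) ->
  in_L2 A u -> in_L2 A (fun x => u x * w x).
Proof.
move=> mA mw wM u2; have uL := Lfun2_scale M (Lfun2_N1 mA u2).
apply: (in_L2_dominated mA _ uL uL).
  by apply: cmfun_mul => //; exact: in_L2_cmfun.
move=> x Ax; rewrite patchE mem_set//; apply: le_trans (N1M _ _) _.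
rewrite ler_wpDr// normrM mulrC (ger0_norm (N1_ge0 _)) ler_wpM2r ?N1_ge0//.
by apply: le_trans (wM x Ax) _; exact: ler_norm.
Qed.

Lemma in_L2_bounded a c M w : cmfun `]a, c[ w ->
  (forall x, a < x < c -> N1 (w x) <= M) -> in_L2 `]a, c[ w.
Proof.
move=> mw wM; have mI : mble `]a, c[ by exact: measurable_itv.
have cL : cst M \_ `]a, c[ \in Lfun mu 2%:E.
  apply: Lfun2_sqr_integrable.
    by apply/(measurable_restrictT _ mI); exact: measurable_cst.
  have Mi : mu.-integrable `]a, c[ (EFin \o (fun=> M ^+ 2)).
    apply: integrableS (integrable_cc_cst a c (M ^+ 2)); [exact: mble_cc|exact: mI|].
    by move=> x; rewrite /= !in_itv/= => /andP[/ltW-> /ltW->].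
  have := (integrable_mkcond _ mI).1 Mi; apply: eq_integrable => //= x _.
  by rewrite !patchE; case: ifP => _ //; rewrite expr0n.
apply: (in_L2_dominated mI mw cL cL) => x xI.
rewrite patchE mem_set//= ler_wpDr//; apply: le_trans (ler_norm _).
by move: xI; rewrite /= in_itv/=; exact: wM.
Qed.

Lemma in_L2_continuous a c u : ccontinuous_on `[a, c] u -> in_L2 `]a, c[ u.
Proof.
move=> cu; have [m _ um] := ccontinuous_bounded cu.
have sub : `]a, c[ `<=` `[a, c] by move=> x; rewrite /= !in_itv/= => /andP[/ltW-> /ltW->].
apply: (@in_L2_bounded _ _ m) => [|x /andP[ax xc]]; last by rewrite um ?(ltW ax)//= ltW.
exact: cint_cmfun (cintS (@mble_cc R a c) (measurable_itv _) sub (ccontinuous_cint cu)).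
Qed.

Lemma in_L2_ae_eq A u v : mble A -> cmfun A v -> {ae mu, forall x, v x = u x} ->
  in_L2 A u -> in_L2 A v.
Proof.
move=> mA [vr vi] vu [ur ui]; split.
- apply: Lfun2_ae_eq ur; first exact/(measurable_restrictT _ mA).
  by apply: ae_imply vu => x E; rewrite !patchE E.
- apply: Lfun2_ae_eq ui; first exact/(measurable_restrictT _ mA).
  by apply: ae_imply vu => x E; rewrite !patchE E.
Qed.

End SquareIntegrable.

(** * Weak derivatives of primitives *)

Section WeakDerivativesOfPrimitives.
Context {R : realType}.
Local Notation mu := (@lebesgue_measure R).
Local Notation C := R[i].
Local Notation Re := complex.Re.
Local Notation Im := complex.Im.
Local Notation mble A := (@measurable _ (measurableTypeR R) A).
Local Notation L1 a c f := (mu.-integrable `[a, c] (EFin \o f)).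
Implicit Types (z : C) (V w u v : R -> C) (x a c : R).

Lemma weak_derivative_prim_real a c (A : R) (f g phi : R -> R) : a < c ->
  L1 a c g -> (forall x, a <= x <= c -> f x = A + prim a g x) ->
  test_function a c phi ->
  \int[mu]_(x in `]a, c[) (f x * phi^`()%classic x) =
  - \int[mu]_(x in `]a, c[) (g x * phi x).
Proof.
move=> ac gi fE tphi; have [sphi _] := tphi; have [pa pc] := test_function_end tphi.
have sp : smooth phi := sphi.
have cphi := smooth_continuous sp.
have cphi' := smooth_continuous (smooth_derive1 sp).
have cf : {within `[a, c], continuous (fun x => A + prim a g x)}.
  have cp := prim_continuous (ltW ac) gi.
  by move=> x; apply: cvgD; [exact: cvg_cst|exact: cp].
have [M _ phiM] := @continuous_bounded_cc _ a c _ (continuous_subspaceT cphi).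
have igp : L1 a c (fun x => g x * phi x).
  have : L1 a c (fun x => phi x * g x).
    apply: integrable_mulb gi => //.
      exact: integrable_measurable (@L1_continuousT _ a c _ cphi).
    by move=> x; rewrite /= in_itv/=; exact: phiM.
  by apply: eq_integrable => // x _ /=; rewrite mulrC.
have ifp : L1 a c (fun x => f x * phi^`()%classic x).
  have := L1_mul_continuous cf cphi'; apply: eq_integrable => // x.
  by rewrite inE/= in_itv/= => xac; rewrite fE.
rewrite !Rintegral_oo_cc//.
transitivity (\int[mu]_(x in `[a, c]) (A * phi^`()%classic x + phi^`()%classic x * prim a g x)).
  by apply: eq_Rintegral => x; rewrite inE/= in_itv/= => xac; rewrite fE//; ring.
have iprod : L1 a c (fun x => phi^`()%classic x * prim a g x).
  have := L1_mul_continuous (prim_continuous (ltW ac) gi) cphi'.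
  by apply: eq_integrable => // x _ /=; rewrite mulrC.
rewrite Rintegral_lin//; last exact: L1_continuousT.
have := FTC2_prim (ltW ac) cphi' (fun y => smooth_is_derive y sp).
rewrite /prim pa pc subrr => ->; rewrite mulr0 add0r.
rewrite (Rintegral_prim_parts ac gi sp pa pc); congr (- _).
by apply: eq_Rintegral => x _; rewrite mulrC.
Qed.

Lemma weak_derivative_cprim a c (A : C) u v : a < c -> cint `[a, c] v ->
  (forall x, a <= x <= c -> u x = A + cprim a v x) -> weak_derivative a c u v.
Proof.
move=> ac [rv iv] uE phi tphi; apply: complex_ext; rewrite ?Re_opp ?Im_opp /=.
- have := weak_derivative_prim_real (f := fun x => Re (u x)) (A := Re A) ac rv _ tphi.
  move=> H; rewrite -[LHS]/(\int[mu]_(x in `]a, c[) Re (u x * (phi^`()%classic x)%:C)).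
  transitivity (\int[mu]_(x in `]a, c[) (Re (u x) * phi^`()%classic x)).
    by apply: eq_Rintegral => x _; rewrite Re_mul/= mulr0 subr0.
  rewrite H => [|x /uE ->]; last by rewrite Re_add.
  by congr (- _); apply: eq_Rintegral => x _; rewrite Re_mul/= mulr0 subr0.
- have := weak_derivative_prim_real (f := fun x => Im (u x)) (A := Im A) ac iv _ tphi.
  move=> H; transitivity (\int[mu]_(x in `]a, c[) (Im (u x) * phi^`()%classic x)).
    by apply: eq_Rintegral => x _; rewrite Im_mul/= mulr0 add0r.
  rewrite H => [|x /uE ->]; last by rewrite Im_add.
  by congr (- _); apply: eq_Rintegral => x _; rewrite Im_mul/= mulr0 add0r.
Qed.

Lemma cprim_continuous a c (A : C) w : a <= c -> cint `[a, c] w ->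
  ccontinuous_on `[a, c] (fun x => A + cprim a w x).
Proof.
have S (k : R) (f : R -> R) : a <= c -> L1 a c f ->
    {within `[a, c], continuous (fun x => k + prim a f x)}.
  move=> ac fi; have cp := prim_continuous ac fi.
  by move=> x; apply: cvgD; [exact: cvg_cst|exact: cp].
move=> ac [rw iw]; split.
  have -> : (fun x => Re (A + cprim a w x)) = fun x => Re A + prim a (fun t => Re (w t)) x.
    by apply/funext => x; rewrite Re_add.
  exact: S.
have -> : (fun x => Im (A + cprim a w x)) = fun x => Im A + prim a (fun t => Im (w t)) x.
  by apply/funext => x; rewrite Im_add.
exact: S.
Qed.

Lemma cprim_sub a c x y w : a <= x -> x <= y -> y <= c -> cint `[a, c] w ->
  cprim a w y - cprim a w x = cintegral `[x, y] w.
Proof.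
have S (f : R -> R) : a <= x -> x <= y -> y <= c -> L1 a c f ->
    prim a f y - prim a f x = \int[mu]_(t in `[x, y]) f t.
  move=> ax xy yc fi; rewrite /prim Rintegral_itvB ?bnd_simp//.
    apply: Rintegral_itv_obnd_cbnd; apply: integrableS fi; [exact: measurable_itv..|].
    move=> t; rewrite /= !in_itv/= => /andP[xt ty].
    by rewrite (ltW (le_lt_trans ax xt)) (le_trans ty).
  exact: L1_sub fi.
move=> ax xy yc [rw iw]; apply: complex_ext; rewrite !(Re_add, Re_opp, Im_add, Im_opp);
  exact: S.
Qed.

Lemma cintegral_cc_cst a c z : a <= c -> cintegral `[a, c] (fun=> z) = z * (c - a)%:C.
Proof.
move=> ac; rewrite /cintegral !Rintegral_cc_cst//.
by apply: complex_ext; rewrite !(Re_mul, Im_mul)/=; ring.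
Qed.

(** [u] and its first derivative are square integrable because they are
    continuous on the closed interval. *)
Lemma cprim2_H2 a c (A B : C) u w : a < c -> cint `[a, c] w -> in_L2 `]a, c[ w ->
  (forall x, a <= x <= c -> u x = A + B * (x - a)%:C + cprim a (cprim a w) x) ->
  H2_derivatives a c u (fun x => B + cprim a w x) w.
Proof.
move=> ac wi w2 uE; have pi := cprim_cint (ltW ac) wi.
have uE' x : a <= x <= c -> u x = A + cprim a (fun x => B + cprim a w x) x.
  move=> /andP[ax xc]; rewrite uE ?ax// -addrA; congr (_ + _).
  have := cprim_lin 1 xc (cint_cst a c B) pi.
  by rewrite !mul1r => ->; rewrite /cprim cintegral_cc_cst.
have vi : cint `[a, c] (fun x => B + cprim a w x).
  by have := cint_lin 1 (@mble_cc R a c) (cint_cst a c B) pi;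
     apply: eq_cint => // x _; rewrite mul1r.
split=> //.
- apply: (@in_L2_eq _ _ (fun x => A + cprim a (fun x => B + cprim a w x) x)).
    move=> x; rewrite /= in_itv/= => /andP[ax xc].
    by rewrite uE' ?(ltW ax) ?(ltW xc).
  by apply/in_L2_continuous/cprim_continuous => //; exact: ltW.
- by apply/in_L2_continuous/cprim_continuous => //; exact: ltW.
- exact: weak_derivative_cprim uE'.
- exact: weak_derivative_cprim.
Qed.

End WeakDerivativesOfPrimitives.

(** * The integrated equation with point interactions *)

Section PiecewiseEquation.
Context {R : realType}.
Local Notation mu := (@lebesgue_measure R).
Local Notation C := R[i].
Local Notation Re := complex.Re.
Local Notation Im := complex.Im.
Local Notation mble A := (@measurable _ (measurableTypeR R) A).
Local Notation mfun A f := (@measurable_fun _ _ (measurableTypeR R) R A f).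
Local Notation L1 a c f := (mu.-integrable `[a, c] (EFin \o f)).
Context (b : R) (q : R -> C) (N : nat) (xs : nat -> R) (alpha : nat -> C).
Hypothesis hI : interactions b N xs alpha.
Implicit Types (z : C) (V w u v : R -> C) (x a c : R).

(** The right derivative at [xs k] of the function that satisfies
    [piecewise V w s0] below. *)
Fixpoint slope V w (s0 : C) (k : nat) : C :=
  if k is k'.+1 then
    slope V w s0 k' + cprim (xs k') w (xs k) + alpha k * V (xs k)
  else s0.

(** Integrated form of [V'' = w] on each subinterval, with jump
    [alpha k * V (xs k)] of the derivative at [xs k] and [V'(0+) = s0]. *)
Definition piecewise V w (s0 : C) : Prop :=
  forall k x, (k <= N)%N -> xs k <= x <= xs k.+1 ->
  V x = V (xs k) + slope V w s0 k * (x - xs k)%:C + cprim (xs k) (cprim (xs k) w) x.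

Lemma xs_lt k : (k <= N)%N -> xs k < xs k.+1.
Proof. by case: hI => _ _ H _; exact: H. Qed.

Lemma xs_le i j : (i <= j)%N -> (j <= N.+1)%N -> xs i <= xs j.
Proof.
elim: j => [|j IH]; first by rewrite leqn0 => /eqP->.
rewrite leq_eqVlt => /orP[/eqP->//|]; rewrite ltnS => ij jN.
by apply: le_trans (IH ij (ltnW jN)) (ltW (xs_lt _)).
Qed.

Lemma xs_ge0 k : (k <= N.+1)%N -> 0 <= xs k.
Proof. by move=> kN; have [<- _ _ _] := hI; exact: xs_le. Qed.

Lemma xs_leb k : (k <= N.+1)%N -> xs k <= b.
Proof. by move=> kN; have [_ <- _ _] := hI; exact: xs_le. Qed.

Lemma cint_piece k w : (k <= N)%N -> cint `[0, b] w -> cint `[xs k, xs k.+1] w.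
Proof.
by move=> kN; apply: cint_sub; [exact/xs_ge0/leqW|exact: xs_leb].
Qed.

(** On each subinterval a solution is continuous and of class H^2, hence the
    double primitive of its second derivative up to an affine function. The
    slope of the affine function is identified at the left end: by the initial
    derivative on the first subinterval, by the jump condition on the others. *)
Lemma solution_piecewise v g w s0 : in_domain b N xs alpha v ->
  L_equals b q N xs v g -> derivative_right v 0 s0 -> cint `[0, b] w ->
  {ae mu, forall x, 0 < x < b -> w x = q x * v x - g x} -> piecewise v w s0.
Proof.
move=> [acv _ jump] [_ Lv] v's0 wi wE.
have cv := abs_cont_continuous acv.
have form k : (k <= N)%N -> exists B : C, forall x, xs k <= x <= xs k.+1 ->
    v x = v (xs k) + B * (x - xs k)%:C + cprim (xs k) (cprim (xs k) w) x.
  move=> kN; have xlt := xs_lt kN; have [w' v'' gE] := Lv k kN.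
  have wik := cint_piece kN wi.
  have cvk : ccontinuous_on `[xs k, xs k.+1] v.
    by move: cv => [cr ci]; split; [move: cr|move: ci];
      apply: continuous_subspaceW; apply: subset_cc;
      [exact/xs_ge0/leqW|exact: xs_leb|exact/xs_ge0/leqW|exact: xs_leb].
  have [A [B AB]] := second_derivative_primitive xlt cvk v''.
  have [v' [_ _ w'2 _ _]] := v''.
  have w'i := in_L2_cint (xs k) (xs k.+1) w'2.
  have cpE x : xs k <= x <= xs k.+1 -> 
      cprim (xs k) (zext `]xs k, xs k.+1[ w') x = cprim (xs k) w x.
    move=> /andP[kx xk]; apply: ae_eq_cintegral; first exact: mble_cc.
    - exact: cint_cmfun (cint_sub (lexx _) xk w'i).
    - exact: cint_cmfun (cint_sub (lexx _) xk wik).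
    - have ends := ae_and (ae_neq (xs k)) (ae_neq (xs k.+1)).
      have := ae_and ends (ae_and wE gE); apply: ae_imply => y [[yk yk1] [wy gy]] yI.
      have yoo : y \in `]xs k, xs k.+1[.
        move: yI; rewrite /= !in_itv/= => /andP[ky yx].
        by rewrite !lt_neqAle eq_sym yk ky yk1 (le_trans yx).
      rewrite zextE// wy; first by rewrite (gy yoo); ring.
      move: yoo; rewrite in_itv/= => /andP[ky yx1].
      rewrite (le_lt_trans (xs_ge0 (leqW kN)) ky)/=.
      exact: lt_le_trans yx1 (xs_leb _).
  have cp2E x : xs k <= x <= xs k.+1 ->
      cprim (xs k) (cprim (xs k) (zext `]xs k, xs k.+1[ w')) x =
      cprim (xs k) (cprim (xs k) w) x.
    move=> /andP[kx xk]; apply: eq_cintegral => y; rewrite /= in_itv/= => /andP[ky yx].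
    by apply: cpE; rewrite ky (le_trans yx).
  exists B => x xI; rewrite (AB x xI) cp2E//; congr (_ + _ + _).
  rewrite AB ?lexx ?ltW// subrr mulr0 addr0 cp2E ?lexx ?ltW//.
  by rewrite /cprim set_itv1 /cintegral !Rintegral_set1 addr0.
have formS k (kN : (k <= N)%N) := derivative_ends (xs_lt kN) (cint_piece kN wi).
suff H k : (k <= N)%N -> forall x, xs k <= x <= xs k.+1 ->
    v x = v (xs k) + slope v w s0 k * (x - xs k)%:C + cprim (xs k) (cprim (xs k) w) x.
  by move=> k x kN; exact: H.
elim: k => [|k IH] kN.
  have [B HB] := form 0%N kN; have [dr _] := formS _ _ _ _ kN HB.
  suff <- : B = s0 by [].
  by apply: derivative_right_unique v's0; have [<- _ _ _] := hI.
have [B HB] := form _ kN; have [dr _] := formS _ _ _ _ kN HB.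
have [_ dl] := formS _ _ _ _ (ltnW kN) (IH (ltnW kN)).
suff <- : B = slope v w s0 k.+1 by [].
have [dp [dm [hp hm]]] := jump k.+1 kN.
rewrite (derivative_right_unique hp dr) (derivative_left_unique hm dl) /=.
by move=> /eqP; rewrite subr_eq => /eqP ->; ring.
Qed.

Section FromPiecewise.
Context (V w : R -> C) (s0 : C).
Hypothesis wi : cint `[0, b] w.
Hypothesis pV : piecewise V w s0.

Let I := \int[mu]_(t in `[0, b]) N1 (w t).

Let piece_lipschitz k x y : (k <= N)%N -> xs k <= x -> x <= y -> y <= xs k.+1 ->
  N1 (V y - V x) <= (N1 (slope V w s0 k) + I) * (y - x).
Proof.
move=> kN kx xy yk; have ik := cint_piece kN wi; have klt := ltW (xs_lt kN).
have -> : V y - V x = slope V w s0 k * (y - x)%:C +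
    cintegral `[x, y] (cprim (xs k) w).
  rewrite -(cprim_sub kx xy yk (cprim_cint klt ik)).
  rewrite (pV kN (_ : xs k <= y <= xs k.+1)); last by rewrite yk (le_trans kx).
  rewrite (pV kN (_ : xs k <= x <= xs k.+1)); last by rewrite kx (le_trans xy).
  have -> : (y - x)%:C = (y - xs k)%:C - (x - xs k)%:C :> C.
    by apply: complex_ext; rewrite !(Re_add, Re_opp, Im_add, Im_opp)/=; ring.
  by ring.
apply: le_trans (N1D _ _) _; rewrite mulrDl; apply: lerD.
  by apply: le_trans (N1M _ _) _; rewrite N1_real ger0_norm ?subr_ge0.
rewrite -Rintegral_cc_cst//; apply: cintegral_bound_le.
- exact: mble_cc.
- exact: cint_sub kx yk (cprim_cint klt ik).
- exact: integrable_cc_cst.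
- move=> t; rewrite /= in_itv/= => /andP[xt ty]; rewrite /I.
  apply: cintegral_bound_sub wi; first exact/xs_ge0/leqW.
  exact: le_trans (le_trans ty yk) (xs_leb _).
Qed.

(** The slopes and the primitives of [w] are bounded on each of the finitely
    many subintervals. *)
Lemma piecewise_lipschitz : exists2 M : R, 0 <= M & forall x y,
  0 <= x -> x <= y -> y <= b -> N1 (V y - V x) <= M * (y - x).
Proof.
pose M := \sum_(k < N.+1) N1 (slope V w s0 k) + I.
have I0 : 0 <= I by exact: nrm_ge0.
have M0 : 0 <= M by rewrite addr_ge0// sumr_ge0// => k _; exact: N1_ge0.
have pieceM k x y : (k <= N)%N -> xs k <= x -> x <= y -> y <= xs k.+1 ->
    N1 (V y - V x) <= M * (y - x).
  move=> kN kx xy yk; apply: le_trans (piece_lipschitz kN kx xy yk) _.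
  rewrite ler_wpM2r ?subr_ge0// lerD2r.
  rewrite (bigD1 (Ordinal (kN : (k < N.+1)%N)))//= lerDl.
  by rewrite sumr_ge0// => j _; exact: N1_ge0.
exists M => // x y x0 xy yb.
suff H k : (k <= N.+1)%N -> forall x y, 0 <= x -> x <= y -> y <= xs k ->
    N1 (V y - V x) <= M * (y - x).
  by apply: (H N.+1) => //; have [_ -> _ _] := hI.
elim: k {x y x0 xy yb} => [|k IH] kN x y x0 xy yk.
  have xsz : xs 0 = 0 by have [-> _ _ _] := hI.
  have -> : y = x by apply/eqP; rewrite eq_le xy andbT (le_trans yk)// xsz.
  by rewrite !subrr N10 mulr0.
have [ylek|klty] := leP y (xs k); first exact: IH (ltnW kN) _ _ x0 xy ylek.
have [klex|xltk] := leP (xs k) x; first exact: pieceM kN klex xy yk.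
have -> : V y - V x = (V y - V (xs k)) + (V (xs k) - V x) by ring.
apply: le_trans (N1D _ _) _.
have := pieceM k (xs k) y kN (lexx _) (ltW klty) yk.
by have := IH (ltnW kN) x (xs k) x0 (ltW xltk) (lexx _); nra.
Qed.

Lemma piecewise_abs_cont : abs_cont 0 b V.
Proof.
have [M M0 lipV] := piecewise_lipschitz; move=> e e0.
have M1 : 0 < M + 1 by rewrite ltr_wpDl.
exists (e / (M + 1)) => [|n s t st _]; first by rewrite divr_gt0.
rewrite ltr_pdivlMr// => H.
apply: (@le_lt_trans _ _ (\sum_(i < n) (M * (t i - s i))%:C)).
  apply: ler_sum => i _; apply: le_trans (norm_N1 _) _; rewrite lecR.
  by have [? ? ?] := st i; exact: lipV.
have -> : \sum_(i < n) (M * (t i - s i))%:C = (M * \sum_(i < n) (t i - s i))%:C :> C.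
  by rewrite mulr_sumr rmorph_sum.
rewrite ltcR; apply: le_lt_trans _ H; rewrite mulrC ler_wpM2l//; last by rewrite lerDl.
by apply: sumr_ge0 => i _; have [_ ? _] := st i; rewrite subr_ge0.
Qed.

Hypothesis w2 : in_L2 `]0, b[ w.

Lemma piecewise_H2 k : (k <= N)%N -> H2_derivatives (xs k) (xs k.+1) V
  (fun x => slope V w s0 k + cprim (xs k) w x) w.
Proof.
move=> kN; apply: (cprim2_H2 _ _ _ (fun x => @pV k x kN)).
- exact: xs_lt.
- exact: cint_piece.
- apply: in_L2_sub w2; first exact: measurable_itv.
  move=> x; rewrite /= !in_itv/= => /andP[kx xk].
  by rewrite (le_lt_trans (xs_ge0 (leqW kN)) kx) (lt_le_trans xk (xs_leb _)).
Qed.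

Lemma piecewise_in_domain : in_domain b N xs alpha V.
Proof.
split.
- exact: piecewise_abs_cont.
- by move=> k kN; exists (fun x => slope V w s0 k + cprim (xs k) w x), w; exact: piecewise_H2.
- case=> [//|k] /andP[_ kN].
  exists (slope V w s0 k.+1), (slope V w s0 k + cprim (xs k) w (xs k.+1)).
  have [dr _] := derivative_ends (xs_lt kN) (cint_piece kN wi) (fun x => @pV k.+1 x kN).
  have [_ dl] := derivative_ends (xs_lt (ltnW kN)) (cint_piece (ltnW kN) wi)
    (fun x => @pV k x (ltnW kN)).
  by split=> //=; ring.
Qed.

Lemma piecewise_L_equals g : in_L2 `]0, b[ g ->
  {ae mu, forall x, 0 < x < b -> w x = q x * V x - g x} ->
  L_equals b q N xs V g.
Proof.
move=> g2 gE; split=> // k kN; exists w.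
  by exists (fun x => slope V w s0 k + cprim (xs k) w x); exact: piecewise_H2.
apply: ae_imply gE => x gx; rewrite in_itv/= => /andP[kx xk].
rewrite gx; first by ring.
by rewrite (le_lt_trans (xs_ge0 (leqW kN)) kx) (lt_le_trans xk (xs_leb _)).
Qed.

End FromPiecewise.

End PiecewiseEquation.

(** * Integral operators with bounded kernels *)

Section Kernels.
Context {R : realType}.
Local Notation mu := (@lebesgue_measure R).
Local Notation C := R[i].
Local Notation Re := complex.Re.
Local Notation Im := complex.Im.
Local Notation mble A := (@measurable _ (measurableTypeR R) A).
Local Notation mfun A f := (@measurable_fun _ _ (measurableTypeR R) R A f).
Local Notation m2fun F :=
  (@measurable_fun _ _ (measurableTypeR R * measurableTypeR R)%type R setT F).
Local Notation L1 a c f := (mu.-integrable `[a, c] (EFin \o f)).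
Implicit Types (F G : R * R -> R) (x t a c : R).

Lemma Lfun_oo_ae_bounded F : F \in Lfun (mu \x mu)%E +oo%E ->
  exists2 M : R, 0 <= M & {ae (mu \x mu)%E, forall p, `|F p| <= M}.
Proof.
rewrite inE => /andP[]; rewrite !inE/= => mF; rewrite /finite_norm unlock/=.
case: ifPn => [muT|muT _]; last first.
  exists 0 => //; exists setT; split => //.
  by apply/eqP; rewrite eq_le measure_ge0 andbT leNgt.
have := ess_sup_ge (mu \x mu)%E (abse \o (EFin \o F)).
case: (ess_sup _ _) => [r H _|//|H _].
- exists `|r| => //; apply: filterS H => p /=.
  by rewrite lee_fin => /le_trans; apply; exact: ler_norm.
- by exists 0 => //; apply: filterS H => p /=; rewrite leeNy_eq.
Qed.

(** Almost every section of a null set is null, by Tonelli's theorem. *)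
Lemma negligible_xsection (P : R * R -> Prop) : {ae (mu \x mu)%E, forall p, P p} ->
  {ae mu, forall x, {ae mu, forall t, P (x, t)}}.
Proof.
move=> [A [mA A0 PA]].
have mphi := measurable_fun_xsection mu mA.
have H : (\int[mu]_x `|(mu \o xsection A) x|)%E = 0%E.
  by rewrite -[RHS]A0; apply: eq_integral => x _; rewrite gee0_abs.
have := (ae_eq_integral_abs mu measurableT mphi).1 H.
apply: ae_imply => x /(_ I) /= Ax; exists (xsection A x); split => //.
  exact: measurable_xsection.
by move=> t /= nP; rewrite /xsection/= inE; apply: PA.
Qed.

(** Clamping to [[- M, M]], where [M] is an essential bound, gives an
    everywhere bounded version of an essentially bounded kernel; almost every
    section of it is a version of the section. *)
Lemma bounded_version F : F \in Lfun (mu \x mu)%E +oo%E ->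
  exists G, exists2 M : R, 0 <= M &
   [/\ m2fun G, forall p, `|G p| <= M
     & {ae mu, forall x, {ae mu, forall t, F (x, t) = G (x, t)}}].
Proof.
move=> FL; have [M M0 FM] := Lfun_oo_ae_bounded FL.
have mF : m2fun F by move: FL; rewrite inE => /andP[]; rewrite inE.
exists (fun p => Num.max (- M) (Num.min (F p) M)), M => //; split.
- apply: measurable_maxr; first exact: measurable_cst.
  by apply: measurable_minr => //; exact: measurable_cst.
- move=> p; rewrite ler_norml le_max lexx/= ge_max ge_min lexx orbT andbT.
  by rewrite (le_trans _ M0)// oppr_le0.
- apply: (@negligible_xsection (fun p => F p = Num.max (- M) (Num.min (F p) M))).
  apply: (@filterS _ _ (ae_filter_ringOfSetsType (mu \x mu)%E)) FM => p.
  rewrite ler_norml => /andP[h1 h2].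
  by rewrite (min_idPl h2) (max_idPr h1).
Qed.

Lemma measurable_Rintegral_section F : m2fun F ->
  mfun setT (fun x => \int[mu]_t F (x, t)).
Proof.
move=> mF.
have mEF : @measurable_fun _ _ (measurableTypeR R * measurableTypeR R)%type _ setT
  (EFin \o F) by exact/measurable_EFinP.
apply: measurableT_comp; first exact: fine_measurable.
have -> : (fun x : measurableTypeR R => \int[mu]_t (F (x, t))%:E)%E =
  (fun x => (\int[mu]_t ((EFin \o F)^\+ (x, t)) - \int[mu]_t ((EFin \o F)^\- (x, t)))%E).
  apply/funext => x; rewrite integralE; congr (_ - _)%E.
  - by apply: eq_integral => t _; rewrite funeposE funeposE.
  - by apply: eq_integral => t _; rewrite funenegE funenegE.
apply: emeasurable_funB.
- exact: (@measurable_fun_fubini_tonelli_F _ _ (measurableTypeR R) (measurableTypeR R) R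
    mu _ (measurable_funepos mEF) (funepos_ge0 _)).
- exact: (@measurable_fun_fubini_tonelli_F _ _ (measurableTypeR R) (measurableTypeR R) R
    mu _ (measurable_funeneg mEF) (funeneg_ge0 _)).
Qed.

Definition kint a c (k : R -> R -> C) (u : R -> C) x : C :=
  cintegral `[a, c] (fun t => k x t * u t).

Definition measurable_kernel (k : R -> R -> C) :=
  m2fun (fun p => Re (k p.1 p.2)) /\ m2fun (fun p => Im (k p.1 p.2)).

Definition bounded_kernel (k : R -> R -> C) (M : R) :=
  measurable_kernel k /\ forall x t, N1 (k x t) <= M.

Lemma measurable_kernel_section a c k x : measurable_kernel k -> cmfun `[a, c] (k x).
Proof.
move=> [mr mi].
have S (f : R * R -> R) : m2fun f -> mfun `[a, c] (fun t => f (x, t)).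
  move=> mf; have := @measurable_fun_pair2 _ _ _ (measurableTypeR R) (measurableTypeR R) R _ x mf.
  exact: measurable_funS.
by split; [exact: (S (fun p => Re (k p.1 p.2)))|exact: (S (fun p => Im (k p.1 p.2)))].
Qed.

(** The integrand is jointly measurable, so Tonelli's theorem for its positive
    and negative parts gives measurability in [x]. *)
Lemma kint_cmfun a c k (u : R -> C) A : mble A -> measurable_kernel k ->
  cint `[a, c] u -> cmfun A (kint a c k u).
Proof.
move=> mA [mr mi] [ru iu].
have m2 (r : R -> R) : L1 a c r -> m2fun (fun p => (r \_ `[a, c]) p.2).
  move=> ri; have mr' : mfun setT (r \_ `[a, c]).
    by apply/(measurable_restrictT _ (@mble_cc R a c)); exact: integrable_measurable.
  by apply: (measurableT_comp mr'); exact: measurable_snd.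
have mru := m2 _ ru; have miu := m2 _ iu.
have restr (f : R -> R -> R) (g : R * R -> R) : m2fun g ->
    (forall x t, g (x, t) = (f x \_ `[a, c]) t) ->
    mfun A (fun x => \int[mu]_(t in `[a, c]) f x t).
  move=> mg gE; have := measurable_Rintegral_section mg.
  have -> : (fun x => \int[mu]_t g (x, t)) = (fun x => \int[mu]_(t in `[a, c]) f x t).
    apply/funext => x; rewrite [RHS]Rintegral_mkcond.
    by apply: eq_Rintegral => t _; rewrite gE.
  exact: measurable_funS.
split.
- apply: (restr _ (fun p => Re (k p.1 p.2) * ((fun t => Re (u t)) \_ `[a, c]) p.2 -
    Im (k p.1 p.2) * ((fun t => Im (u t)) \_ `[a, c]) p.2)).
    by apply: measurable_funB; exact: measurable_funM.
  by move=> x t /=; rewrite !patchE /=; case: ifP => _; [rewrite Re_mul|rewrite !mulr0 subr0].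
- apply: (restr _ (fun p => Re (k p.1 p.2) * ((fun t => Im (u t)) \_ `[a, c]) p.2 +
    Im (k p.1 p.2) * ((fun t => Re (u t)) \_ `[a, c]) p.2)).
    by apply: measurable_funD; exact: measurable_funM.
  by move=> x t /=; rewrite !patchE /=; case: ifP => _; [rewrite Im_mul|rewrite !mulr0 addr0].
Qed.

Section BoundedKernel.
Context (a c : R) (k : R -> R -> C) (M : R).
Hypothesis kM : bounded_kernel k M.

Lemma kint_cint x (u : R -> C) : cint `[a, c] u -> cint `[a, c] (fun t => k x t * u t).
Proof.
have [mk kb] := kM; apply: (@cint_mulb _ _ _ _ M) => //.
exact: measurable_kernel_section mk.
Qed.

Lemma kint_lin x z (u v : R -> C) : cint `[a, c] u -> cint `[a, c] v ->
  kint a c k (fun t => z * u t + v t) x = z * kint a c k u x + kint a c k v x.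
Proof.
move=> ui vi; rewrite /kint -cintegral_lin; [|exact: mble_cc|exact: kint_cint..].
by apply: eq_cintegral => t _; ring.
Qed.

Lemma kint_bound x (u : R -> C) : cint `[a, c] u ->
  N1 (kint a c k u x) <= M * \int[mu]_(t in `[a, c]) N1 (u t).
Proof.
move=> ui; have iN := cint_N1 (@mble_cc R a c) ui.
rewrite -RintegralZl//; apply: cintegral_bound_le.
- exact: mble_cc.
- exact: kint_cint.
- by have := integrableZl (@mble_cc R a c) M iN; apply: eq_integrable.
- move=> t _; apply: le_trans (N1M _ _) _; rewrite ler_wpM2r ?N1_ge0//.
  by have [_] := kM; apply.
Qed.

End BoundedKernel.

Lemma cintegral_zext A B (u : R -> C) : B `<=` A ->
  cintegral B u = cintegral A (zext B u).
Proof.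
move=> BA; rewrite /cintegral Re_zext Im_zext -!Rintegral_mkcondr.
by rewrite setIidr.
Qed.

Lemma zext_mul A (u v : R -> C) x : zext A (fun t => u t * v t) x = zext A u x * v x.
Proof. by rewrite /zext; case: ifP; rewrite ?mul0r. Qed.

Definition triangle (b : R) : set (R * R) := [set p | 0 < p.1 <= b /\ `|p.2| <= p.1].

(** Since the Borel sigma-algebra is not complete, measurability of [T u] cannot
    be inferred from the bounded version of the kernel, which agrees only almost
    everywhere. The extension of [K] by zero is jointly measurable, and represents
    [T u] at every point of ]0, b]. *)
Definition triangle_ext (b : R) (K : R -> R -> C) x t : C :=
  if (x, t) \in triangle b then K x t else 0.

Lemma triangle_ext_Re b K :
  (fun p => Re (triangle_ext b K p.1 p.2)) = (fun p => Re (K p.1 p.2)) \_ (triangle b).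
Proof. by apply/funext => -[x t]; rewrite patchE /triangle_ext/=; case: ifP. Qed.

Lemma triangle_ext_Im b K :
  (fun p => Im (triangle_ext b K p.1 p.2)) = (fun p => Im (K p.1 p.2)) \_ (triangle b).
Proof. by apply/funext => -[x t]; rewrite patchE /triangle_ext/=; case: ifP. Qed.

Lemma triangle_ext_measurable (b : R) K : in_Loo2 (triangle b) K ->
  measurable_kernel (triangle_ext b K).
Proof.
move=> [r i]; split; rewrite ?triangle_ext_Re ?triangle_ext_Im.
- by move: r; rewrite inE => /andP[]; rewrite inE.
- by move: i; rewrite inE => /andP[]; rewrite inE.
Qed.

(** The two integrands differ at [t = x] and [t = - x] only. *)
Lemma kint_triangle_ext (b : R) K x u : in_Loo2 (triangle b) K ->
  in_L2 `]- x, x[ (K x) -> 0 < x <= b -> cint `[- b, b] u ->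
  cintegral `]- x, x[ (fun t => K x t * u t) = kint (- b) b (triangle_ext b K) u x.
Proof.
move=> Koo K2 /andP[x0 xb] ui; have mk := triangle_ext_measurable Koo.
have sub : `]- x, x[ `<=` `[- b, b].
  by move=> t; rewrite /= !in_itv/= => /andP[? ?]; apply/andP; split; lra.
rewrite (cintegral_zext _ sub).
have -> : zext `]- x, x[ (fun t => K x t * u t) = fun t => zext `]- x, x[ (K x) t * u t.
  by apply/funext => t; exact: zext_mul.
apply: ae_eq_cintegral; first exact: mble_cc.
- by apply: cmfun_mul; [exact: cint_cmfun (in_L2_cint _ _ K2)|exact: cint_cmfun].
- by apply: cmfun_mul; [exact: measurable_kernel_section mk|exact: cint_cmfun].
- have := ae_and (ae_neq (- x)) (ae_neq x); apply: ae_imply => t [t1 t2] _.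
  congr (_ * _); rewrite /triangle_ext; have [tI|tI] := boolP (t \in `]- x, x[).
    rewrite zextE// mem_set//; split; first by rewrite /= x0.
    by rewrite /= ler_norml; move: tI; rewrite in_itv/= => /andP[/ltW-> /ltW->].
  rewrite /zext mem_setE (negbTE tI) memNset//= => -[_].
  rewrite ler_norml => /andP[xt tx]; move: tI.
  by rewrite in_itv/= !lt_neqAle eq_sym t1 xt t2 tx.
Qed.

Lemma bounded_kernel_version (b : R) (K : R -> R -> C) : in_Loo2 (triangle b) K ->
  exists k M, bounded_kernel k M /\
    {ae mu, forall x, forall u, cint `[- b, b] u ->
      kint (- b) b (triangle_ext b K) u x = kint (- b) b k u x}.
Proof.
move=> Koo; have mK := triangle_ext_measurable Koo.
move: (Koo) => [/bounded_version[G1 [M1 _ [mG1 bG1 E1]]] /bounded_version[G2 [M2 _ [mG2 bG2 E2]]]].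
pose k x t : C := G1 (x, t) +i* G2 (x, t).
have kM : bounded_kernel k (M1 + M2).
  split; last by move=> x t; apply: lerD; [exact: bG1|exact: bG2].
  split.
  - by have -> : (fun p => Re (k p.1 p.2)) = G1 by apply/funext => -[].
  - by have -> : (fun p => Im (k p.1 p.2)) = G2 by apply/funext => -[].
exists k, (M1 + M2); split => //.
have := ae_and E1 E2; apply: ae_imply => x [e1 e2] u ui.
apply: ae_eq_cintegral; first exact: mble_cc.
- by apply: cmfun_mul; [exact: measurable_kernel_section mK|exact: cint_cmfun].
- by apply: cmfun_mul; [exact: measurable_kernel_section kM.1|exact: cint_cmfun].
- have := ae_and e1 e2; apply: ae_imply => t [{}e1 {}e2] _; congr (_ * _).
  apply: complex_ext; rewrite /k/=.
    by rewrite -e1; have := congr1 (fun f => f (x, t)) (triangle_ext_Re b K).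
  by rewrite -e2; have := congr1 (fun f => f (x, t)) (triangle_ext_Im b K).
Qed.

End Kernels.

(** * The defect of the integrated equation *)

Section Defect.
Context {R : realType}.
Local Notation mu := (@lebesgue_measure R).
Local Notation C := R[i].
Local Notation Re := complex.Re.
Local Notation Im := complex.Im.
Local Notation mble A := (@measurable _ (measurableTypeR R) A).
Context (b : R) (N : nat) (xs : nat -> R) (alpha : nat -> C) (q : R -> C).
Hypothesis hI : interactions b N xs alpha.
Implicit Types (z : C) (V w u v r : R -> C) (x a c : R).

Local Notation slope := (slope xs alpha).

(** The amount by which [V] fails the integrated equation on the subinterval
    number [k]; it is jointly linear in [V], [w] and [s0]. *)
Definition defect V w (s0 : C) (k : nat) x : C :=
  V x - V (xs k) - slope V w s0 k * (x - xs k)%:C - cprim (xs k) (cprim (xs k) w) x.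

Let in0b k x : (k <= N)%N -> xs k <= x <= xs k.+1 -> 0 <= x <= b.
Proof.
move=> kN /andP[kx xk].
by rewrite (le_trans (xs_ge0 hI (leqW kN)) kx) (le_trans xk (xs_leb hI _)).
Qed.

Let xs0b k : (k <= N.+1)%N -> 0 <= xs k <= b.
Proof. by move=> kN; rewrite (xs_ge0 hI kN) (xs_leb hI kN). Qed.

Lemma defect_piecewise V w s0 :
  (forall k x, (k <= N)%N -> xs k <= x <= xs k.+1 -> defect V w s0 k x = 0) <->
  piecewise N xs alpha V w s0.
Proof.
split=> H k x kN xk; last by rewrite /defect (H k x kN xk); ring.
by apply/eqP; rewrite -subr_eq0 -(H k x kN xk) /defect; apply/eqP; ring.
Qed.

Lemma slope_eq V V' w w' s0 k : (forall x, 0 <= x <= b -> V x = V' x) ->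
  (forall x, 0 <= x <= b -> w x = w' x) -> (k <= N.+1)%N ->
  slope V w s0 k = slope V' w' s0 k.
Proof.
move=> VV ww; elim: k => [//|k IH] kN /=; rewrite IH ?(ltnW kN)// VV ?xs0b//.
congr (_ + _ + _); apply: eq_cintegral => t; rewrite /= in_itv/= => tk.
exact/ww/(in0b kN).
Qed.

Lemma defect_eq V V' w w' s0 k x : (forall x, 0 <= x <= b -> V x = V' x) ->
  (forall x, 0 <= x <= b -> w x = w' x) -> (k <= N)%N -> xs k <= x <= xs k.+1 ->
  defect V w s0 k x = defect V' w' s0 k x.
Proof.
move=> VV ww kN xk; rewrite /defect (slope_eq _ VV ww (leqW kN)).
rewrite (VV _ (in0b kN xk)) (VV _ (xs0b (leqW kN))); congr (_ - _).
have /andP[kx xk1] := xk.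
apply: eq_cintegral => t; rewrite /= in_itv/= => /andP[kt tx].
apply: eq_cintegral => y; rewrite /= in_itv/= => /andP[ky yt].
by apply/ww/(in0b kN); rewrite ky (le_trans yt (le_trans tx xk1)).
Qed.

Lemma piecewise_eq V V' w s0 : (forall x, 0 <= x <= b -> V x = V' x) ->
  piecewise N xs alpha V w s0 -> piecewise N xs alpha V' w s0.
Proof.
move=> VV /defect_piecewise H; apply/defect_piecewise => k x kN xk.
by rewrite -(H k x kN xk); apply: defect_eq => // y yb; rewrite VV.
Qed.

Lemma slope_lin V V' w w' s s' z k : cint `[0, b] w -> cint `[0, b] w' ->
  (k <= N.+1)%N ->
  slope (fun x => z * V x + V' x) (fun x => z * w x + w' x) (z * s + s') k =
  z * slope V w s k + slope V' w' s' k.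
Proof.
move=> wi wi'; elim: k => [//|k IH] kN /=; rewrite IH ?(ltnW kN)//.
rewrite (cprim_lin z (lexx _) (cint_piece hI kN wi) (cint_piece hI kN wi')); ring.
Qed.

Lemma defect_lin V V' w w' s s' z k x : cint `[0, b] w -> cint `[0, b] w' ->
  (k <= N)%N -> xs k <= x <= xs k.+1 ->
  defect (fun x => z * V x + V' x) (fun x => z * w x + w' x) (z * s + s') k x =
  z * defect V w s k x + defect V' w' s' k x.
Proof.
move=> wi wi' kN xk; rewrite /defect slope_lin ?leqW//.
have [+ _] := blf_cprim2 xk => /(_ z _ _ (cint_piece hI kN wi) (cint_piece hI kN wi')) ->.
by ring.
Qed.

Lemma defect_bound V w s k x : cint `[0, b] w -> (k <= N)%N -> xs k <= x <= xs k.+1 ->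
  N1 (defect V w s k x) <= N1 (V x) + N1 (V (xs k)) + N1 (slope V w s k) * b +
    b * \int[mu]_(t in `[0, b]) N1 (w t).
Proof.
move=> wi kN xk; have /andP[kx xk1] := xk.
have /andP[x0 xb] := in0b kN xk; have /andP[k0 kb] := xs0b (leqW kN).
have /andP[k10 k1b] := xs0b (kN : (k.+1 <= N.+1)%N).
rewrite /defect; apply: le_trans (N1D _ _) _; apply: lerD.
  apply: le_trans (N1D _ _) _; rewrite N1N; apply: lerD.
    by apply: le_trans (N1D _ _) _; rewrite N1N.
  apply: le_trans (N1M _ _) _; rewrite ler_wpM2l ?N1_ge0//.
  by rewrite N1_real ger0_norm; lra.
rewrite N1N; apply: le_trans (cprim2_bound xk (cint_piece hI kN wi)) _.
apply: ler_pM; rewrite ?nrm_ge0//; [lra|lra|exact: nrm_sub].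
Qed.

End Defect.

Section BoundedQuantities.
Context {R : realType} (a c : R).
Local Notation mu := (@lebesgue_measure R).
Local Notation C := R[i].
Local Notation nrm r := (\int[mu]_(x in `[a, c]) N1 (r x)).
Implicit Types (X Y : (R -> C) -> R).

(** Closure under sums and multiples yields bounds of composite quantities without explicit
    constants. *)
Definition bnd X := exists2 M : R, 0 <= M &
  forall r, cint `[a, c] r -> X r <= M * nrm r.

Lemma bnd_le Y X : (forall r, cint `[a, c] r -> X r <= Y r) -> bnd Y -> bnd X.
Proof. by move=> XY [M M0 YM]; exists M => // r ri; exact: le_trans (XY r ri) (YM r ri). Qed.

Lemma bnd_nrm (k : R) : bnd (fun r => k * nrm r).
Proof.
exists `|k| => // r _; rewrite ler_wpM2r ?nrm_ge0//; exact: ler_norm.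
Qed.

Lemma bnd_add X Y : bnd X -> bnd Y -> bnd (fun r => X r + Y r).
Proof.
move=> [M M0 XM] [M' M'0 YM]; exists (M + M') => [|r ri]; first exact: addr_ge0.
by rewrite mulrDl lerD ?XM ?YM.
Qed.

Lemma bnd_scale (k : R) X : 0 <= k -> bnd X -> bnd (fun r => k * X r).
Proof.
move=> k0 [M M0 XM]; exists (k * M) => [|r ri]; first exact: mulr_ge0.
by rewrite -mulrA ler_wpM2l// XM.
Qed.

End BoundedQuantities.

(** * The transmutation operator and the integrated equation *)

Section Transmutation.
Context {R : realType}.
Local Notation mu := (@lebesgue_measure R).
Local Notation C := R[i].
Local Notation Re := complex.Re.
Local Notation Im := complex.Im.
Local Notation mble A := (@measurable _ (measurableTypeR R) A).
Context (b : R) (q : R -> C) (N : nat) (xs : nat -> R) (alpha : nat -> C)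
  (h : C) (K k : R -> R -> C) (M : R).
Hypothesis b0 : 0 < b.
Hypothesis hq : in_L2 `]0, b[ q.
Hypothesis hI : interactions b N xs alpha.
Hypothesis Koo : in_Loo2 (triangle b) K.
Hypothesis K2 : forall x, 0 < x <= b -> in_L2 `]- x, x[ (K x).
Hypothesis Kexp : forall rho : C, exists e : R -> C,
  [/\ is_solution b q N xs alpha (rho ^+ 2) e, e 0 = 1,
      derivative_right e 0 ('i%C * rho + h)
    & forall x, 0 < x <= b -> e x = cexp ('i%C * rho * x%:C) +
        cintegral `]- x, x[ (fun t => K x t * cexp ('i%C * rho * t%:C))].
Hypothesis kM : bounded_kernel k M.
Hypothesis kK : {ae mu, forall x, forall u, cint `[- b, b] u ->
  kint (- b) b (triangle_ext b K) u x = kint (- b) b k u x}.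
Implicit Types (z d : C) (u v r w : R -> C) (x s : R).

(** Division by [s * p] in the relation given by the exponential
    [exp (s x)], where [p] is its value at [- b]. *)
Lemma cancel_real_scale (s p : R) (X L : C) : s != 0 -> p != 0 ->
  (s * p)%:C * X + (s ^+ 2)%:C * L = 0 -> X = (- (s * p^-1))%:C * L.
Proof.
move=> s0 p0 E; have n0 : (s * p)%:C != 0 :> C.
  by rewrite (fmorph_eq0 (real_complex R)) mulf_neq0.
have sp : (s * p)%:C * (s * p^-1)%:C = (s ^+ 2)%:C :> C.
  rewrite -[LHS](rmorphM (real_complex R)).
  by apply: (congr1 (real_complex R)); field.
apply: (mulfI n0); rewrite (rmorphN (real_complex R)) /= mulrA mulrN sp mulNr.
by apply/eqP; rewrite -addr_eq0 E.
Qed.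

Lemma cexp_real (s x : R) : cexp ('i%C * (- 'i%C * s%:C) * x%:C) = (expR (s * x))%:C.
Proof.
have -> : 'i%C * (- 'i%C * s%:C) * x%:C = (s * x)%:C :> C.
  by apply: complex_ext; rewrite !(Re_mul, Im_mul, Re_opp, Im_opp)/=; ring.
by rewrite /cexp /= sin0 cos0; apply: complex_ext; rewrite !(Re_mul, Im_mul)/=; ring.
Qed.

Local Notation T := (transmutation_operator K).
Local Notation S u := (kint (- b) b k u).
Local Notation nrm r := (\int[mu]_(x in `[- b, b]) N1 (r x)).
Local Notation U r := (cprim (- b) (cprim (- b) r)).
Local Notation ccont u := (ccontinuous_on `[- b, b] u).

Let bb : - b <= b. Proof. by rewrite ge0_cp// ltW. Qed.
Let M0 : 0 <= M.
Proof. by have [_ kb] := kM; exact: le_trans (N1_ge0 _) (kb 0 0). Qed.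

(** [q (T u) + T r], with the bounded version of the kernel inside [T]. *)
Definition source u r x : C :=
  zext `]0, b[ q x * (u x + S u x) + (r x + S r x).

Lemma T0 u : T u 0 = u 0.
Proof.
rewrite /transmutation_operator oppr0 /cintegral set_itvoo0.
by rewrite !Rintegral_set0 addr0.
Qed.

Lemma K_cint x : 0 < x <= b -> cint `]- x, x[ (K x).
Proof.
move=> xb; have Ki := in_L2_cint (- x) x (K2 xb).
have sub : `]- x, x[ `<=` `[- x, x].
  by move=> t; rewrite /= !in_itv/= => /andP[/ltW-> /ltW->].
have := cintS (@mble_cc R _ _) (measurable_itv _) sub Ki.
by apply: eq_cint; [exact: measurable_itv|move=> t tx; rewrite zextE].
Qed.

Let seg x t : 0 < x <= b -> `]- x, x[%classic t -> - b <= t <= b.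
Proof.
move=> /andP[x0 xb]; rewrite /= in_itv/= => /andP[xt tx].
by apply/andP; split; lra.
Qed.

Lemma Ku_cint x u : 0 < x <= b -> ccont u -> cint `]- x, x[ (fun t => K x t * u t).
Proof.
move=> xb cu; have [m _ um] := ccontinuous_bounded cu.
have mI : mble `]- x, x[ by exact: measurable_itv.
have cm : cmfun `]- x, x[ u.
  have [mr mi] := cint_cmfun (ccontinuous_cint cu).
  have sub : `]- x, x[ `<=` `[- b, b] by move=> t /(seg xb).
  by split; [move: mr|move: mi]; apply: measurable_funS.
have : cint `]- x, x[ (fun t => u t * K x t).
  apply: (@cint_mulb _ _ _ _ m) => //; last exact: K_cint.
  by move=> t /(seg xb); exact: um.
by apply: eq_cint => // t _; rewrite mulrC.
Qed.

Lemma T_lin u v z x : 0 <= x <= b -> ccont u -> ccont v ->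
  T (fun t => z * u t + v t) x = z * T u x + T v x.
Proof.
move=> /andP[]; rewrite le_eqVlt => /orP[/eqP<- _ _ _|x0 xb cu cv].
  by rewrite !T0.
have xI : 0 < x <= b by rewrite x0.
rewrite /transmutation_operator mulrDr addrACA; congr (_ + _).
rewrite -cintegral_lin; [|exact: measurable_itv|exact: Ku_cint..].
by apply: eq_cintegral => t _; ring.
Qed.

Lemma T_eq u v x : 0 <= x <= b -> (forall t, - b <= t <= b -> u t = v t) ->
  T u x = T v x.
Proof.
move=> /andP[]; rewrite le_eqVlt => /orP[/eqP<- _ uv|x0 xb uv].
  by rewrite !T0 uv// lerNl oppr0 !ltW.
have xI : 0 < x <= b by rewrite x0.
rewrite /transmutation_operator uv; last by apply/andP; split; lra.
by congr (_ + _); apply: eq_cintegral => t /(seg xI) tb; rewrite uv.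
Qed.

(** At a given [x] the kernel section is in [L^2], hence integrable, which bounds
    [T u x] by a constant depending on [x]. This suffices because the integrated
    equation contains [T u] at finitely many points only, and otherwise under an
    integral sign, where the bounded version of the kernel is used. *)
Lemma T_bound x : 0 <= x <= b -> exists2 m : R, 0 <= m & forall u (l : R), ccont u ->
  (forall t, - b <= t <= b -> N1 (u t) <= l) -> N1 (T u x) <= m * l.
Proof.
move=> /andP[]; rewrite le_eqVlt => /orP[/eqP<- _|x0 xb].
  by exists 1 => // u l _ ul; rewrite T0 mul1r ul// lerNl oppr0 !ltW.
have xI : 0 < x <= b by rewrite x0.
have mI : mble `]- x, x[ by exact: measurable_itv.
have iN := cint_N1 mI (K_cint xI).
exists (1 + \int[mu]_(t in `]- x, x[) N1 (K x t)) => [|u l cu ul].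
  by rewrite addr_ge0// Rintegral_ge0// => t _; exact: N1_ge0.
rewrite mulrDl mul1r; apply: le_trans (N1D _ _) _; apply: lerD.
  by apply: ul; apply/andP; split; lra.
rewrite mulrC -RintegralZl//; apply: cintegral_bound_le => //.
- exact: Ku_cint.
- by have := integrableZl mI l iN; apply: eq_integrable.
- move=> t /(seg xI) tb; apply: le_trans (N1M _ _) _.
  by rewrite mulrC ler_wpM2r ?N1_ge0// ul.
Qed.

Let qi : cint `[0, b] (zext `]0, b[ q). Proof. exact: in_L2_cint. Qed.

Let sub0b u : cint `[- b, b] u -> cint `[0, b] u.
Proof. by apply: cint_sub => //; rewrite lerNl oppr0 ltW. Qed.

Let S_cint u : cint `[- b, b] u -> cint `[0, b] (S u).
Proof.
move=> ui; apply: (@cint_dominated _ _ _ (fun=> M * nrm u)) => //.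
- exact: kint_cmfun kM.1 ui.
- by move=> x _; exact: kint_bound.
- exact: integrable_cc_cst.
Qed.

Lemma source_cint u r : ccont u -> cint `[- b, b] r -> cint `[0, b] (source u r).
Proof.
move=> cu ri; have ui := ccontinuous_cint cu.
have rS : cint `[0, b] (fun x => r x + S r x).
  exact: cint_add (@mble_cc R 0 b) (sub0b ri) (S_cint ri).
have [m _ um] := ccontinuous_bounded cu.
have uS : cmfun `[0, b] (fun x => u x + S u x).
  by apply: cmfun_add; [exact: cint_cmfun (sub0b ui)|exact: cint_cmfun (S_cint ui)].
have quS : cint `[0, b] (fun x => (u x + S u x) * zext `]0, b[ q x).
  apply: (@cint_mulb _ _ _ _ (m + M * nrm u)) => // x; rewrite /= in_itv/= => /andP[x0 xb].
  apply: le_trans (N1D _ _) _; apply: lerD; last exact: kint_bound.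
  by apply: um; apply/andP; split; lra.
have := cint_add (@mble_cc R 0 b) quS rS.
by apply: eq_cint => // x _; rewrite /source mulrC.
Qed.

(** For [r = u''] and [d = u'(0)], the defect of the integrated equation that
    [T u] is expected to satisfy. *)
Definition total u d r (j : nat) x : C :=
  defect xs alpha (T u) (source u r) (d + h * u 0) j x.

Let zero_seg : - b <= 0 <= b. Proof. by rewrite lerNl oppr0 !ltW. Qed.

Lemma total_eq u u' d d' r r' j x : (j <= N)%N -> xs j <= x <= xs j.+1 ->
  (forall t, - b <= t <= b -> u t = u' t) -> d = d' ->
  (forall t, - b <= t <= b -> r t = r' t) -> total u d r j x = total u' d' r' j x.
Proof.
move=> jN xj uu -> rr; rewrite /total (uu 0 zero_seg).
apply: (defect_eq hI _ _ _ jN xj); first by move=> t tb; exact: T_eq.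
have Seq v v' t : (forall t, - b <= t <= b -> v t = v' t) -> S v t = S v' t.
  by move=> vv; apply: eq_cintegral => y; rewrite /= in_itv/= => yb; rewrite vv.
move=> t /andP[t0 tb]; rewrite /source (Seq _ _ t uu) (Seq _ _ t rr).
have tI : - b <= t <= b by apply/andP; split; lra.
by rewrite (uu t tI) (rr t tI).
Qed.

Lemma total_lin u u' d d' r r' z j x : (j <= N)%N -> xs j <= x <= xs j.+1 ->
  ccont u -> ccont u' -> cint `[- b, b] r -> cint `[- b, b] r' ->
  total (fun t => z * u t + u' t) (z * d + d') (fun t => z * r t + r' t) j x =
  z * total u d r j x + total u' d' r' j x.
Proof.
move=> jN xj cu cu' ri ri'; have ui := ccontinuous_cint cu; have ui' := ccontinuous_cint cu'.
rewrite /total -(defect_lin hI _ _ _ _ _ (source_cint cu ri) (source_cint cu' ri') jN xj).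
have -> : z * d + d' + h * (z * u 0 + u' 0) = z * (d + h * u 0) + (d' + h * u' 0) by ring.
apply: (defect_eq hI _ _ _ jN xj) => t tb; first exact: T_lin.
rewrite /source (kint_lin kM t z ui ui') (kint_lin kM t z ri ri'); ring.
Qed.

Lemma U_cont r : cint `[- b, b] r -> ccont (U r).
Proof.
move=> ri; have := cprim_continuous 0 bb (cprim_cint bb ri).
by apply: eq_ccontinuous => x _; rewrite add0r.
Qed.

Let wid : b - - b = 2 * b. Proof. by rewrite opprK; ring. Qed.

Let U_bound r t : cint `[- b, b] r -> - b <= t <= b -> N1 (U r t) <= 2 * b * nrm r.
Proof. by move=> ri tb; rewrite -wid; exact: cprim2_bound. Qed.

Let nrm_U r : cint `[- b, b] r -> nrm (U r) <= 2 * b * (2 * b * nrm r).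
Proof.
move=> ri; rewrite mulrC -wid -Rintegral_cc_cst//; apply: le_Rintegral.
- exact: mble_cc.
- exact: cint_N1 (@mble_cc R _ _) (ccontinuous_cint (U_cont ri)).
- exact: integrable_cc_cst.
- by move=> t; rewrite /= in_itv/= wid; exact: U_bound.
Qed.

Let bnd_T y : 0 <= y <= b -> bnd (- b) b (fun r => N1 (T (U r) y)).
Proof.
move=> yb; have [m m0 Tm] := T_bound yb.
apply: bnd_le (bnd_nrm _ _ (m * (2 * b))) => r ri; rewrite -mulrA.
by apply: Tm => [|t tb]; [exact: U_cont|exact: U_bound].
Qed.

(** The factor of [q] is bounded in terms of the supremum of [u], which leaves
    the [L^1] norm of [q]. *)
Let source_bound u r (l : R) : ccont u -> cint `[- b, b] r ->
  (forall t, - b <= t <= b -> N1 (u t) <= l) ->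
  \int[mu]_(t in `[0, b]) N1 (source u r t) <=
  (l + M * nrm u) * \int[mu]_(t in `[0, b]) N1 (zext `]0, b[ q t) +
  (nrm r + b * (M * nrm r)).
Proof.
move=> cu ri ul; have ui := ccontinuous_cint cu; have m0b := @mble_cc R 0 b.
have iq := cint_N1 m0b qi; have ir := cint_N1 m0b (sub0b ri).
have icst : mu.-integrable `[0, b] (EFin \o (fun=> M * nrm r)).
  exact: integrable_cc_cst.
have ird := integrable_lin 1 m0b ir icst.
have ig := integrable_lin (l + M * nrm u) m0b iq ird.
apply: (@le_trans _ _ (\int[mu]_(t in `[0, b]) ((l + M * nrm u) * N1 (zext `]0, b[ q t) +
    (1 * N1 (r t) + M * nrm r)))).
  apply: le_Rintegral => //; first exact: cint_N1 m0b (source_cint cu ri).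
  move=> t; rewrite /= in_itv/= => /andP[t0 tb].
  have tI : - b <= t <= b by apply/andP; split; lra.
  rewrite /source mul1r; apply: le_trans (N1D _ _) _; apply: lerD.
    apply: le_trans (N1M _ _) _; rewrite mulrC ler_wpM2r ?N1_ge0//.
    by apply: le_trans (N1D _ _) _; apply: lerD; [exact: ul|exact: kint_bound].
  by apply: le_trans (N1D _ _) _; apply: lerD; [exact: lexx|exact: kint_bound].
rewrite (Rintegral_lin _ m0b iq ird) (Rintegral_lin _ m0b ir icst) mul1r lerD2l.
rewrite Rintegral_cc_cst ?subr0 ?(ltW b0)//.
apply: lerD; first by apply: (nrm_sub _ (lexx _) ri); rewrite lerNl oppr0 ltW.
by rewrite mulrC.
Qed.

Let bnd_source : bnd (- b) b (fun r => \int[mu]_(t in `[0, b]) N1 (source (U r) r t)).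
Proof.
pose Q := \int[mu]_(t in `[0, b]) N1 (zext `]0, b[ q t).
have Q0 : 0 <= Q by exact: nrm_ge0.
apply: bnd_le (bnd_nrm _ _ ((2 * b + M * (2 * b * (2 * b))) * Q + (1 + b * M))) => r ri.
apply: le_trans (source_bound (U_cont ri) ri (fun t => U_bound ri)) _.
have nr := nrm_ge0 (- b) b r.
have -> : ((2 * b + M * (2 * b * (2 * b))) * Q + (1 + b * M)) * nrm r =
  (2 * b * nrm r + M * (2 * b * (2 * b * nrm r))) * Q + (nrm r + b * (M * nrm r)) by ring.
by rewrite lerD2r ler_wpM2r// lerD2l ler_wpM2l// nrm_U.
Qed.

Let bnd_initial : bnd (- b) b (fun r => N1 (cprim (- b) r 0 + h * U r 0)).
Proof.
apply: bnd_le (bnd_nrm _ _ (1 + N1 h * (2 * b))) => r ri.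
rewrite mulrDl mul1r; apply: le_trans (N1D _ _) _; apply: lerD.
  by apply: cprim_bound => //; rewrite ltW.
apply: le_trans (N1M _ _) _; rewrite -mulrA ler_wpM2l ?N1_ge0//.
exact: U_bound.
Qed.

Let bnd_slope j : (j <= N.+1)%N -> bnd (- b) b (fun r =>
  N1 (slope xs alpha (T (U r)) (source (U r) r) (cprim (- b) r 0 + h * U r 0) j)).
Proof.
elim: j => [_|j IH jN]; first exact: bnd_initial.
have xj : 0 <= xs j.+1 <= b by rewrite (xs_ge0 hI jN) (xs_leb hI jN).
apply: bnd_le (bnd_add (bnd_add (IH (ltnW jN)) bnd_source)
  (bnd_scale (N1_ge0 (alpha j.+1)) (bnd_T xj))) => r ri /=.
apply: le_trans (N1D _ _) _; apply: lerD; last exact: N1M.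
apply: le_trans (N1D _ _) _; rewrite lerD2l.
apply: cintegral_bound_sub (source_cint (U_cont ri) ri); last exact: (xs_leb hI jN).
exact: (xs_ge0 hI (ltnW jN)).
Qed.

(** Since [U r] is bounded by a multiple of the [L^1] norm of [r], each
    ingredient of the defect of [U r] is. *)
Lemma blf_total j x : (j <= N)%N -> xs j <= x <= xs j.+1 ->
  blf (- b) b (fun r => total (U r) (cprim (- b) r 0) r j x).
Proof.
move=> jN xj; have /andP[jx xj1] := xj.
have jb : 0 <= xs j <= b by rewrite (xs_ge0 hI (leqW jN)) (xs_leb hI (leqW jN)).
have xb : 0 <= x <= b.
  have /andP[j0 _] := jb; rewrite (le_trans j0 jx) (le_trans xj1)//.
  exact: (xs_leb hI).
split=> [z f g fi gi|].
  rewrite -(total_lin _ _ z jN xj (U_cont fi) (U_cont gi) fi gi).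
  apply: total_eq => // [t tb|]; first exact: (blf_cprim2 tb).1.
  by apply: (@cprim_lin _ _ b) => //; exact: ltW.
have [] := bnd_add (bnd_add (bnd_add (bnd_T xb) (bnd_T jb))
   (bnd_scale (ltW b0) (bnd_slope (leqW jN)))) (bnd_scale (ltW b0) bnd_source).
move=> m m0 H; exists m => // r ri; apply: le_trans _ (H r ri).
apply: le_trans (defect_bound hI _ _ (source_cint (U_cont ri) ri) jN xj) _.
by rewrite [X in _ + X + _]mulrC.
Qed.

Let es s x : C := (expR (s * x))%:C.

Let es_cont s : ccont (es s).
Proof. by apply: ccontinuous_real; exact: continuous_exp_scale. Qed.

(** The integrated equation holds for exponentials: this is the defining
    property of the kernel, at [rho = - i s]. *)
Lemma total_exp s j x : (j <= N)%N -> xs j <= x <= xs j.+1 ->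
  total (es s) s%:C (fun t => (s ^+ 2)%:C * es s t) j x = 0.
Proof.
move=> jN xj; have [e [[edom eL] e0 e'0 eE]] := Kexp (- 'i%C * s%:C).
have eT y : 0 <= y <= b -> e y = T (es s) y.
  move=> /andP[]; rewrite le_eqVlt => /orP[/eqP<- _|y0 yb].
    by rewrite T0 e0 /es mulr0 expR0.
  rewrite eE ?y0// cexp_real; congr (_ + _).
  by apply: eq_cintegral => t _; rewrite cexp_real.
have esi := ccontinuous_cint (es_cont s).
have ri := cint_scale (s ^+ 2)%:C (@mble_cc R _ _) esi.
have p : piecewise N xs alpha e (source (es s) (fun t => (s ^+ 2)%:C * es s t))
    (s%:C + h * es s 0).
  apply: (solution_piecewise hI edom eL).
  - have -> : s%:C + h * es s 0 = 'i%C * (- 'i%C * s%:C) + h; last exact: e'0.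
    rewrite /es mulr0 expR0 mulr1; congr (_ + _).
    by apply: complex_ext; rewrite !(Re_mul, Im_mul, Re_opp, Im_opp)/=; ring.
  - exact: source_cint.
  - apply: ae_imply kK => y Ky /andP[y0 yb].
    have yI : 0 < y <= b by rewrite y0 ltW.
    have yI' : 0 <= y <= b by rewrite !ltW.
    have TE : e y = es s y + S (es s) y.
      by rewrite eT// -Ky// -kint_triangle_ext//; exact: K2.
    have SE : S (fun t => (s ^+ 2)%:C * es s t) y = (s ^+ 2)%:C * S (es s) y.
      rewrite -cintegral_scale; [|exact: mble_cc|exact: (kint_cint kM y esi)].
      by apply: eq_cintegral => t _; ring.
    rewrite /source SE zextE; last by rewrite /= in_itv/= y0.
    rewrite -TE -mulrDr -TE.
    have -> : (- 'i%C * s%:C) ^+ 2 = - (s ^+ 2)%:C :> C.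
      by apply: complex_ext; rewrite expr2 !(Re_mul, Im_mul, Re_opp, Im_opp)/=; ring.
    by rewrite mulNr opprK.
by have /defect_piecewise := piecewise_eq hI eT p; apply.
Qed.

Let lin x : C := (x - - b)%:C.

Let lin_cont : ccont lin.
Proof.
apply: ccontinuous_real => x; apply: cvgB; [exact: cvg_id|exact: cvg_cst].
Qed.

Let cst_cont z : ccont (fun=> z).
Proof. by split => y; exact: cvg_cst. Qed.

Let cint0b : cint `[- b, b] (fun=> (0 : C)). Proof. exact: cint_cst. Qed.

(** Separates the contribution of the constants, of [x + b] and of the double
    primitive of [r]. *)
Let affine_total A B u d r (j : nat) x : (j <= N)%N -> xs j <= x <= xs j.+1 ->
  cint `[- b, b] r -> d = B + cprim (- b) r 0 ->
  (forall t, - b <= t <= b -> u t = A + B * lin t + U r t) ->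
  total u d r j x = A * total (fun=> 1) 0 (fun=> 0) j x +
    (B * total lin 1 (fun=> 0) j x + total (U r) (cprim (- b) r 0) r j x).
Proof.
move=> jN xj ri dE uE; have cU := U_cont ri.
have cBU : ccont (fun t => B * lin t + U r t) by exact: ccontinuous_lin.
have rE : cint `[- b, b] (fun t => B * 0 + r t) by exact: cint_lin (@mble_cc R _ _) cint0b ri.
have E1 := total_lin 1 (cprim (- b) r 0) B jN xj lin_cont cU cint0b ri.
have E2 := total_lin 0 (B * 1 + cprim (- b) r 0) A jN xj (cst_cont 1) cBU cint0b rE.
rewrite E1 in E2; apply: etrans E2.
apply: (total_eq jN xj).
- by move=> t tb; rewrite uE//; ring.
- by rewrite dE; ring.
- by move=> t _; ring.
Qed.

Let prim_expS s x : - b <= x ->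
  cprim (- b) (fun t => (s ^+ 2)%:C * es s t) x =
  (s * expR (s * x) - s * expR (s * - b))%:C.
Proof.
move=> bx; apply: complex_ext; rewrite /cprim /cintegral /=.
  have F := @FTC2_prim R (- b) x (fun y => s * expR (s * y)) (fun y => s ^+ 2 * expR (s * y)) bx.
  apply: etrans (F _ _).
  - by apply: eq_Rintegral => y _; rewrite mul0r subr0.
  - by move=> y; apply: cvgM; [exact: cvg_cst|exact: continuous_exp_scale].
  - move=> y; have := is_derive_exp_scale s y => ?.
    by apply: is_derive_eq; rewrite /GRing.scale/= expr2 mulrA.
rewrite (@eq_Rintegral _ _ _ _ _ (fun=> 0)); last by move=> y _; rewrite mulr0 mul0r addr0.
by rewrite (@Rintegral_cst _ _ _ mu _ (@mble_cc R _ _) 0) mul0r.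
Qed.

(** Taylor's formula for [exp (s x)] at [- b], with integral remainder. *)
Let es_decomp s t : - b <= t <= b -> es s t =
  (expR (s * - b))%:C + (s * expR (s * - b))%:C * lin t +
    U (fun t => (s ^+ 2)%:C * es s t) t.
Proof.
move=> /andP[bt tb].
have -> : U (fun t => (s ^+ 2)%:C * es s t) t =
    (expR (s * t) - expR (s * - b) - s * expR (s * - b) * (t - - b))%:C.
  transitivity (cprim (- b) (fun x => (s * expR (s * x) - s * expR (s * - b))%:C) t).
    by apply: eq_cintegral => y; rewrite /= in_itv/= => /andP[by_ _]; exact: prim_expS.
  apply: complex_ext; rewrite /cprim /cintegral /=.
    have F := @FTC2_prim R (- b) t (fun y => expR (s * y) - s * expR (s * - b) * (y - - b))
      (fun y => s * expR (s * y) - s * expR (s * - b)) bt.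
    apply: etrans (F _ _) _.
    - move=> y; apply: cvgB; last exact: cvg_cst.
      by apply: cvgM; [exact: cvg_cst|exact: continuous_exp_scale].
    - move=> y; have := is_derive_exp_scale s y => ?.
      by apply: is_derive_eq; rewrite /GRing.scale/=; ring.
    - by rewrite subrr mulr0 subr0; ring.
  by rewrite (@Rintegral_cst _ _ _ mu _ (@mble_cc R _ _) 0) mul0r.
by rewrite /es /lin; apply: complex_ext; rewrite !(Re_add, Im_add, Re_mul, Im_mul)/=; ring.
Qed.

Let es_slope s : s%:C = (s * expR (s * - b))%:C +
  cprim (- b) (fun t => (s ^+ 2)%:C * es s t) 0.
Proof.
rewrite prim_expS; last by rewrite lerNl oppr0 ltW.
by rewrite mulr0 expR0; apply: complex_ext; rewrite !(Re_add, Im_add)/=; ring.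
Qed.

(** The relation for exponentials at [s = 0]. *)
Let total_one j x : (j <= N)%N -> xs j <= x <= xs j.+1 ->
  total (fun=> 1) 0 (fun=> 0) j x = 0.
Proof.
move=> jN xj; rewrite -[RHS](total_exp 0 jN xj); apply: total_eq => //.
- by move=> t _; rewrite /es mul0r expR0.
- by move=> t _; rewrite expr0n/= mul0r.
Qed.

(** What [total_exp] says once the affine part of the exponential is separated
    and the constants are known to contribute nothing. *)
Let exp_relation s j x : (j <= N)%N -> xs j <= x <= xs j.+1 ->
  (s * expR (s * - b))%:C * total lin 1 (fun=> 0) j x +
  (s ^+ 2)%:C * total (U (es s)) (cprim (- b) (es s) 0) (es s) j x = 0.
Proof.
move=> jN xj; have esi := ccontinuous_cint (es_cont s).
have ri := cint_scale (s ^+ 2)%:C (@mble_cc R _ _) esi.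
have := affine_total jN xj ri (es_slope s) (fun t => @es_decomp s t).
have E1 := total_exp s jN xj; have E2 := total_one jN xj.
have E3 := blf_scale_arg (s ^+ 2)%:C (blf_total jN xj) esi.
by rewrite E1 E2 mulr0 add0r => E; rewrite [RHS]E -E3.
Qed.

(** The integrated equation is exact on the function [x + b]: divide the relation
    for [exp (s x)] by [s] and let [s] tend to 0. *)
Let total_affine j x : (j <= N)%N -> xs j <= x <= xs j.+1 ->
  total lin 1 (fun=> 0) j x = 0.
Proof.
move=> jN xj; have [_ [m m0 Lm]] := blf_total jN xj.
set X := total _ _ _ _ _.
pose Q := expR b * (m * (expR b * (2 * b))).
have Q0 : 0 <= Q by rewrite !mulr_ge0 ?expR_ge0// ltW.
have bnd_s s : 0 < s <= 1 -> N1 X <= s * Q.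
  move=> /andP[s0 s1]; have := exp_relation s jN xj; rewrite -/X.
  set L := total _ _ _ _ _ => E.
  have NL : N1 L <= m * (expR b * (2 * b)).
    apply: le_trans (Lm _ (ccontinuous_cint (es_cont s))) _; rewrite ler_wpM2l//.
    rewrite -wid -Rintegral_cc_cst//; apply: le_Rintegral.
    - exact: mble_cc.
    - exact: cint_N1 (@mble_cc R _ _) (ccontinuous_cint (es_cont s)).
    - exact: integrable_cc_cst.
    - move=> t; rewrite /= in_itv/= => /andP[bt tb]; rewrite N1_real.
      by rewrite ger0_norm ?expR_ge0// ler_expR; nra.
  have XE : X = (- (s * expR (s * b)))%:C * L.
    have -> : expR (s * b) = (expR (s * - b))^-1 by rewrite mulrN expRN invrK.
    by apply: cancel_real_scale E; rewrite gt_eqF ?expR_gt0.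
  rewrite XE; apply: le_trans (N1M _ _) _.
  rewrite N1_real normrN ger0_norm ?mulr_ge0 ?expR_ge0 ?(ltW s0)// /Q mulrA.
  apply: ler_pM => //; rewrite ?mulr_ge0 ?expR_ge0 ?N1_ge0 ?(ltW s0)//.
  apply: ler_wpM2l; first exact: ltW.
  by rewrite ler_expR ler_piMl// ltW.
apply: N1_eq0; apply/ler_addgt0Pr => eta eta0; rewrite add0r.
have Q1 : 0 < Q + 1 by rewrite ltr_wpDl.
pose s := Num.min 1 (eta / (Q + 1)).
have s0 : 0 < s by rewrite lt_min ltr01 divr_gt0.
apply: le_trans (bnd_s s _) _; first by rewrite s0 /s ge_min lexx.
have : s <= eta / (Q + 1) by rewrite /s ge_min lexx orbT.
rewrite ler_pdivlMr// => H; nra.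
Qed.

(** As [x + b] contributes nothing, [exp_relation] says that the functional of
    [blf_total] vanishes on [exp (s x)] for [s != 0]; such a functional is zero. *)
Lemma total_zero A B u d r (j : nat) x : (j <= N)%N -> xs j <= x <= xs j.+1 ->
  cint `[- b, b] r -> d = B + cprim (- b) r 0 ->
  (forall t, - b <= t <= b -> u t = A + B * (t - - b)%:C + U r t) ->
  total u d r j x = 0.
Proof.
move=> jN xj ri dE uE; rewrite (affine_total jN xj ri dE uE).
rewrite total_one// total_affine// !mulr0 !add0r.
apply: (blf_exp_total bb (blf_total jN xj)) ri => s s0.
have := exp_relation s jN xj; rewrite total_affine// mulr0 add0r => /eqP.
rewrite mulf_eq0 => /orP[|/eqP//]; rewrite -(rmorph0 (real_complex R)).
by rewrite (inj_eq (fmorph_inj _)) sqrf_eq0 (negbTE s0).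
Qed.

Lemma transmutation_piecewise A B u r : cint `[- b, b] r ->
  (forall t, - b <= t <= b -> u t = A + B * (t - - b)%:C + U r t) ->
  piecewise N xs alpha (T u) (source u r) (B + cprim (- b) r 0 + h * u 0).
Proof.
by move=> ri uE; apply/defect_piecewise => j x jN xj; exact: total_zero uE.
Qed.

End Transmutation.

(** * Square integrability of the transmuted functions *)

Section TransmutationL2.
Context {R : realType}.
Local Notation mu := (@lebesgue_measure R).
Local Notation C := R[i].
Local Notation mble A := (@measurable _ (measurableTypeR R) A).
Context (b : R) (q : R -> C) (K k : R -> R -> C) (M : R).
Hypothesis b0 : 0 < b.
Hypothesis hq : in_L2 `]0, b[ q.
Hypothesis Koo : in_Loo2 (triangle b) K.
Hypothesis K2 : forall x, 0 < x <= b -> in_L2 `]- x, x[ (K x).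
Hypothesis kM : bounded_kernel k M.
Hypothesis kK : {ae mu, forall x, forall u, cint `[- b, b] u ->
  kint (- b) b (triangle_ext b K) u x = kint (- b) b k u x}.
Implicit Types (u v r w : R -> C) (x : R).

Local Notation T := (transmutation_operator K).
Local Notation I0 := `]0, b[.

Let mI : mble `]0, b[. Proof. exact: measurable_itv. Qed.

Let I0P x : `]0, b[%classic x -> 0 < x <= b.
Proof. by rewrite /= in_itv/= => /andP[-> /ltW->]. Qed.

Lemma T_triangle_ext u x : cint `[- b, b] u -> 0 < x <= b ->
  T u x = u x + kint (- b) b (triangle_ext b K) u x.
Proof. by move=> ui xb; rewrite -kint_triangle_ext//; exact: K2. Qed.

Let kint_L2 u : cint `[- b, b] u -> in_L2 `]0, b[ (kint (- b) b k u).
Proof.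
move=> ui; apply: in_L2_bounded (fun x _ => kint_bound kM x ui).
exact: kint_cmfun kM.1 ui.
Qed.

Lemma source_L2 u r : ccontinuous_on `[- b, b] u -> cint `[- b, b] r ->
  in_L2 `]0, b[ r -> in_L2 `]0, b[ (source b q k u r).
Proof.
move=> cu ri r2; have ui := ccontinuous_cint cu; have [m _ um] := ccontinuous_bounded cu.
have sub : `]0, b[ `<=` `[- b, b].
  by move=> x; rewrite /= !in_itv/= => /andP[x0 xb]; apply/andP; split; lra.
apply: in_L2_add => //; last by apply: in_L2_add => //; exact: kint_L2.
apply: (@in_L2_mulb _ _ (m + M * \int[mu]_(t in `[- b, b]) N1 (u t))) => //.
- apply: cmfun_add; last exact: kint_cmfun kM.1 ui.
  by have [ur uI] := cint_cmfun ui; split; [move: ur|move: uI]; apply: measurable_funS.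
- move=> x xI; apply: le_trans (N1D _ _) _; apply: lerD; last exact: kint_bound.
  by apply: um; have := sub x xI; rewrite /= in_itv.
- by apply: in_L2_eq hq => x xI; rewrite zextE.
Qed.

(** The integral part is almost everywhere equal to the one given by the bounded
    kernel, which is bounded, and it is measurable in its own right. *)
Lemma T_L2 u : cint `[- b, b] u -> in_L2 `]0, b[ u -> in_L2 `]0, b[ (T u).
Proof.
move=> ui u2; apply: (@in_L2_eq _ _ (fun x => u x + kint (- b) b (triangle_ext b K) u x)).
  by move=> x /I0P xI; exact: T_triangle_ext.
apply: in_L2_add => //; apply: in_L2_ae_eq (kint_L2 ui) => //.
- exact: kint_cmfun (triangle_ext_measurable Koo) ui.
- by apply: ae_imply kK => x /(_ _ ui).
Qed.

Lemma source_ae u r : cint `[- b, b] u -> cint `[- b, b] r ->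
  {ae mu, forall x, 0 < x < b -> source b q k u r x = q x * T u x + T r x}.
Proof.
move=> ui ri; apply: ae_imply kK => x Kx /andP[x0 xb].
have xI : 0 < x <= b by rewrite x0 ltW.
rewrite /source zextE; last by rewrite /= in_itv/= x0.
by rewrite !T_triangle_ext// !Kx.
Qed.

(** For [x < b] the operator does not see the behaviour of [u] at [- b] and
    [b]. *)
Lemma T_zext u x : 0 < x < b ->
  T (zext `]- b, b[ u) x = T u x.
Proof.
move=> /andP[x0 xb]; have xI t : - x <= t <= x -> `]- b, b[%classic t.
  by move=> /andP[xt tx]; rewrite /= in_itv/=; apply/andP; split; lra.
rewrite /transmutation_operator zextE; last by apply: xI; apply/andP; split; lra.
congr (_ + _); apply: eq_cintegral => t; rewrite /= in_itv/= => /andP[/ltW xt /ltW tx].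
by rewrite zextE//; apply: xI; rewrite xt.
Qed.

End TransmutationL2.

Set Strict Implicit.
Unset Implicit Arguments.

Theorem theorem29 (R : realType) (b : R) (q : R -> R[i]) (N : nat)
    (xs : nat -> R) (alpha : nat -> R[i])
    (hb : 0 < b) (hq : in_L2 `]0, b[ q) (hN : (0 < N)%N)
    (hI : interactions b N xs alpha)
    (f : R -> R[i]) (hf : is_solution b q N xs alpha 0 f)
    (hf_neq0 : forall x, 0 <= x <= b -> f x != 0) (hf0 : f 0 = 1)
    (h : R[i]) (hh : derivative_right f 0 h)
    (K : R -> R -> R[i]) (hK : transmutation_kernel b q N xs alpha h K)
    (u : R -> R[i]) (hu_cont : ccontinuous_on `[- b, b] u)
    (hu : in_H2 (- b) b u) :
  in_domain b N xs alpha (transmutation_operator K u) /\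
  forall D2u : R -> R[i], second_derivative (- b) b u D2u ->
    L_equals b q N xs (transmutation_operator K u)
      (fun x => - transmutation_operator K D2u x).
Proof.
have [Koo K2 Kexp] := hK.
have [k [M [kM kK]]] := bounded_kernel_version Koo.
have bb : - b < b by rewrite gt0_cp.
have mI : @measurable _ (measurableTypeR R) `]0, b[ by exact: measurable_itv.
have sub : `]0, b[ `<=` `]- b, b[.
  by move=> x; rewrite /= !in_itv/= => /andP[x0 ->]; rewrite andbT; lra.
have solves (w : R -> R[i]) : second_derivative (- b) b u w ->
    in_domain b N xs alpha (transmutation_operator K u) /\
    L_equals b q N xs (transmutation_operator K u) (fun x => - transmutation_operator K w x).
  move=> uw; have [A [B uE]] := second_derivative_primitive bb hu_cont uw.
  have w2 : in_L2 `]- b, b[ w by have [v []] := uw.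
  pose r := zext `]- b, b[ w.
  have ri : cint `[- b, b] r by exact: in_L2_cint.
  have ui := ccontinuous_cint hu_cont.
  have r2 : in_L2 `]0, b[ r.
    by apply: in_L2_eq (in_L2_sub mI sub w2) => x /sub xb; rewrite /r zextE.
  have pV := transmutation_piecewise hb hq hI Koo K2 Kexp kM kK ri uE.
  have si := source_cint hb hq kM hu_cont ri.
  have s2 := source_L2 hq kM hu_cont ri r2.
  split; first exact (piecewise_in_domain hI si pV s2).
  apply: (piecewise_L_equals hI si pV s2).
    apply: (@in_L2_eq _ _ (fun x => transmutation_operator K r x * - 1)).
      by move=> x; rewrite /= in_itv/= => xb; rewrite T_zext// mulrN1.
    apply: (@in_L2_mulb _ _ (N1 (- 1 : R[i]))) => //.
    exact (T_L2 Koo K2 kM kK ri r2).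
  apply: ae_imply (source_ae q Koo K2 kK ui ri) => x sx xb.
  by rewrite opprK sx// T_zext.
split; last by move=> w /solves[].
by have [v [w vw]] := hu; have [] := solves w (ex_intro _ v vw).
Qed.
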